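(* Let $i\ge j\ge0$ and $m,n\ge0$ be integers, let $a\in\mathcal{R}_n$ with $\mathrm{ord}(a)=i$ and $b\in\mathcal{R}_m$ with $\mathrm{ord}(b)=j$ (so $\mathrm{top}(a)\in\mathcal{M}_{n-2i}$, $\mathrm{top}(b)\in\mathcal{M}_{m-2j}$), let $d\in\mathcal{M}_l$ be a common divisor of $\mathrm{top}(a)$ and $\mathrm{top}(b)$, and let $a'\in\mathcal{M}_{n-2i-l}$, $b'\in\mathcal{M}_{m-2j-l}$ satisfy $\mathrm{top}(a)=a'd$, $\mathrm{top}(b)=b'd$. Put $p=(m-2j)(i-j+1)-l-m+n$ and $q=(m-2j)(i-j+1)-l+n$. Then: (1) $\mathrm{top}(b)^{i-j}b'a=cb+c'$ for some $c\in\mathcal{R}_p$ with $\mathrm{ord}(c)=i-j$ and some $c'\in\mathcal{R}_q$ with $\mathrm{ord}(c')<j$; (2) $a\,\mathrm{top}(b)^{i-j}b'=bc+c'$ for some $c\in\mathcal{R}_p$ with $\mathrm{ord}(c)=i-j$ and some $c'\in\mathcal{R}_q$ with $\mathrm{ord}(c')<j$.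
   Context: Let $\mathrm{Hol}$ be the space of holomorphic functions on the upper half plane, $q=e^{2\pi iz}$ (as a variable), $f'=\frac{1}{2\pi i}\frac{df}{dz}$, and $E_2,E_4,E_6$ the Eisenstein series with constant term $1$. For $k\in\mathbb{R}$ let $D_kf=f'-\frac{k}{12}E_2f$. Let $H=\bigoplus_{n\in\mathbb{R}}H_n$ where each $H_n$ is a copy of $\mathrm{Hol}$, elements written $(f,n)$, with product $(f,n)(g,m)=(fg,n+m)$. $\mathrm{End}^i(H)$ denotes the $\mathbb{C}$-linear maps sending each $H_n$ into $H_{n+i}$ and $\mathrm{End}(H)=\bigoplus_i\mathrm{End}^i(H)$. Define $\delta(f,n)=(D_nf,n+2)$, $e_4(f,n)=(E_4f,n+4)$, $e_6(f,n)=(E_6f,n+6)$; $\mathcal{R}=\bigoplus_k\mathcal{R}_k$ is the $\mathbb{C}$-subalgebra of $\mathrm{End}(H)$ generated by $\delta,e_4,e_6$, graded by weight ($\mathcal{R}_k=\mathcal{R}\cap\mathrm{End}^k(H)$). The graded ring $\mathcal{M}=\mathbb{C}[E_4,E_6]=\bigoplus_k\mathcal{M}_k$ of level-one holomorphic modular forms is identified with the subalgebra of $\mathcal{R}$ generated by $e_4,e_6$ via $E_4\mapsto e_4$, $E_6\mapsto e_6$. Every nonzero $a\in\mathcal{R}$ has a unique expression $a=a_n\delta^n+\cdots+a_0$ with $a_i\in\mathcal{M}$, $a_n\neq0$; $\mathrm{top}(a)=a_n$, $\mathrm{ord}(a)=n$, and $\mathrm{ord}(0)=-\infty$. Here the letter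 $q$ in the claim denotes the integer defined there. *)

(* Defs.v *)
From Stdlib Require Import Reals ZArith List ClassicalEpsilon.
From Coquelicot Require Import Coquelicot.
Import ListNotations.

Open Scope R_scope.

Definition inH (z : C) : Prop := 0 < Im z.

Definition holo (f : C -> C) : Prop :=
  forall z, inH z -> exists l : C, @is_derive C_AbsRing C_NormedModule f z l.

(** The complex derivative df/dz (chosen; unique where it exists). *)
Definition cderiv (f : C -> C) (z : C) : C :=
  epsilon (inhabits (RtoC 0))
    (fun l : C => @is_derive C_AbsRing C_NormedModule f z l).

Definition Csum (a : nat -> C) : C :=
  (Series (fun k => Re (a k)), Series (fun k => Im (a k))).

Definition sigma (r n : nat) : R :=
  fold_right Rplus 0
    (map (fun d => if Nat.eqb (Nat.modulo n d) 0 then INR d ^ r else 0)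
         (seq 1 n)).

(** q^n where q = exp(2 pi i z). *)
Definition qpow (z : C) (n : nat) : C :=
  (exp (- 2 * PI * INR n * Im z) * cos (2 * PI * INR n * Re z),
   exp (- 2 * PI * INR n * Im z) * sin (2 * PI * INR n * Re z)).

Definition Eis (c : R) (r : nat) (z : C) : C :=
  (RtoC 1 + RtoC c * Csum (fun k => RtoC (sigma r (S k)) * qpow z (S k)))%C.

Definition E2 : C -> C := Eis (-24) 1.
Definition E4 : C -> C := Eis 240 3.
Definition E6 : C -> C := Eis (-504) 5.

Definition dq (f : C -> C) (z : C) : C :=
  (cderiv f z / (RtoC (2 * PI) * Ci))%C.

Definition Dk (k : R) (f : C -> C) (z : C) : C :=
  (dq f z - RtoC (k / 12) * E2 z * f z)%C.

(** * Homogeneous operators on H = (+)_{n in R} H_n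

   An operator [T : Op] of weight [w] sends (f, n) to (T n f, n + w).
   Hol is represented by functions C -> C; only their values on the upper
   half plane matter, and operators are compared on holomorphic inputs
   (see [op_eq]). *)
Definition Op := R -> (C -> C) -> (C -> C).

Definition op_eq (T U : Op) : Prop :=
  forall (n : R) (f : C -> C), holo f -> forall z, inH z -> T n f z = U n f z.

Definition zero_op : Op := fun _ _ _ => RtoC 0.
Definition op_add (T U : Op) : Op := fun n f z => (T n f z + U n f z)%C.

(** Product in End(H): [rcomp w2 T U] = T o U where U has weight w2. *)
Definition rcomp (w2 : Z) (T U : Op) : Op := fun n f => T (n + IZR w2) (U n f).

(** Multiplication operator by a function (the identification M -> R). *)
Definition mul_op (g : C -> C) : Op := fun _ f z => (g z * f z)%C.

Definition fmul (f g : C -> C) : C -> C := fun z => (f z * g z)%C.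
Definition fpow (f : C -> C) (k : nat) : C -> C := fun z => @pow_n C_Ring (f z) k.

Definition delta : Op := fun n f => Dk n f.

Fixpoint dpow (k : nat) : Op :=
  match k with
  | O => fun _ f => f
  | S k' => rcomp (2 * Z.of_nat k') delta (dpow k')
  end.

Inductive inR : Z -> Op -> Prop :=
| inR_zero k : inR k zero_op
| inR_scal (c : C) : inR 0 (fun _ f z => (c * f z)%C)
| inR_delta : inR 2 delta
| inR_e4 : inR 4 (mul_op E4)
| inR_e6 : inR 6 (mul_op E6)
| inR_add k T U : inR k T -> inR k U -> inR k (op_add T U)
| inR_comp k1 k2 T U : inR k1 T -> inR k2 U -> inR (k1 + k2) (rcomp k2 T U).

Inductive inM : (C -> C) -> Prop :=
| inM_const (c : C) : inM (fun _ => c)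
| inM_E4 : inM E4
| inM_E6 : inM E6
| inM_add f g : inM f -> inM g -> inM (fun z => (f z + g z)%C)
| inM_mul f g : inM f -> inM g -> inM (fmul f g).

Inductive inMk : Z -> (C -> C) -> Prop :=
| inMk_zero k : inMk k (fun _ => RtoC 0)
| inMk_const (c : C) : inMk 0 (fun _ => c)
| inMk_E4 : inMk 4 E4
| inMk_E6 : inMk 6 E6
| inMk_add k f g : inMk k f -> inMk k g -> inMk k (fun z => (f z + g z)%C)
| inMk_mul k1 k2 f g : inMk k1 f -> inMk k2 g -> inMk (k1 + k2) (fmul f g).

Definition eqH (f g : C -> C) : Prop := forall z, inH z -> f z = g z.

Definition expand (s : nat -> C -> C) (i : nat) : Op :=
  fun n f z => sum_n (G := C_AbelianMonoid)
                 (fun k => (s k z * dpow k n f z)%C) i.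

Definition has_ord_top (a : Op) (i : nat) (t : C -> C) : Prop :=
  exists s : nat -> C -> C,
    (forall k, (k <= i)%nat -> inM (s k)) /\ s i = t /\
    ~ op_eq (mul_op t) zero_op /\ op_eq a (expand s i).

Definition has_ord (a : Op) (i : nat) : Prop := exists t, has_ord_top a i t.

(** ord(a) < j  (ord 0 = -infinity). *)
Definition ord_lt (a : Op) (j : nat) : Prop :=
  op_eq a zero_op \/ exists i', (i' < j)%nat /\ has_ord a i'.

(* Main.v *)
(** Ramanujan's identities [E4' = (E2 E4 - E6) / 3] and [E6' = (E2 E6 - E4^2) / 2]
    give [delta g = g delta + (D_k g)] with [D_k g] again modular for [g] of weight [k],
    so that operators have normal forms with modular coefficients, and the top of a
    composition is the product of the tops. Both parts are then Euclidean
    pseudo-division: [b' a - a' delta^(i-j) b] has order [< i] because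
    [b' top(a) = a' top(b)], and each of the [i - j] further steps multiplies by [top(b)]
    and lowers the order by one; for (2) the factors are applied on the other side.

    The analytic inputs are: the derivative of a holomorphic function is holomorphic
    (Goursat and Cauchy on rectangles), which makes [delta] iterable; testing on
    [(w - z)^N], which makes normal forms unique and so homogenizes the given expansions
    of [a] and [b]; and the leading term of a [q]-series, which shows that modular forms
    have no zero divisors. Ramanujan's identities reduce to evaluations of
    [sum_k sigma_r(k) sigma_s(n - k)], obtained by Skoruppa's elementary argument. *)

Require Import Defs.
From Stdlib Require Import Reals ZArith List Lra Lia ClassicalEpsilon FunctionalExtensionality Permutation.
From Coquelicot Require Import Coquelicot.

(** * Complex derivatives *)

(** Operators are bare functions compared by [op_eq] on holomorphic inputs only, whereas [inR] has
    no constructor that passes from an operator to an [op_eq] one. The computations therefore use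
    [Deg] and [DegT], which respect [op_eq]; at the end quotient and remainder are exchanged for
    literal normal forms, and these lie in [inR] by construction.

    Going from order i to order below j takes i - j + 1 reductions. The first one spends b' in place
    of a further factor top(b), which is all that the common divisor d contributes, and it explains
    the exponent i - j.

    The order of the quotient has to be exactly i - j. Its top is the product of a' and
    top(b)^(i-j), so exactness is the absence of zero divisors, obtained by finding a point high on
    the imaginary axis where both factors are nonzero.

    The two sides are not symmetric. In c b the summands of c are added pointwise, while in b c a
    sum stands in the argument of b; part (2) therefore also needs that operators with a normal form
    are additive and depend only on values on the upper half plane. *)

Definition cder (f : C -> C) (z l : C) : Prop :=
  forall eps, 0 < eps -> exists del, 0 < del /\
    forall w, Cmod (w - z)%C < del ->
      Cmod (f w - f z - l * (w - z))%C <= eps * Cmod (w - z)%C.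

Definition ccont (f : C -> C) (z : C) : Prop :=
  forall eps, 0 < eps -> exists del, 0 < del /\
    forall w, Cmod (w - z)%C < del -> Cmod (f w - f z)%C < eps.

Lemma Cmod_diff_le (x y : C) : Cmod (x - y)%C <= Cmod x + Cmod y.
Proof. unfold Cminus. generalize (Cmod_triangle x (- y)%C). rewrite Cmod_opp. lra. Qed.

(** The filter behind [is_derive] has [z] as its only limit, and the norm of [C_NormedModule] is
    [Cmod]; beyond that only the order of the factors in [scal] differs. *)
Lemma is_derive_cder (f : C -> C) (z l : C) :
  @is_derive C_AbsRing C_NormedModule f z l <-> cder f z l.
Proof.
  split.
  - intros [_ H] eps He.
    specialize (H z (fun P HP => HP) (mkposreal eps He)).
    destruct H as [del Hd]. exists del. split; [apply cond_pos|].
    intros w Hw. specialize (Hd w Hw).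
    change (Cmod (minus (minus (f w) (f z)) (scal (minus w z) l)) <= eps * Cmod (w - z)%C) in Hd.
    replace (f w - f z - l * (w - z))%C with (minus (minus (f w) (f z)) (scal (minus w z) l)); [exact Hd|].
    unfold minus, plus, opp, scal; simpl. unfold mult; simpl. ring.
  - intros H. split.
    + apply is_linear_scal_l.
    + intros x Hx eps.
      assert (x = z) as ->.
      { symmetry. apply (is_filter_lim_locally_unique (V:=AbsRing_NormedModule C_AbsRing) z x Hx). }
      destruct (H eps (cond_pos eps)) as [d [Hd Hd']].
      exists (mkposreal d Hd). intros w Hw. specialize (Hd' w Hw).
      change (Cmod (minus (minus (f w) (f z)) (scal (minus w z) l)) <= eps * Cmod (w - z)%C).
      replace (f w - f z - l * (w - z))%C with (minus (minus (f w) (f z)) (scal (minus w z) l)) in Hd'; [exact Hd'|].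
    unfold minus, plus, opp, scal; simpl. unfold mult; simpl. ring.
Qed.

Lemma cder_ext_loc (f g : C -> C) (z l : C) (r : R) :
  0 < r -> (forall w, Cmod (w - z)%C < r -> f w = g w) -> cder f z l -> cder g z l.
Proof.
  intros Hr He H eps Heps. destruct (H eps Heps) as [d [Hd H']].
  exists (Rmin d r). split; [apply Rmin_pos; auto|].
  intros w Hw. generalize (Rmin_l d r) (Rmin_r d r); intros.
  rewrite <- !He; [apply H'; lra|replace (z - z)%C with (RtoC 0) by ring; rewrite Cmod_0; auto|lra].
Qed.

Lemma cder_ccont (f : C -> C) (z l : C) : cder f z l -> ccont f z.
Proof.
  intros H eps He. destruct (H 1 Rlt_0_1) as [d [Hd H']].
  assert (Hl := Cmod_ge_0 l).
  assert (Hq : 0 < eps / (2 + Cmod l)) by (apply Rdiv_lt_0_compat; lra).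
  exists (Rmin d (eps / (2 + Cmod l))). split; [apply Rmin_pos; auto|].
  intros w Hw. generalize (Rmin_l d (eps / (2 + Cmod l))) (Rmin_r d (eps / (2 + Cmod l))); intros.
  specialize (H' w ltac:(lra)).
  replace (f w - f z)%C with ((f w - f z - l * (w - z)) + l * (w - z))%C by ring.
  eapply Rle_lt_trans; [apply Cmod_triangle|]. rewrite Cmod_mult.
  assert (Cmod (w - z) * (2 + Cmod l) < eps).
  { apply (Rmult_lt_reg_r (/ (2 + Cmod l))); [apply Rinv_0_lt_compat; lra|].
    rewrite Rmult_assoc, Rinv_r by lra. unfold Rdiv in *. lra. }
  assert (Hw0 := Cmod_ge_0 (w - z)). nra.
Qed.

Lemma cder_unique (f : C -> C) (z l m : C) : cder f z l -> cder f z m -> l = m.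
Proof.
  intros H1 H2. apply NNPP; intros Hn.
  assert (0 < Cmod (l - m)%C) as Hp.
  { apply Cmod_gt_0. intros E. apply Hn. replace l with (l - m + m)%C by ring. rewrite E. ring. }
  destruct (H1 (Cmod (l - m)%C / 4) ltac:(lra)) as [d1 [Hd1 A1]].
  destruct (H2 (Cmod (l - m)%C / 4) ltac:(lra)) as [d2 [Hd2 A2]].
  (* A real increment inside both radii. The two errors, each at most |l - m| h / 4, add up to half
     of |l - m| h, a contradiction. *)
  set (h := Rmin d1 d2 / 2).
  assert (0 < Rmin d1 d2) by (apply Rmin_pos; auto).
  generalize (Rmin_l d1 d2) (Rmin_r d1 d2); intros.
  assert (Hh : 0 < h) by (unfold h; lra).
  assert (E : (z + RtoC h - z = RtoC h)%C) by ring.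
  assert (Em : Cmod (RtoC h) = h) by (rewrite Cmod_R; apply Rabs_pos_eq; lra).
  specialize (A1 (z + RtoC h)%C). specialize (A2 (z + RtoC h)%C).
  rewrite E, Em in A1, A2. specialize (A1 ltac:(unfold h in *; lra)). specialize (A2 ltac:(unfold h in *; lra)).
  assert (A3 : Cmod ((l - m) * RtoC h)%C <= Cmod (l - m)%C / 4 * h + Cmod (l - m)%C / 4 * h).
  { replace ((l - m) * RtoC h)%C with ((f (z + RtoC h) - f z - m * RtoC h) - (f (z + RtoC h) - f z - l * RtoC h))%C by ring.
    eapply Rle_trans; [apply Cmod_diff_le|]. lra. }
  rewrite Cmod_mult, Em in A3. nra.
Qed.

Lemma cder_cderiv (f : C -> C) (z l : C) : cder f z l -> cderiv f z = l.
Proof.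
  intros H. apply (cder_unique f z); auto. apply is_derive_cder. unfold cderiv.
  apply epsilon_spec. exists l. apply is_derive_cder; auto.
Qed.

Lemma cder_const (c z : C) : cder (fun _ => c) z 0.
Proof.
  intros eps He. exists 1. split; [lra|]. intros w _.
  replace (c - c - 0 * (w - z))%C with (RtoC 0) by ring. rewrite Cmod_0.
  generalize (Cmod_ge_0 (w - z)%C). nra.
Qed.

Lemma cder_id (z : C) : cder (fun w => w) z 1.
Proof.
  intros eps He. exists 1. split; [lra|]. intros w _.
  replace (w - z - 1 * (w - z))%C with (RtoC 0) by ring. rewrite Cmod_0.
  generalize (Cmod_ge_0 (w - z)%C). nra.
Qed.

Lemma cder_plus (f g : C -> C) (z l m : C) :
  cder f z l -> cder g z m -> cder (fun w => f w + g w)%C z (l + m).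
Proof.
  intros H1 H2 eps He.
  destruct (H1 (eps / 2) ltac:(lra)) as [d1 [Hd1 A1]].
  destruct (H2 (eps / 2) ltac:(lra)) as [d2 [Hd2 A2]].
  exists (Rmin d1 d2). split; [apply Rmin_pos; auto|]. intros w Hw.
  generalize (Rmin_l d1 d2) (Rmin_r d1 d2); intros.
  specialize (A1 w ltac:(lra)). specialize (A2 w ltac:(lra)).
  replace (f w + g w - (f z + g z) - (l + m) * (w - z))%C with
    ((f w - f z - l * (w - z)) + (g w - g z - m * (w - z)))%C by ring.
  generalize (Cmod_triangle (f w - f z - l * (w - z)) (g w - g z - m * (w - z))). lra.
Qed.

Lemma cder_mult (f g : C -> C) (z l m : C) :
  cder f z l -> cder g z m -> cder (fun w => f w * g w)%C z (l * g z + f z * m).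
Proof.
  intros H1 H2 eps He.
  set (K := Cmod (g z) + 1 + Cmod (f z) + Cmod l).
  assert (HK : 0 < K) by (unfold K; generalize (Cmod_ge_0 (g z)) (Cmod_ge_0 (f z)) (Cmod_ge_0 l); lra).
  assert (He' : 0 < eps / (3 * K)) by (apply Rdiv_lt_0_compat; lra).
  destruct (H1 _ He') as [d1 [Hd1 A1]].
  destruct (H2 _ He') as [d2 [Hd2 A2]].
  destruct (cder_ccont g z m H2 (Rmin 1 (eps / (3 * K)))) as [d3 [Hd3 A3]]; [apply Rmin_pos; lra|].
  exists (Rmin d1 (Rmin d2 d3)). split; [repeat apply Rmin_pos; auto|]. intros w Hw.
  generalize (Rmin_l d1 (Rmin d2 d3)) (Rmin_r d1 (Rmin d2 d3)) (Rmin_l d2 d3) (Rmin_r d2 d3); intros.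
  specialize (A1 w ltac:(lra)). specialize (A2 w ltac:(lra)). specialize (A3 w ltac:(lra)).
  generalize (Rmin_l 1 (eps / (3 * K))) (Rmin_r 1 (eps / (3 * K))); intros.
  set (e := eps / (3 * K)) in *.
  assert (Ee : eps = 3 * (K * e)) by (unfold e; field; lra).
  replace (f w * g w - f z * g z - (l * g z + f z * m) * (w - z))%C with
    ((f w - f z - l * (w - z)) * g w + f z * (g w - g z - m * (w - z)) + l * (w - z) * (g w - g z))%C by ring.
  assert (Hg : Cmod (g w) <= Cmod (g z) + 1).
  { replace (g w) with (g z + (g w - g z))%C by ring.
    generalize (Cmod_triangle (g z) (g w - g z)). lra. }
  set (h := Cmod (w - z)%C) in *. assert (Hh : 0 <= h) by apply Cmod_ge_0.
  assert (B1 : Cmod ((f w - f z - l * (w - z)) * g w)%C <= K * e * h).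
  { rewrite Cmod_mult.
    apply Rle_trans with (e * h * K); [|nra].
    apply Rmult_le_compat; try apply Cmod_ge_0; auto.
    unfold K. generalize (Cmod_ge_0 (f z)) (Cmod_ge_0 l); lra. }
  assert (B2 : Cmod (f z * (g w - g z - m * (w - z)))%C <= K * e * h).
  { rewrite Cmod_mult. rewrite Rmult_assoc.
    apply Rmult_le_compat; try apply Cmod_ge_0; auto.
    unfold K. generalize (Cmod_ge_0 (g z)) (Cmod_ge_0 l); lra. }
  assert (B3 : Cmod (l * (w - z) * (g w - g z))%C <= K * e * h).
  { rewrite !Cmod_mult. fold h. replace (K * e * h) with (K * h * e) by ring.
    apply Rmult_le_compat; try apply Cmod_ge_0; try lra.
    - apply Rmult_le_pos; auto. apply Cmod_ge_0.
    - apply Rmult_le_compat_r; auto.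
      unfold K. generalize (Cmod_ge_0 (g z)) (Cmod_ge_0 (f z)); lra. }
  rewrite Ee.
  eapply Rle_trans; [apply Cmod_triangle|].
  generalize (Cmod_triangle ((f w - f z - l * (w - z)) * g w) (f z * (g w - g z - m * (w - z)))).
  lra.
Qed.

Lemma cder_eq (f : C -> C) (z l m : C) : cder f z l -> l = m -> cder f z m.
Proof. intros H <-. exact H. Qed.

Lemma cder_scal (c : C) (f : C -> C) (z l : C) : cder f z l -> cder (fun w => c * f w)%C z (c * l).
Proof.
  intros H. eapply cder_eq; [apply cder_mult; [apply cder_const|exact H]|]. cbv beta; ring.
Qed.

Lemma cder_minus (f g : C -> C) (z l m : C) :
  cder f z l -> cder g z m -> cder (fun w => f w - g w)%C z (l - m).
Proof.
  intros H1 H2. eapply cder_ext_loc with (r := 1); [lra| |eapply cder_eq;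
    [apply cder_plus; [exact H1|apply (cder_scal (-(1))%C); exact H2]|ring]].
  intros w _. simpl. ring.
Qed.

Lemma cder_comp (f g : C -> C) (z l m : C) :
  cder f (g z) l -> cder g z m -> cder (fun w => f (g w)) z (l * m).
Proof.
  intros H1 H2 eps He.
  set (K := 1 + Cmod l + Cmod m).
  assert (Hl := Cmod_ge_0 l). assert (Hm := Cmod_ge_0 m).
  assert (HK : 0 < K) by (unfold K; lra).
  assert (He' : 0 < eps / (2 * K)) by (apply Rdiv_lt_0_compat; lra).
  destruct (H1 _ He') as [d1 [Hd1 A1]].
  destruct (H2 (Rmin 1 (eps / (2 * K)))) as [d2 [Hd2 A2]]; [apply Rmin_pos; lra|].
  destruct (cder_ccont g z m H2 d1 Hd1) as [d3 [Hd3 A3]].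
  exists (Rmin d2 d3). split; [apply Rmin_pos; auto|]. intros w Hw.
  generalize (Rmin_l d2 d3) (Rmin_r d2 d3); intros.
  specialize (A3 w ltac:(lra)). specialize (A1 (g w) A3). specialize (A2 w ltac:(lra)).
  generalize (Rmin_l 1 (eps / (2 * K))) (Rmin_r 1 (eps / (2 * K))); intros.
  set (e := eps / (2 * K)) in *.
  assert (Ee : eps = 2 * (K * e)) by (unfold e; field; lra).
  set (h := Cmod (w - z)%C) in *. assert (Hh : 0 <= h) by apply Cmod_ge_0.
  assert (Hg : Cmod (g w - g z)%C <= K * h).
  { replace (g w - g z)%C with ((g w - g z - m * (w - z)) + m * (w - z))%C by ring.
    eapply Rle_trans; [apply Cmod_triangle|]. rewrite Cmod_mult. fold h. unfold K. nra. }
  replace (f (g w) - f (g z) - l * m * (w - z))%C with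
    ((f (g w) - f (g z) - l * (g w - g z)) + l * (g w - g z - m * (w - z)))%C by ring.
  eapply Rle_trans; [apply Cmod_triangle|]. rewrite Cmod_mult.
  assert (Cmod l * Cmod (g w - g z - m * (w - z))%C <= K * (e * h)).
  { apply Rmult_le_compat; try apply Cmod_ge_0; [unfold K; lra|]. nra. }
  nra.
Qed.

Lemma cder_pow (z : C) (n : nat) : cder (fun w => Cpow w (S n)) z (INR (S n) * Cpow z n)%C.
Proof.
  induction n as [|n IH].
  - eapply cder_ext_loc with (r := 1) (f := fun w => w); [lra| |eapply cder_eq; [apply cder_id|]].
    + intros w _. simpl. ring.
    + simpl. ring.
  - eapply cder_ext_loc with (r := 1); [lra| |eapply cder_eq; [apply cder_mult; [apply cder_id|exact IH]|]].
    + intros w _. reflexivity.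
    + rewrite (S_INR (S n)), RtoC_plus. simpl Cpow. ring.
Qed.

Lemma ccont_nonzero (f : C -> C) (z : C) : ccont f z -> f z <> 0%C ->
  exists del, 0 < del /\ forall w, Cmod (w - z)%C < del -> Cmod (f z) / 2 <= Cmod (f w).
Proof.
  intros H Hn. apply Cmod_gt_0 in Hn.
  destruct (H (Cmod (f z) / 2) ltac:(lra)) as [d [Hd A]].
  exists d. split; auto. intros w Hw. specialize (A w Hw).
  generalize (Cmod_diff_le (f w) (f w - f z)).
  replace (f w - (f w - f z))%C with (f z) by ring. lra.
Qed.

Lemma Cmod_half_nonzero (x y : C) : x <> 0%C -> Cmod x / 2 <= Cmod y -> y <> 0%C.
Proof.
  intros Hx H E. subst. rewrite Cmod_0 in H. apply Cmod_gt_0 in Hx. lra.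
Qed.

Lemma cder_inv0 (z : C) : z <> 0%C -> cder Cinv z (- / (z * z)).
Proof.
  intros Hz eps He. assert (Hp := proj1 (Cmod_gt_0 z) Hz).
  set (a := Cmod z) in *.
  (* The error equals (w - z)^2 / (z^2 w). The first radius keeps [Cmod w] above [a / 2]; the second
     then bounds the error by [eps * Cmod (w - z)]. *)
  exists (Rmin (a / 2) (eps * (a * a * a) / 2)).
  assert (H3 : 0 < a * a * a) by (repeat apply Rmult_lt_0_compat; auto).
  split; [apply Rmin_pos; nra|]. intros w Hw.
  generalize (Rmin_l (a / 2) (eps * (a * a * a) / 2)) (Rmin_r (a / 2) (eps * (a * a * a) / 2)); intros.
  assert (Hwa : a / 2 <= Cmod w).
  { generalize (Cmod_diff_le w (w - z)). replace (w - (w - z))%C with z by ring. fold a. lra. }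
  assert (Hw0 : w <> 0%C) by (apply (Cmod_half_nonzero z); auto).
  replace (/ w - / z - - / (z * z) * (w - z))%C with ((w - z) * (w - z) / (z * z * w))%C by (field; auto).
  rewrite Cmod_div by (repeat apply Cmult_neq_0; auto). rewrite !Cmod_mult. fold a.
  set (h := Cmod (w - z)%C) in *. assert (Hh : 0 <= h) by apply Cmod_ge_0.
  apply (Rmult_le_reg_r (a * a * Cmod w)); [repeat apply Rmult_lt_0_compat; lra|].
  unfold Rdiv at 1. rewrite Rmult_assoc, Rinv_l by (apply Rgt_not_eq; repeat apply Rmult_lt_0_compat; lra).
  rewrite Rmult_1_r.
  replace (eps * h * (a * a * Cmod w)) with (h * (eps * (a * a) * Cmod w)) by ring.
  apply Rmult_le_compat_l; auto.
  apply Rle_trans with (eps * (a * a) * (a / 2)); [lra|].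
  apply Rmult_le_compat_l; [|auto]. nra.
Qed.

Lemma cder_div (f g : C -> C) (z l m : C) : g z <> 0%C ->
  cder f z l -> cder g z m ->
  cder (fun w => f w / g w)%C z ((l * g z - f z * m) / (g z * g z)).
Proof.
  intros Hn H1 H2. eapply cder_eq.
  - apply cder_mult; [exact H1|]. apply (cder_comp Cinv g); [apply cder_inv0; auto|exact H2].
  - cbv beta. field; auto.
Qed.

(** * Integrals along rectangles and Goursat's theorem *)

Lemma C_ext (u v : C) : Re u = Re v -> Im u = Im v -> u = v.
Proof. destruct u, v; simpl; intros; subst; auto. Qed.

Lemma im_le_Cmod (c : C) : Rabs (Im c) <= Cmod c.
Proof. generalize (Rmax_Cmod c) (Rmax_r (Rabs (fst c)) (Rabs (snd c))). unfold Im. lra. Qed.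

Lemma Cmod_le_sum (c : C) : Cmod c <= Rabs (Re c) + Rabs (Im c).
Proof.
  replace c with (RtoC (Re c) + Ci * RtoC (Im c))%C at 1 by (apply C_ext; simpl; ring).
  eapply Rle_trans; [apply Cmod_triangle|].
  rewrite Cmod_mult, Cmod_Ci, !Cmod_R. lra.
Qed.

Definition cdiff (f : C -> C) (z : C) : Prop := exists l, cder f z l.

Definition cint (g : R -> C) (a b : R) : C :=
  (RInt (fun t => Re (g t)) a b, RInt (fun t => Im (g t)) a b).

Definition crc (g : R -> C) (t : R) : Prop :=
  continuous (fun t => Re (g t)) t /\ continuous (fun t => Im (g t)) t.

Definition cok (g : R -> C) (a b : R) : Prop := forall t, a <= t <= b -> crc g t.

Lemma cok_ex (g : R -> C) (a b : R) : a <= b -> cok g a b ->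
  ex_RInt (fun t => Re (g t)) a b /\ ex_RInt (fun t => Im (g t)) a b.
Proof.
  intros Hab H. split; apply (ex_RInt_continuous (V:=R_CompleteNormedModule)); intros t Ht;
    rewrite Rmin_left, Rmax_right in Ht by auto; apply (H t Ht).
Qed.

Lemma cint_ext (f g : R -> C) (a b : R) : a <= b -> (forall t, a <= t <= b -> f t = g t) ->
  cint f a b = cint g a b.
Proof.
  intros Hab H. unfold cint. f_equal; apply RInt_ext; intros t Ht;
    rewrite Rmin_left, Rmax_right in Ht by auto; rewrite H; auto; lra.
Qed.

Lemma cint_lin (c d : C) (f g : R -> C) (a b : R) : a <= b -> cok f a b -> cok g a b ->
  cint (fun t => c * f t + d * g t)%C a b = (c * cint f a b + d * cint g a b)%C.
Proof.
  intros Hab Hf Hg.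
  destruct (cok_ex f a b Hab Hf) as [[f1 F1] [f2 F2]].
  destruct (cok_ex g a b Hab Hg) as [[g1 G1] [g2 G2]].
  unfold cint. rewrite (is_RInt_unique _ _ _ _ F1), (is_RInt_unique _ _ _ _ F2),
    (is_RInt_unique _ _ _ _ G1), (is_RInt_unique _ _ _ _ G2).
  apply C_ext; simpl; apply is_RInt_unique.
  - generalize (is_RInt_plus _ _ _ _ _ _
      (is_RInt_minus _ _ _ _ _ _ (is_RInt_scal _ _ _ (Re c) _ F1) (is_RInt_scal _ _ _ (Im c) _ F2))
      (is_RInt_minus _ _ _ _ _ _ (is_RInt_scal _ _ _ (Re d) _ G1) (is_RInt_scal _ _ _ (Im d) _ G2))).
    exact (fun H => H).
  - generalize (is_RInt_plus _ _ _ _ _ _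
      (is_RInt_plus _ _ _ _ _ _ (is_RInt_scal _ _ _ (Re c) _ F2) (is_RInt_scal _ _ _ (Im c) _ F1))
      (is_RInt_plus _ _ _ _ _ _ (is_RInt_scal _ _ _ (Re d) _ G2) (is_RInt_scal _ _ _ (Im d) _ G1))).
    exact (fun H => H).
Qed.

Lemma cint_chasles (f : R -> C) (a b c : R) : a <= b <= c -> cok f a c ->
  cint f a c = (cint f a b + cint f b c)%C.
Proof.
  intros Habc H.
  destruct (cok_ex f a b ltac:(lra) (fun t Ht => H t ltac:(lra))) as [A1 A2].
  destruct (cok_ex f b c ltac:(lra) (fun t Ht => H t ltac:(lra))) as [B1 B2].
  apply C_ext; simpl; symmetry; apply (RInt_Chasles (V:=R_CompleteNormedModule)); auto.
Qed.

Lemma cint_const (c : C) (a b : R) : cint (fun _ => c) a b = (RtoC (b - a) * c)%C.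
Proof.
  unfold cint. rewrite (RInt_const a b (Re c)), (RInt_const a b (Im c)).
  apply C_ext; unfold Re, Im; simpl; unfold scal; simpl; unfold mult; simpl; unfold Re, Im; ring.
Qed.

(** The factor 2 comes from estimating real and imaginary parts separately; the later uses only need
    the right order of magnitude. *)
Lemma cint_bound (f : R -> C) (a b M : R) : a <= b -> cok f a b ->
  (forall t, a <= t <= b -> Cmod (f t) <= M) -> Cmod (cint f a b) <= 2 * M * (b - a).
Proof.
  intros Hab H HM. destruct (cok_ex f a b Hab H) as [A1 A2].
  eapply Rle_trans; [apply Cmod_le_sum|]. simpl.
  assert (B : forall h : R -> R, ex_RInt h a b -> (forall t, a <= t <= b -> Rabs (h t) <= M) ->
    Rabs (RInt h a b) <= (b - a) * M).
  { intros h Hh Hb. apply (norm_RInt_le_const (V:=R_NormedModule) h a b); auto.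
    apply (RInt_correct (V:=R_CompleteNormedModule)); auto. }
  assert (B1 := B _ A1 (fun t Ht => Rle_trans _ _ _ (re_le_Cmod _) (HM t Ht))).
  assert (B2 := B _ A2 (fun t Ht => Rle_trans _ _ _ (im_le_Cmod _) (HM t Ht))).
  lra.
Qed.

Lemma continuous_eps (h : R -> R) (t : R) :
  (forall eps, 0 < eps -> exists d, 0 < d /\ forall s, Rabs (s - t) < d -> Rabs (h s - h t) < eps) ->
  continuous h t.
Proof.
  intros H. apply filterlim_locally. intros eps.
  destruct (H eps (cond_pos eps)) as [d [Hd Hd']].
  exists (mkposreal d Hd). intros s Hs. apply Hd'. exact Hs.
Qed.

Lemma crc_line (f : C -> C) (p : R -> C) (t : R) :
  (forall s, Cmod (p s - p t)%C = Rabs (s - t)) -> cdiff f (p t) -> crc (fun s => f (p s)) t.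
Proof.
  intros Hp [l Hl]. apply cder_ccont in Hl. split; apply continuous_eps; intros eps He;
    destruct (Hl eps He) as [d [Hd A]]; exists d; split; auto; intros s Hs;
    rewrite <- Hp in Hs; specialize (A _ Hs).
  - generalize (re_le_Cmod (f (p s) - f (p t))). unfold Re, Cminus, Cplus, Copp in *; simpl in *. unfold Rminus. lra.
  - generalize (im_le_Cmod (f (p s) - f (p t))). unfold Im, Cminus, Cplus, Copp in *; simpl in *. unfold Rminus. lra.
Qed.

Lemma hline_dist (y s t : R) : Cmod ((s, y) - (t, y))%C = Rabs (s - t).
Proof.
  replace ((s, y) - (t, y))%C with (RtoC (s - t)) by (apply C_ext; simpl; ring). apply Cmod_R.
Qed.

Lemma vline_dist (x s t : R) : Cmod ((x, s) - (x, t))%C = Rabs (s - t).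
Proof.
  replace ((x, s) - (x, t))%C with (Ci * RtoC (s - t))%C by (apply C_ext; simpl; ring).
  rewrite Cmod_mult, Cmod_Ci, Cmod_R. ring.
Qed.

Definition bd (x0 x1 y0 y1 : R) (z : C) : Prop :=
  (x0 <= Re z <= x1 /\ (Im z = y0 \/ Im z = y1)) \/
  (y0 <= Im z <= y1 /\ (Re z = x0 \/ Re z = x1)).

(** The integral of [F] along the boundary of a rectangle, opposite sides
    being grouped so that it vanishes trivially on affine functions. *)
Definition rint (F : C -> C) (x0 x1 y0 y1 : R) : C :=
  (cint (fun x => F (x, y0) - F (x, y1)) x0 x1 +
   Ci * cint (fun y => F (x1, y) - F (x0, y)) y0 y1)%C.

Lemma cok_sub (f g : R -> C) (a b : R) : cok f a b -> cok g a b -> cok (fun t => f t - g t)%C a b.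
Proof.
  intros Hf Hg t Ht. destruct (Hf t Ht) as [f1 f2]. destruct (Hg t Ht) as [g1 g2].
  split.
  - generalize (continuous_minus (V:=R_NormedModule) _ _ _ f1 g1). exact (fun H => H).
  - generalize (continuous_minus (V:=R_NormedModule) _ _ _ f2 g2). exact (fun H => H).
Qed.

Lemma cok_h (F : C -> C) (y a b : R) : (forall t, a <= t <= b -> cdiff F (t, y)) -> cok (fun x => F (x, y)) a b.
Proof.
  intros H t Ht. apply (crc_line F (fun x => (x, y))); [intros; apply hline_dist|auto].
Qed.

Lemma cok_v (F : C -> C) (x a b : R) : (forall t, a <= t <= b -> cdiff F (x, t)) -> cok (fun y => F (x, y)) a b.
Proof.
  intros H t Ht. apply (crc_line F (fun y => (x, y))); [intros; apply vline_dist|auto].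
Qed.

Lemma cok_hh (F : C -> C) (x0 x1 y0 y1 : R) : (forall z, bd x0 x1 y0 y1 z -> cdiff F z) ->
  cok (fun x => F (x, y0) - F (x, y1))%C x0 x1.
Proof.
  intros H. apply cok_sub; apply cok_h; intros t Ht; apply H; left; simpl; auto.
Qed.

Lemma cok_vv (F : C -> C) (x0 x1 y0 y1 : R) : (forall z, bd x0 x1 y0 y1 z -> cdiff F z) ->
  cok (fun y => F (x1, y) - F (x0, y))%C y0 y1.
Proof.
  intros H. apply cok_sub; apply cok_v; intros t Ht; apply H; right; simpl; auto.
Qed.

Lemma rint_ext (F G : C -> C) (x0 x1 y0 y1 : R) : x0 <= x1 -> y0 <= y1 ->
  (forall z, bd x0 x1 y0 y1 z -> F z = G z) -> rint F x0 x1 y0 y1 = rint G x0 x1 y0 y1.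
Proof.
  intros Hx Hy H. unfold rint. f_equal; [|f_equal]; apply cint_ext; auto; intros t Ht;
    rewrite !H; auto; try (left; simpl; auto; fail); right; simpl; auto.
Qed.

Lemma rint_lin (c d : C) (F G : C -> C) (x0 x1 y0 y1 : R) : x0 <= x1 -> y0 <= y1 ->
  (forall z, bd x0 x1 y0 y1 z -> cdiff F z) -> (forall z, bd x0 x1 y0 y1 z -> cdiff G z) ->
  rint (fun z => c * F z + d * G z)%C x0 x1 y0 y1 = (c * rint F x0 x1 y0 y1 + d * rint G x0 x1 y0 y1)%C.
Proof.
  intros Hx Hy HF HG. unfold rint.
  transitivity (cint (fun x => c * (F (x, y0) - F (x, y1)) + d * (G (x, y0) - G (x, y1)))%C x0 x1
    + Ci * cint (fun y => c * (F (x1, y) - F (x0, y)) + d * (G (x1, y) - G (x0, y)))%C y0 y1)%C.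
  - f_equal; [|f_equal]; apply cint_ext; auto; intros; ring.
  - rewrite !cint_lin; auto using cok_hh, cok_vv. ring.
Qed.

Lemma rint_bound (F : C -> C) (x0 x1 y0 y1 M : R) : x0 <= x1 -> y0 <= y1 ->
  (forall z, bd x0 x1 y0 y1 z -> cdiff F z) ->
  (forall z, bd x0 x1 y0 y1 z -> Cmod (F z) <= M) ->
  Cmod (rint F x0 x1 y0 y1) <= 4 * M * ((x1 - x0) + (y1 - y0)).
Proof.
  intros Hx Hy HF HM. unfold rint.
  eapply Rle_trans; [apply Cmod_triangle|]. rewrite Cmod_mult, Cmod_Ci.
  assert (A : Cmod (cint (fun x => F (x, y0) - F (x, y1))%C x0 x1) <= 2 * (M + M) * (x1 - x0)).
  { apply cint_bound; auto using cok_hh. intros t Ht.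
    eapply Rle_trans; [apply Cmod_diff_le|]. apply Rplus_le_compat; apply HM; left; simpl; auto. }
  assert (B : Cmod (cint (fun y => F (x1, y) - F (x0, y))%C y0 y1) <= 2 * (M + M) * (y1 - y0)).
  { apply cint_bound; auto using cok_vv. intros t Ht.
    eapply Rle_trans; [apply Cmod_diff_le|]. apply Rplus_le_compat; apply HM; right; simpl; auto. }
  lra.
Qed.

Lemma cint_plus (f g : R -> C) (a b : R) : a <= b -> cok f a b -> cok g a b ->
  (cint f a b + cint g a b)%C = cint (fun t => f t + g t)%C a b.
Proof.
  intros. transitivity (cint (fun t => 1 * f t + 1 * g t)%C a b).
  - rewrite cint_lin; auto. ring.
  - apply cint_ext; auto. intros; ring.
Qed.

Lemma rint_split_x (F : C -> C) (x0 xm x1 y0 y1 : R) : x0 <= xm <= x1 -> y0 <= y1 ->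
  (forall z, bd x0 xm y0 y1 z -> cdiff F z) -> (forall z, bd xm x1 y0 y1 z -> cdiff F z) ->
  rint F x0 x1 y0 y1 = (rint F x0 xm y0 y1 + rint F xm x1 y0 y1)%C.
Proof.
  intros Hx Hy H1 H2. unfold rint.
  rewrite (cint_chasles _ x0 xm x1); auto.
  - replace (cint (fun y => F (x1, y) - F (x0, y)) y0 y1)%C with
      (cint (fun y => F (xm, y) - F (x0, y)) y0 y1 + cint (fun y => F (x1, y) - F (xm, y)) y0 y1)%C.
    + ring.
    + rewrite cint_plus; auto using cok_vv. apply cint_ext; auto. intros; ring.
  - intros t Ht. destruct (Rle_dec t xm).
    + apply (cok_hh _ x0 xm); auto. lra.
    + apply (cok_hh _ xm x1); auto. lra.
Qed.

Lemma rint_split_y (F : C -> C) (x0 x1 y0 ym y1 : R) : y0 <= ym <= y1 -> x0 <= x1 ->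
  (forall z, bd x0 x1 y0 ym z -> cdiff F z) -> (forall z, bd x0 x1 ym y1 z -> cdiff F z) ->
  rint F x0 x1 y0 y1 = (rint F x0 x1 y0 ym + rint F x0 x1 ym y1)%C.
Proof.
  intros Hx Hy H1 H2. unfold rint.
  rewrite (cint_chasles _ y0 ym y1); auto.
  - replace (cint (fun x => F (x, y0) - F (x, y1)) x0 x1)%C with
      (cint (fun x => F (x, y0) - F (x, ym)) x0 x1 + cint (fun x => F (x, ym) - F (x, y1)) x0 x1)%C.
    + ring.
    + rewrite cint_plus; auto using cok_hh. apply cint_ext; auto. intros; ring.
  - intros t Ht. destruct (Rle_dec t ym).
    + apply (cok_vv _ x0 x1 y0 ym); auto. lra.
    + apply (cok_vv _ x0 x1 ym y1); auto. lra.
Qed.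

Lemma rint_affine (a b z0 : C) (x0 x1 y0 y1 : R) : x0 <= x1 -> y0 <= y1 ->
  rint (fun z => a + b * (z - z0))%C x0 x1 y0 y1 = 0%C.
Proof.
  intros Hx Hy. unfold rint.
  transitivity (cint (fun _ => b * (Ci * RtoC (y0 - y1)))%C x0 x1 + Ci * cint (fun _ => b * RtoC (x1 - x0))%C y0 y1)%C.
  - f_equal; [|f_equal]; apply cint_ext; auto; intros; apply C_ext; simpl; ring.
  - rewrite !cint_const. apply C_ext; simpl; ring.
Qed.

(** * Goursat's theorem by repeated quartering *)

Lemma nested_intervals (x w : nat -> R) :
  (forall k, 0 <= w k) -> (forall k, x k <= x (S k) /\ x (S k) + w (S k) <= x k + w k) ->
  exists l, forall k, x k <= l <= x k + w k.
Proof.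
  intros Hw H.
  assert (A : forall j k, x k <= x (k + j)%nat /\ x (k + j)%nat + w (k + j)%nat <= x k + w k).
  { induction j; intros k.
    - rewrite Nat.add_0_r. lra.
    - rewrite Nat.add_succ_r. specialize (IHj k). specialize (H (k + j)%nat). lra. }
  assert (B : forall j k, x j <= x k + w k).
  { intros j k. destruct (Nat.le_ge_cases j k).
    - specialize (A (k - j)%nat j). replace (j + (k - j))%nat with k in A by lia. specialize (Hw k). lra.
    - specialize (A (j - k)%nat k). replace (k + (j - k))%nat with j in A by lia. specialize (Hw j). lra. }
  destruct (completeness (fun r => exists k, r = x k)) as [l [L1 L2]].
  - exists (x 0%nat + w 0%nat). intros r [k ->]. apply B.
  - exists (x 0%nat). eauto.
  - exists l. intros k. split; [apply L1; eauto|]. apply L2. intros r [j ->]. apply B.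
Qed.

Definition in_rect (x0 x1 y0 y1 : R) (z : C) : Prop := x0 <= Re z <= x1 /\ y0 <= Im z <= y1.

Lemma bd_in_rect (x0 x1 y0 y1 : R) (z : C) : x0 <= x1 -> y0 <= y1 ->
  bd x0 x1 y0 y1 z -> in_rect x0 x1 y0 y1 z.
Proof. unfold bd, in_rect. intros Hx Hy [[A [B|B]]|[A [B|B]]]; rewrite B; lra. Qed.

(** The inner sides cancel, so the four quarter integrals add up to the whole one; if each were at
    most [c] in modulus, the sum would be at most [4 * c]. *)
Lemma rint_quarter (F : C -> C) (x y w h c : R) : 0 <= w -> 0 <= h ->
  (forall z, in_rect x (x + 2 * w) y (y + 2 * h) z -> cdiff F z) ->
  4 * c < Cmod (rint F x (x + 2 * w) y (y + 2 * h)) ->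
  exists x' y', (x' = x \/ x' = x + w) /\ (y' = y \/ y' = y + h) /\
    c < Cmod (rint F x' (x' + w) y' (y' + h)).
Proof.
  intros Hw Hh HF Hc. apply NNPP; intros HN.
  assert (A : forall x' y', (x' = x \/ x' = x + w) -> (y' = y \/ y' = y + h) ->
    Cmod (rint F x' (x' + w) y' (y' + h)) <= c).
  { intros x' y' H1 H2. apply Rnot_lt_le. intros H3. apply HN. exists x', y'. auto. }
  assert (D : forall a b a' b' z, bd a b a' b' z -> x <= a <= b -> b <= x + 2 * w ->
    y <= a' <= b' -> b' <= y + 2 * h -> cdiff F z).
  { intros a b a' b' z Hz ? ? ? ?. apply HF. apply bd_in_rect in Hz; unfold in_rect in *; lra. }
  rewrite (rint_split_x F x (x + w)) in Hc; try lra; try (intros z Hz; eapply D; [exact Hz|lra..]).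
  rewrite (rint_split_y F x (x + w) y (y + h)) in Hc; try lra; try (intros z Hz; eapply D; [exact Hz|lra..]).
  rewrite (rint_split_y F (x + w) (x + 2 * w) y (y + h)) in Hc; try lra; try (intros z Hz; eapply D; [exact Hz|lra..]).
  generalize (A x y (or_introl eq_refl) (or_introl eq_refl))
    (A (x + w) y (or_intror eq_refl) (or_introl eq_refl))
    (A x (y + h) (or_introl eq_refl) (or_intror eq_refl))
    (A (x + w) (y + h) (or_intror eq_refl) (or_intror eq_refl)).
  replace (x + w + w) with (x + 2 * w) by ring. replace (y + h + h) with (y + 2 * h) by ring.
  intros A1 A2 A3 A4. revert Hc. apply Rle_not_lt.
  eapply Rle_trans; [apply Cmod_triangle|].
  eapply Rle_trans; [apply Rplus_le_compat; apply Cmod_triangle|]. lra.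
Qed.

Lemma pow_half_small (K eps : R) : 0 <= K -> 0 < eps -> exists k, K * (/ 2) ^ k < eps.
Proof.
  intros HK He.
  destruct (pow_lt_1_zero (/ 2) ltac:(rewrite Rabs_pos_eq; lra) (eps / (K + 1))) as [k Hk].
  - apply Rdiv_lt_0_compat; lra.
  - exists k. specialize (Hk k (le_n k)). rewrite Rabs_pos_eq in Hk by (apply pow_le; lra).
    assert (0 < (/ 2) ^ k) by (apply pow_lt; lra).
    apply (Rmult_lt_compat_r (K + 1)) in Hk; [|lra].
    unfold Rdiv in Hk. rewrite Rmult_assoc, Rinv_l in Hk by lra. nra.
Qed.

Lemma goursat (F : C -> C) (X Y W H : R) : 0 <= W -> 0 <= H ->
  (forall z, in_rect X (X + W) Y (Y + H) z -> cdiff F z) ->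
  rint F X (X + W) Y (Y + H) = 0%C.
Proof.
  intros HW HH HF. apply NNPP; intros HN. apply Cmod_gt_0 in HN.
  (* Half the modulus, so that the strict inequality in [bad] already holds for the initial
     rectangle. *)
  set (c := Cmod (rint F X (X + W) Y (Y + H)) / 2) in *.
  set (t := fun k : nat => (/ 2) ^ k).
  assert (Ht : forall k, 0 < t k) by (intros; apply pow_lt; lra).
  assert (HtS : forall k, t k = 2 * t (S k)) by (intros; unfold t; simpl; field).
  set (bad := fun k (p : R * R) =>
    (X <= fst p /\ fst p + W * t k <= X + W /\ Y <= snd p /\ snd p + H * t k <= Y + H) /\
    c * (t k * t k) < Cmod (rint F (fst p) (fst p + W * t k) (snd p) (snd p + H * t k))).
  assert (step : forall k p, bad k p -> exists q, bad (S k) q /\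
    (fst q = fst p \/ fst q = fst p + W * t (S k)) /\ (snd q = snd p \/ snd q = snd p + H * t (S k))).
  { intros k p [Hin Hb]. rewrite HtS in Hb, Hin.
    assert (HWt : 0 <= W * t (S k)) by (apply Rmult_le_pos; auto; left; auto).
    assert (HHt : 0 <= H * t (S k)) by (apply Rmult_le_pos; auto; left; auto).
    replace (W * (2 * t (S k))) with (2 * (W * t (S k))) in * by ring.
    replace (H * (2 * t (S k))) with (2 * (H * t (S k))) in * by ring.
    destruct (rint_quarter F (fst p) (snd p) (W * t (S k)) (H * t (S k)) (c * (t (S k) * t (S k)))) as (x' & y' & Hx & Hy & Hc); auto.
    - intros z Hz. apply HF. unfold in_rect in *. lra.
    - lra.
    - exists (x', y'). unfold bad; simpl. repeat split; auto; destruct Hx, Hy; subst; lra. }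
  assert (bad0 : bad 0%nat (X, Y)).
  { unfold bad, t; simpl. rewrite !Rmult_1_r. repeat split; try lra. unfold c in *. lra. }
  (* Dependent choice: every term carries the proof that it is bad, and from that proof the next
     corner is chosen. *)
  set (nxt := fun k (p : {p | bad k p}) =>
    let s := constructive_indefinite_description _ (step k (proj1_sig p) (proj2_sig p)) in
    exist (bad (S k)) (proj1_sig s) (proj1 (proj2_sig s))).
  set (sq := fix sq k : {p | bad k p} := match k with O => exist _ (X, Y) bad0 | S k' => nxt k' (sq k') end).
  assert (Hsq : forall k, let p := proj1_sig (sq k) in let q := proj1_sig (sq (S k)) in
     (fst q = fst p \/ fst q = fst p + W * t (S k)) /\ (snd q = snd p \/ snd q = snd p + H * t (S k))).
  { intros k. simpl. apply (proj2_sig (constructive_indefinite_description _ (step k (proj1_sig (sq k)) (proj2_sig (sq k))))). }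
  assert (Hpos : forall V k, 0 <= V -> 0 <= V * t k) by (intros; apply Rmult_le_pos; auto; left; auto).
  destruct (nested_intervals (fun k => fst (proj1_sig (sq k))) (fun k => W * t k)) as [x Hx]; auto.
  { intros k. generalize (Hpos W (S k) HW) (HtS k). destruct (Hsq k) as [[->| ->] _]; intros ? ->; lra. }
  destruct (nested_intervals (fun k => snd (proj1_sig (sq k))) (fun k => H * t k)) as [y Hy]; auto.
  { intros k. generalize (Hpos H (S k) HH) (HtS k). destruct (Hsq k) as [_ [->| ->]]; intros ? ->; lra. }
  set (z0 := (x, y) : C).
  destruct (HF z0) as [l Hl].
  { generalize (Hx 0%nat) (Hy 0%nat). unfold t; simpl. unfold in_rect; simpl. lra. }
  set (V := W + H + 1). assert (HV : 0 < V) by (unfold V; lra).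
  assert (HVV : 0 < 4 * (V * V)) by nra.
  (* The tolerance is dictated by the final estimate: on the k-th rectangle the remainder is at most
     eps V t, and [rint_bound] turns this into 4 eps V t (W + H) t, which is at most c t^2. *)
  destruct (Hl (c / (4 * (V * V)))) as [d [Hd Hd']]; [apply Rdiv_lt_0_compat; unfold c; lra|].
  set (eps := c / (4 * (V * V))) in *.
  assert (Ec : c = eps * (4 * (V * V))) by (unfold eps; field; lra).
  assert (Heps : 0 < eps) by (unfold eps; apply Rdiv_lt_0_compat; unfold c; lra).
  destruct (pow_half_small V d) as [k Hk]; [lra|auto|]. change ((/ 2) ^ k) with (t k) in Hk.
  destruct (proj2_sig (sq k)) as [Hin Hbad]. specialize (Hx k). specialize (Hy k). simpl in Hx, Hy.
  set (p := proj1_sig (sq k)) in *.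
  assert (HWk := Hpos W k HW). assert (HHk := Hpos H k HH).
  assert (Hr : forall z, bd (fst p) (fst p + W * t k) (snd p) (snd p + H * t k) z ->
    cdiff F z /\ Cmod (z - z0)%C <= V * t k).
  { intros z Hz. apply bd_in_rect in Hz; try lra. unfold in_rect in Hz. split.
    - apply HF. unfold in_rect. lra.
    - eapply Rle_trans; [apply Cmod_le_sum|].
      assert (Rabs (Re (z - z0)%C) <= W * t k) by (unfold z0; simpl; apply Rabs_le; unfold Re in *; lra).
      assert (Rabs (Im (z - z0)%C) <= H * t k) by (unfold z0; simpl; apply Rabs_le; unfold Im in *; lra).
      unfold V. generalize (Ht k). lra. }
  (* The affine part integrates to 0, so [F] may be replaced by its first-order remainder at
     [z0]. *)
  set (G := fun z => (F z0 + l * (z - z0))%C).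
  assert (HG : forall z, cdiff G z).
  { intros z. exists (0 + l * (1 - 0))%C. unfold G. apply cder_plus; [apply cder_const|].
    apply cder_scal. apply cder_minus; [apply cder_id|apply cder_const]. }
  assert (E : rint F (fst p) (fst p + W * t k) (snd p) (snd p + H * t k) =
    rint (fun z => 1 * F z + (-(1)) * G z)%C (fst p) (fst p + W * t k) (snd p) (snd p + H * t k)).
  { rewrite rint_lin; try lra.
    - unfold G. rewrite rint_affine; try lra. ring.
    - intros z Hz. apply Hr; auto.
    - intros z _; auto. }
  revert Hbad. apply Rle_not_lt. rewrite E.
  eapply Rle_trans; [apply (rint_bound _ _ _ _ _ (eps * (V * t k)))|]; try lra.
  - intros z Hz. destruct (proj1 (Hr z Hz)) as [m Hm]. destruct (HG z) as [m' Hm'].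
    eexists. apply cder_plus; apply cder_scal; eauto.
  - intros z Hz. destruct (Hr z Hz) as [_ Hz']. specialize (Hd' z ltac:(lra)).
    unfold G. replace (1 * F z + - (1) * (F z0 + l * (z - z0)))%C with (F z - F z0 - l * (z - z0))%C by ring.
    eapply Rle_trans; [exact Hd'|]. apply Rmult_le_compat_l; lra.
  - rewrite Ec. generalize (Ht k). intros Htk.
    replace (fst p + W * t k - fst p + (snd p + H * t k - snd p)) with ((W + H) * t k) by ring.
    replace (eps * (4 * (V * V)) * (t k * t k)) with (4 * (eps * (V * t k)) * (V * t k)) by ring.
    apply Rmult_le_compat_l.
    + assert (0 <= V * t k) by nra. nra.
    + apply Rmult_le_compat_r; [lra|unfold V; lra].
Qed.

Lemma goursat_rect (F : C -> C) (x0 x1 y0 y1 : R) : x0 <= x1 -> y0 <= y1 ->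
  (forall z, in_rect x0 x1 y0 y1 z -> cdiff F z) -> rint F x0 x1 y0 y1 = 0%C.
Proof.
  intros Hx Hy HF. replace x1 with (x0 + (x1 - x0)) in * by ring. replace y1 with (y0 + (y1 - y0)) in * by ring.
  apply goursat; auto; lra.
Qed.

(** * Cauchy's integral formula on rectangles *)

Lemma cdiff_div (f g : C -> C) (z : C) : g z <> 0%C -> cdiff f z -> cdiff g z -> cdiff (fun w => f w / g w)%C z.
Proof. intros Hn [l Hl] [m Hm]. eexists. apply cder_div; eauto. Qed.

Lemma cdiff_sub_const (f : C -> C) (c z : C) : cdiff f z -> cdiff (fun w => f w - c)%C z.
Proof. intros [l Hl]. eexists. apply cder_minus; [eauto|apply cder_const]. Qed.

Lemma cdiff_mult (f g : C -> C) (z : C) : cdiff f z -> cdiff g z -> cdiff (fun w => f w * g w)%C z.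
Proof. intros [l Hl] [m Hm]. eexists. apply cder_mult; eauto. Qed.

Lemma cdiff_id (z : C) : cdiff (fun w => w) z.
Proof. eexists. apply cder_id. Qed.

Lemma cdiff_lin (c d : C) (f g : C -> C) (z : C) : cdiff f z -> cdiff g z -> cdiff (fun w => c * f w + d * g w)%C z.
Proof. intros [l Hl] [m Hm]. eexists. apply cder_plus; apply cder_scal; eauto. Qed.

Lemma Csub_neq0 (z w : C) : z <> w -> (z - w)%C <> 0%C.
Proof. intros H E. apply H. replace z with (z - w + w)%C by ring. rewrite E. ring. Qed.

(** Cutting out a small square around [w], on which [F] is only bounded. *)
Lemma removable_rint (F : C -> C) (x0 x1 y0 y1 : R) (w : C) (M d : R) :
  x0 < Re w < x1 -> y0 < Im w < y1 ->
  (forall z, in_rect x0 x1 y0 y1 z -> z <> w -> cdiff F z) ->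
  0 < d -> (forall z, z <> w -> Cmod (z - w)%C < d -> Cmod (F z) <= M) ->
  rint F x0 x1 y0 y1 = 0%C.
Proof.
  intros Hx Hy HF Hd HM. apply NNPP; intros HN. apply Cmod_gt_0 in HN.
  set (I := Cmod (rint F x0 x1 y0 y1)) in *.
  set (u := Re w) in *. set (v := Im w) in *.
  (* On a square of half-side [e], [rint_bound] gives 4 M (2 e + 2 e) = 16 M e; the absolute value
     and the summand 1 keep the divisor positive. *)
  assert (HM0 : 0 < 16 * (Rabs M + 1)) by (generalize (Rabs_pos M); lra).
  assert (HI : 0 < I / (16 * (Rabs M + 1))) by (apply Rdiv_lt_0_compat; auto).
  destruct (pow_half_small 1 (Rmin (I / (16 * (Rabs M + 1))) (Rmin (d / 2) (Rmin (Rmin (u - x0) (x1 - u)) (Rmin (v - y0) (y1 - v)))))) as [k Hk]; [lra|repeat apply Rmin_pos; lra|].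
  assert (Ht0 : 0 < (/ 2) ^ k) by (apply pow_lt; lra). rewrite Rmult_1_l in Hk.
  set (e := (/ 2) ^ k) in *.
  repeat match goal with _ : context [Rmin ?a ?b] |- _ =>
    generalize (Rmin_l a b) (Rmin_r a b); generalize dependent (Rmin a b); intros end.
  assert (HFr : forall a b a' b', x0 <= a -> a <= b -> b <= x1 -> y0 <= a' -> a' <= b' -> b' <= y1 ->
     (b <= u - e \/ u + e <= a \/ b' <= v - e \/ v + e <= a') -> rint F a b a' b' = 0%C).
  { intros. apply goursat_rect; auto. intros z [Hz1 Hz2]. apply HF; [unfold in_rect; lra|].
    intros ->. fold u v in Hz1, Hz2. lra. }
  assert (HFb : forall a b a' b', x0 <= a -> a <= b -> b <= x1 -> y0 <= a' -> a' <= b' -> b' <= y1 ->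
     (a <> u /\ b <> u /\ a' <> v /\ b' <> v) -> forall z, bd a b a' b' z -> cdiff F z).
  { intros a b a' b' ? ? ? ? ? ? (? & ? & ? & ?) z Hz. apply HF.
    - apply bd_in_rect in Hz; auto. unfold in_rect in *; lra.
    - intros ->. unfold bd in Hz. fold u v in Hz. lra. }
  assert (EI : rint F x0 x1 y0 y1 = rint F (u - e) (u + e) (v - e) (v + e)).
  { rewrite (rint_split_x F x0 (u - e)); try lra; try (apply HFb; lra).
    rewrite (rint_split_x F (u - e) (u + e)); try lra; try (apply HFb; lra).
    rewrite (rint_split_y F (u - e) (u + e) y0 (v - e)); try lra; try (apply HFb; lra).
    rewrite (rint_split_y F (u - e) (u + e) (v - e) (v + e)); try lra; try (apply HFb; lra).
    rewrite (HFr x0 (u - e)), (HFr (u + e) x1), (HFr (u - e) (u + e) y0 (v - e)), (HFr (u - e) (u + e) (v + e) y1) by (try lra; intuition lra).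
    ring. }
  assert (HB : I <= 4 * M * ((u + e - (u - e)) + (v + e - (v - e)))).
  { unfold I. rewrite EI. apply rint_bound; try lra; [apply HFb; lra|].
    intros z Hz. assert (Hzw : z <> w). { intros ->. unfold bd in Hz. fold u v in Hz. lra. }
    apply HM; auto. apply bd_in_rect in Hz; try lra. destruct Hz as [Hz1 Hz2].
    eapply Rle_lt_trans; [apply Cmod_le_sum|].
    assert (Rabs (Re (z - w)%C) <= e) by (unfold u in *; simpl; apply Rabs_le; unfold Re in *; lra).
    assert (Rabs (Im (z - w)%C) <= e) by (unfold v in *; simpl; apply Rabs_le; unfold Im in *; lra).
    lra. }
  assert (HE : e < I / (16 * (Rabs M + 1))) by lra.
  apply (Rmult_lt_compat_r (16 * (Rabs M + 1))) in HE; auto.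
  unfold Rdiv in HE. rewrite Rmult_assoc, Rinv_l in HE by lra.
  generalize (Rle_abs M). intros. nra.
Qed.

(** Near [w] the quotient (f z - f w) / (z - w) is bounded by 1 + |f'(w)|, so its boundary integral
    vanishes by [removable_rint]; splitting the numerator gives the formula. The integral of 1 / (z
    - w) stays unevaluated. *)
Lemma cauchy_rect (f : C -> C) (x0 x1 y0 y1 : R) (w : C) :
  x0 < Re w < x1 -> y0 < Im w < y1 ->
  (forall z, in_rect x0 x1 y0 y1 z -> cdiff f z) ->
  (f w * rint (fun z => 1 / (z - w)) x0 x1 y0 y1 = rint (fun z => f z / (z - w)) x0 x1 y0 y1)%C.
Proof.
  intros Hx Hy Hf.
  assert (Hne : forall z, bd x0 x1 y0 y1 z -> z <> w).
  { intros z Hz ->. unfold bd in Hz. lra. }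
  assert (H1 : forall z, z <> w -> cdiff (fun z => 1 / (z - w))%C z).
  { intros z Hz. apply cdiff_div; [apply Csub_neq0; auto|eexists; apply cder_const|apply cdiff_sub_const, cdiff_id]. }
  assert (H2 : forall z, in_rect x0 x1 y0 y1 z -> z <> w -> cdiff (fun z => f z / (z - w))%C z).
  { intros z Hz Hzw. apply cdiff_div; [apply Csub_neq0; auto|auto|apply cdiff_sub_const, cdiff_id]. }
  assert (E : rint (fun z => (f z - f w) / (z - w))%C x0 x1 y0 y1 = 0%C).
  { destruct (Hf w) as [l Hl]; [unfold in_rect; lra|].
    destruct (Hl 1 Rlt_0_1) as [d [Hd Hd']].
    apply (removable_rint _ _ _ _ _ w (1 + Cmod l) d); auto.
    - intros z Hz Hzw. apply cdiff_div; [apply Csub_neq0; auto|apply cdiff_sub_const; auto|apply cdiff_sub_const, cdiff_id].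
    - intros z Hzw Hz. assert (Hn := Csub_neq0 z w Hzw). assert (Hp := proj1 (Cmod_gt_0 _) Hn).
      rewrite Cmod_div by auto. apply (Rmult_le_reg_r (Cmod (z - w))); auto.
      unfold Rdiv. rewrite Rmult_assoc, Rinv_l by lra. rewrite Rmult_1_r.
      replace (f z - f w)%C with (f z - f w - l * (z - w) + l * (z - w))%C by ring.
      eapply Rle_trans; [apply Cmod_triangle|]. rewrite Cmod_mult. specialize (Hd' z Hz). lra. }
  rewrite (rint_ext _ (fun z => 1 * (f z / (z - w)) + (- f w) * (1 / (z - w)))%C) in E; try lra.
  - rewrite rint_lin in E; try lra.
    + replace (rint (fun z => f z / (z - w)) x0 x1 y0 y1)%C with
       ((1 * rint (fun z => f z / (z - w)) x0 x1 y0 y1 + - f w * rint (fun z => 1 / (z - w)) x0 x1 y0 y1)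
        + f w * rint (fun z => 1 / (z - w)) x0 x1 y0 y1)%C by ring.
      rewrite E. ring.
    + intros z Hz. apply H2; auto. apply bd_in_rect; auto; lra.
    + intros z Hz. apply H1; auto.
  - intros z Hz. field. apply Csub_neq0; auto.
Qed.

(** The imaginary part is a sum of two real integrals, one for each pair of opposite sides, and both
    integrands are positive because [w] lies strictly between the sides. *)
Lemma winding_neq0 (x0 x1 y0 y1 : R) (w : C) : x0 < Re w < x1 -> y0 < Im w < y1 ->
  rint (fun z => 1 / (z - w))%C x0 x1 y0 y1 <> 0%C.
Proof.
  intros Hx Hy E. apply (f_equal Im) in E. revert E. apply Rgt_not_eq.
  assert (H1 : forall z, bd x0 x1 y0 y1 z -> cdiff (fun z => 1 / (z - w))%C z).
  { intros z Hz. apply cdiff_div; [|eexists; apply cder_const|apply cdiff_sub_const, cdiff_id].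
    apply Csub_neq0; auto. intros ->. unfold bd in Hz. lra. }
  assert (C1 := cok_hh _ _ _ _ _ H1). assert (C2 := cok_vv _ _ _ _ _ H1).
  unfold rint, cint. simpl.
  match goal with |- ?a + (0 * ?b + 1 * ?c) > 0 => enough (0 < a /\ 0 < c) by lra end.
  set (u := Re w) in *. set (v := Im w) in *.
  assert (Hw : w = (u, v)) by (apply C_ext; auto).
  assert (P : forall a b, a <> 0 \/ b <> 0 -> 0 < a * a + b * b).
  { intros a b [H|H]; generalize (Rsqr_pos_lt _ H) (Rle_0_sqr a) (Rle_0_sqr b); unfold Rsqr; lra. }
  assert (K : forall x y, x <> u \/ y <> v ->
     Re (1 / ((x, y) - w))%C = (x - u) / ((x - u) * (x - u) + (y - v) * (y - v)) /\
     Im (1 / ((x, y) - w))%C = (v - y) / ((x - u) * (x - u) + (y - v) * (y - v))).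
  { intros x y Hxy. rewrite Hw. simpl.
    generalize (P (x - u) (y - v) ltac:(lra)). intros.
    split; field; unfold Rminus in *; nra. }
  split; apply RInt_gt_0; try lra.
  - intros x Hx'. generalize (proj2 (K x y0 ltac:(lra))) (proj2 (K x y1 ltac:(lra))).
    generalize (P (x - u) (y0 - v) ltac:(lra)) (P (x - u) (y1 - v) ltac:(lra)).
    intros Q1 Q2 E1 E2.
    change (0 < Im ((1 / ((x, y0) - w)) - (1 / ((x, y1) - w)))%C).
    replace (Im ((1 / ((x, y0) - w)) - (1 / ((x, y1) - w)))%C) with (Im (1 / ((x, y0) - w))%C - Im (1 / ((x, y1) - w))%C) by (simpl; ring).
    rewrite E1, E2.
    assert (0 < (v - y0) / ((x - u) * (x - u) + (y0 - v) * (y0 - v))) by (apply Rdiv_lt_0_compat; lra).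
    assert (0 < (y1 - v) / ((x - u) * (x - u) + (y1 - v) * (y1 - v))) by (apply Rdiv_lt_0_compat; lra).
    unfold Rdiv in *. lra.
  - intros x Hx'. apply (C1 x Hx').
  - intros y Hy'. generalize (proj1 (K x0 y ltac:(lra))) (proj1 (K x1 y ltac:(lra))).
    generalize (P (x0 - u) (y - v) ltac:(lra)) (P (x1 - u) (y - v) ltac:(lra)).
    intros Q1 Q2 E1 E2.
    change (0 < Re ((1 / ((x1, y) - w)) - (1 / ((x0, y) - w)))%C).
    replace (Re ((1 / ((x1, y) - w)) - (1 / ((x0, y) - w)))%C) with (Re (1 / ((x1, y) - w))%C - Re (1 / ((x0, y) - w))%C) by (simpl; ring).
    rewrite E1, E2.
    assert (0 < (x1 - u) / ((x1 - u) * (x1 - u) + (y - v) * (y - v))) by (apply Rdiv_lt_0_compat; lra).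
    assert (0 < (u - x0) / ((x0 - u) * (x0 - u) + (y - v) * (y - v))) by (apply Rdiv_lt_0_compat; lra).
    unfold Rdiv in *. lra.
  - intros y Hy'. apply (C2 y Hy').
Qed.

(** Differentiation under the integral sign: an error of second order in v - w, uniform in [z], is
    integrated along the boundary. *)
Lemma cder_rint (G : C -> C -> C) (G' : C -> C) (w : C) (x0 x1 y0 y1 r Q : R) :
  x0 <= x1 -> y0 <= y1 -> 0 < r -> 0 <= Q ->
  (forall z v, bd x0 x1 y0 y1 z -> Cmod (v - w)%C < r -> cdiff (G v) z) ->
  (forall z, bd x0 x1 y0 y1 z -> cdiff G' z) ->
  (forall z v, bd x0 x1 y0 y1 z -> Cmod (v - w)%C < r ->
     Cmod (G v z - G w z - (v - w) * G' z)%C <= Q * (Cmod (v - w) * Cmod (v - w))) ->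
  cder (fun v => rint (G v) x0 x1 y0 y1) w (rint G' x0 x1 y0 y1).
Proof.
  intros Hx Hy Hr HQ H1 H2 H3 eps He.
  set (P := 4 * (Q + 1) * ((x1 - x0) + (y1 - y0)) + 1).
  assert (HP : 0 < P) by (unfold P; nra).
  exists (Rmin r (eps / P)). split; [apply Rmin_pos; auto; apply Rdiv_lt_0_compat; lra|].
  intros v Hv. generalize (Rmin_l r (eps / P)) (Rmin_r r (eps / P)); intros.
  assert (Hw : Cmod (w - w)%C < r) by (replace (w - w)%C with (RtoC 0) by ring; rewrite Cmod_0; auto).
  set (h := Cmod (v - w)%C) in *. assert (Hh : 0 <= h) by apply Cmod_ge_0.
  assert (D1 : forall z, bd x0 x1 y0 y1 z -> cdiff (fun z => 1 * G v z + (-(1)) * G w z)%C z).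
  { intros z Hz. apply cdiff_lin; apply H1; auto. unfold h in *; lra. }
  replace (rint (G v) x0 x1 y0 y1 - rint (G w) x0 x1 y0 y1 - rint G' x0 x1 y0 y1 * (v - w))%C
    with (rint (fun z => 1 * (1 * G v z + (-(1)) * G w z) + (- (v - w)) * G' z)%C x0 x1 y0 y1).
  - eapply Rle_trans; [apply (rint_bound _ _ _ _ _ (Q * (h * h)))|]; auto.
    + intros z Hz. apply cdiff_lin; auto.
    + intros z Hz. unfold h. replace (1 * (1 * G v z + - (1) * G w z) + - (v - w) * G' z)%C
        with (G v z - G w z - (v - w) * G' z)%C by ring.
      apply H3; auto. unfold h in *; lra.
    + assert (h * P <= eps).
      { apply (Rmult_le_reg_r (/ P)); [apply Rinv_0_lt_compat; lra|].
        rewrite Rmult_assoc, Rinv_r by lra. unfold Rdiv in *. lra. }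
      assert (4 * Q * ((x1 - x0) + (y1 - y0)) <= P).
      { unfold P. assert (0 <= (x1 - x0) + (y1 - y0)) by lra. nra. }
      replace (4 * (Q * (h * h)) * (x1 - x0 + (y1 - y0))) with (h * (h * (4 * Q * ((x1 - x0) + (y1 - y0))))) by ring.
      rewrite (Rmult_comm eps). apply Rmult_le_compat_l; auto.
      eapply Rle_trans; [|exact H4]. apply Rmult_le_compat_l; auto.
  - rewrite (rint_lin 1 (- (v - w))%C (fun z => 1 * G v z + (-(1)) * G w z)%C G'); auto.
    rewrite rint_lin; auto; try (intros; apply H1; auto; unfold h in *; lra). ring.
Qed.

(** * Derivatives of holomorphic functions are holomorphic *)

(** [h] is kept general because the kernel is applied both to the function of Cauchy's formula and
    to the constant 1 in the denominator. *)
Section CauchyKernel.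
Variables (h : C -> C) (x0 x1 y0 y1 M rho : R) (w : C).
Hypotheses (Hx : x0 <= x1) (Hy : y0 <= y1) (Hrho : 0 < rho).
Hypothesis Hh : forall z, bd x0 x1 y0 y1 z -> cdiff h z /\ Cmod (h z) <= M.
Hypothesis Hw : forall z, bd x0 x1 y0 y1 z -> rho <= Cmod (z - w)%C.

Lemma kernel_away (z v : C) : bd x0 x1 y0 y1 z -> Cmod (v - w)%C < rho / 2 ->
  rho / 2 <= Cmod (z - v)%C /\ (z - v <> 0)%C.
Proof.
  intros Hz Hv. assert (H : rho / 2 <= Cmod (z - v)%C).
  { generalize (Hw z Hz) (Cmod_triangle (z - v)%C (v - w)%C).
    replace (z - v + (v - w))%C with (z - w)%C by ring. lra. }
  split; auto. apply Cmod_gt_0. lra.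
Qed.

Lemma kernel_inv_bound (z v : C) : bd x0 x1 y0 y1 z -> Cmod (v - w)%C < rho / 2 ->
  Cmod (/ (z - v))%C <= 2 / rho.
Proof.
  intros Hz Hv. destruct (kernel_away z v Hz Hv) as [A B].
  rewrite Cmod_inv by auto. replace (2 / rho) with (/ (rho / 2)) by (field; lra).
  apply Rinv_le_contravar; lra.
Qed.

Lemma kernel_center : Cmod (w - w)%C < rho / 2.
Proof. replace (w - w)%C with (RtoC 0) by ring. rewrite Cmod_0. lra. Qed.

Lemma cdiff_kernel (k : nat) (z v : C) : bd x0 x1 y0 y1 z -> Cmod (v - w)%C < rho / 2 ->
  cdiff (fun z => h z * Cpow (/ (z - v)) k)%C z.
Proof.
  intros Hz Hv. apply cdiff_mult; [apply Hh; auto|]. destruct k.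
  - eexists; simpl; apply cder_const.
  - eexists. apply (cder_comp (fun u => Cpow u (S k)) (fun z => (/ (z - v))%C)); [apply cder_pow|].
    apply (cder_comp Cinv (fun z => (z - v)%C)).
    + apply cder_inv0. apply kernel_away; auto.
    + apply cder_minus; [apply cder_id|apply cder_const].
Qed.

Lemma cder_kernel1 : cder (fun v => rint (fun z => h z * Cpow (/ (z - v)) 1)%C x0 x1 y0 y1) w
  (rint (fun z => h z * Cpow (/ (z - w)) 2)%C x0 x1 y0 y1).
Proof.
  apply (cder_rint (fun v z => h z * Cpow (/ (z - v)) 1)%C (fun z => h z * Cpow (/ (z - w)) 2)%C w _ _ _ _ (rho / 2)
    (Rabs M * (2 / rho) ^ 3)); auto; try lra.
  - apply Rmult_le_pos; [apply Rabs_pos|]. apply pow_le, Rlt_le, Rdiv_lt_0_compat; lra.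
  - intros; apply cdiff_kernel; auto.
  - intros; apply cdiff_kernel; auto using kernel_center.
  - intros z v Hz Hv.
    destruct (kernel_away z v Hz Hv) as [_ N1]. destruct (kernel_away z w Hz kernel_center) as [_ N2].
    assert (I1 := kernel_inv_bound z v Hz Hv). assert (I2 := kernel_inv_bound z w Hz kernel_center).
    replace (h z * (/ (z - v)) ^ 1 - h z * (/ (z - w)) ^ 1 - (v - w) * (h z * (/ (z - w)) ^ 2))%C
      with (h z * (/ (z - v) * (/ (z - w) * / (z - w))) * ((v - w) * (v - w)))%C by (field; auto).
    rewrite !Cmod_mult. apply Rmult_le_compat_r; [apply Rmult_le_pos; apply Cmod_ge_0|].
    apply Rmult_le_compat; [apply Cmod_ge_0| | |].
    + repeat apply Rmult_le_pos; apply Cmod_ge_0.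
    + apply Rle_trans with M; [apply Hh; auto|apply Rle_abs].
    + simpl. rewrite Rmult_1_r. repeat apply Rmult_le_compat; auto; try apply Rmult_le_pos; apply Cmod_ge_0.
Qed.

(** With A = 1/(z - v) and B = 1/(z - w), the remainder is (2 A B^3 + A^2 B^2) (v - w)^2, whence the
    constant 3. The summand [0 * 0] only gives the integrand the shape of [cdiff_lin]. *)
Lemma cder_kernel2 : cder (fun v => rint (fun z => h z * Cpow (/ (z - v)) 2)%C x0 x1 y0 y1) w
  (rint (fun z => 2 * (h z * Cpow (/ (z - w)) 3) + 0 * 0)%C x0 x1 y0 y1).
Proof.
  apply (cder_rint (fun v z => h z * Cpow (/ (z - v)) 2)%C (fun z => 2 * (h z * Cpow (/ (z - w)) 3) + 0 * 0)%C w _ _ _ _ (rho / 2)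
    (Rabs M * (3 * (2 / rho) ^ 4))); auto; try lra.
  - apply Rmult_le_pos; [apply Rabs_pos|]. apply Rmult_le_pos; [lra|]. apply pow_le, Rlt_le, Rdiv_lt_0_compat; lra.
  - intros; apply cdiff_kernel; auto.
  - intros; apply cdiff_lin; [apply cdiff_kernel; auto using kernel_center|eexists; apply cder_const].
  - intros z v Hz Hv.
    destruct (kernel_away z v Hz Hv) as [_ N1]. destruct (kernel_away z w Hz kernel_center) as [_ N2].
    assert (I1 := kernel_inv_bound z v Hz Hv). assert (I2 := kernel_inv_bound z w Hz kernel_center).
    replace (h z * (/ (z - v)) ^ 2 - h z * (/ (z - w)) ^ 2 - (v - w) * (2 * (h z * (/ (z - w)) ^ 3) + 0 * 0))%C
      with (h z * (2 * (/ (z - v) * (/ (z - w) * (/ (z - w) * / (z - w)))) +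
          / (z - v) * (/ (z - v) * (/ (z - w) * / (z - w)))) * ((v - w) * (v - w)))%C by (field; auto).
    rewrite !Cmod_mult. apply Rmult_le_compat_r; [apply Rmult_le_pos; apply Cmod_ge_0|].
    apply Rmult_le_compat; [apply Cmod_ge_0|apply Cmod_ge_0| |].
    + apply Rle_trans with M; [apply Hh; auto|apply Rle_abs].
    + eapply Rle_trans; [apply Cmod_triangle|]. rewrite !Cmod_mult, Cmod_R, Rabs_pos_eq by lra.
      simpl. rewrite Rmult_1_r. set (b := 2 / rho) in *.
      replace (3 * (b * (b * (b * b)))) with (2 * (b * (b * (b * b))) + b * (b * (b * b))) by ring.
      apply Rplus_le_compat; repeat apply Rmult_le_compat; auto; try lra; repeat apply Rmult_le_pos; apply Cmod_ge_0.
Qed.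
End CauchyKernel.

(** Cauchy's formula writes [f] as a quotient of two parametric integrals,
    each of which can be differentiated twice. *)
Lemma cdiff_derivative (f : C -> C) (z0 : C) (r : R) : 0 < r ->
  (forall z, Cmod (z - z0)%C < r -> cdiff f z) ->
  exists g s, 0 < s /\ (forall z, Cmod (z - z0)%C < s -> cder f z (g z)) /\ cdiff g z0.
Proof.
  intros Hr Hf.
  destruct (Hf z0) as [l Hl]; [replace (z0 - z0)%C with (RtoC 0) by ring; rewrite Cmod_0; auto|].
  destruct (cder_ccont _ _ _ Hl 1 Rlt_0_1) as [d [Hd Hd']].
  (* The square of half-side [s] around [z0] then lies in both discs: the one where [f] is
     differentiable and the one where [f] stays within 1 of [f z0]. *)
  set (s := Rmin r d / 4).
  assert (Hrd : 0 < Rmin r d) by (apply Rmin_pos; auto).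
  assert (H4 : Rmin r d = 4 * s) by (unfold s; field).
  generalize (Rmin_l r d) (Rmin_r r d); rewrite H4; intros Hsr Hsd.
  assert (Hs : 0 < s) by lra.
  set (u := Re z0). set (v := Im z0).
  set (x0 := u - s). set (x1 := u + s). set (y0 := v - s). set (y1 := v + s).
  assert (Hx : x0 <= x1) by (unfold x0, x1; lra). assert (Hy : y0 <= y1) by (unfold y0, y1; lra).
  assert (Hin : forall z, in_rect x0 x1 y0 y1 z -> Cmod (z - z0)%C < 4 * s).
  { intros z [A B]. eapply Rle_lt_trans; [apply Cmod_le_sum|].
    assert (Rabs (Re (z - z0)%C) <= s) by (unfold x0, x1, u in *; simpl; apply Rabs_le; unfold Re in *; lra).
    assert (Rabs (Im (z - z0)%C) <= s) by (unfold y0, y1, v in *; simpl; apply Rabs_le; unfold Im in *; lra).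
    lra. }
  assert (Hbd : forall z, bd x0 x1 y0 y1 z -> s <= Cmod (z - z0)%C).
  { intros z Hz. generalize (re_le_Cmod (z - z0)%C) (im_le_Cmod (z - z0)%C).
    replace (Re (z - z0)%C) with (Re z - u) by reflexivity.
    replace (Im (z - z0)%C) with (Im z - v) by reflexivity.
    generalize (Rle_abs (Re z - u)) (Rle_abs (Im z - v)) (Rabs_maj2 (Re z - u)) (Rabs_maj2 (Im z - v)).
    unfold bd, x0, x1, y0, y1 in Hz. lra. }
  set (M := Cmod (f z0) + 1).
  assert (HfM : forall z, bd x0 x1 y0 y1 z -> cdiff f z /\ Cmod (f z) <= M).
  { intros z Hz. assert (Hz' := Hin z (bd_in_rect _ _ _ _ _ Hx Hy Hz)). split; [apply Hf; lra|].
    specialize (Hd' z ltac:(lra)). unfold M.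
    generalize (Cmod_triangle (f z0) (f z - f z0)%C). replace (f z0 + (f z - f z0))%C with (f z) by ring. lra. }
  assert (H1M : forall z, bd x0 x1 y0 y1 z -> cdiff (fun _ => RtoC 1) z /\ Cmod 1 <= 1).
  { intros z Hz. split; [eexists; apply cder_const|rewrite Cmod_1; lra]. }
  assert (Haw : forall w, Cmod (w - z0)%C < s / 2 -> forall z, bd x0 x1 y0 y1 z -> s / 2 <= Cmod (z - w)%C).
  { intros w Hw z Hz. generalize (Hbd z Hz) (Cmod_triangle (z - w)%C (w - z0)%C).
    replace (z - w + (w - z0))%C with (z - z0)%C by ring. lra. }
  set (W := fun w => rint (fun z => f z * Cpow (/ (z - w)) 1)%C x0 x1 y0 y1).
  set (W' := fun w => rint (fun z => f z * Cpow (/ (z - w)) 2)%C x0 x1 y0 y1).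
  set (N := fun w => rint (fun z => 1 * Cpow (/ (z - w)) 1)%C x0 x1 y0 y1).
  set (N' := fun w => rint (fun z => 1 * Cpow (/ (z - w)) 2)%C x0 x1 y0 y1).
  assert (HW : forall w, Cmod (w - z0)%C < s / 2 -> cder W w (W' w)).
  { intros w Hw. apply (cder_kernel1 f x0 x1 y0 y1 M (s / 2)); auto; lra. }
  assert (HN : forall w, Cmod (w - z0)%C < s / 2 -> cder N w (N' w)).
  { intros w Hw. apply (cder_kernel1 (fun _ => RtoC 1) x0 x1 y0 y1 1 (s / 2)); auto; lra. }
  assert (HWN : forall w, Cmod (w - z0)%C < s / 2 -> N w <> 0%C /\ f w = (W w / N w)%C).
  { intros w Hw.
    assert (Hre : Rabs (Re w - u) < s / 2).
    { generalize (re_le_Cmod (w - z0)%C). replace (Re (w - z0)%C) with (Re w - u) by reflexivity. lra. }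
    assert (Him : Rabs (Im w - v) < s / 2).
    { generalize (im_le_Cmod (w - z0)%C). replace (Im (w - z0)%C) with (Im w - v) by reflexivity. lra. }
    apply Rabs_def2 in Hre. apply Rabs_def2 in Him.
    assert (Hux : x0 < Re w < x1) by (unfold x0, x1; lra).
    assert (Huy : y0 < Im w < y1) by (unfold y0, y1; lra).
    assert (EN : N w = rint (fun z => 1 / (z - w))%C x0 x1 y0 y1).
    { unfold N. apply rint_ext; auto. intros. simpl. unfold Cdiv. ring. }
    assert (EW : W w = rint (fun z => f z / (z - w))%C x0 x1 y0 y1).
    { unfold W. apply rint_ext; auto. intros. simpl. unfold Cdiv. ring. }
    assert (Hn : N w <> 0%C) by (rewrite EN; apply winding_neq0; auto).
    split; auto. rewrite EW, <- cauchy_rect, <- EN; auto.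
    - field; auto.
    - intros z Hz. apply Hf. specialize (Hin z Hz). lra. }
  (* The quotient rule. Radius s / 4 leaves around each [w] a disc of radius s / 4 on which Cauchy's
     formula, valid up to s / 2, still holds. *)
  exists (fun w => ((W' w * N w - W w * N' w) / (N w * N w))%C), (s / 4).
  split; [lra|]. split.
  - intros w Hw. apply (cder_ext_loc (fun w => W w / N w)%C) with (s / 4); [lra| |].
    + intros w' Hw'. symmetry. apply HWN.
      generalize (Cmod_triangle (w' - w)%C (w - z0)%C). replace (w' - w + (w - z0))%C with (w' - z0)%C by ring. lra.
    + apply cder_div; [apply HWN; lra|apply HW; lra|apply HN; lra].
  - assert (H0 : Cmod (z0 - z0)%C < s / 2).
    { replace (z0 - z0)%C with (RtoC 0) by ring. rewrite Cmod_0. lra. }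
    assert (cdiff W z0) by (eexists; apply HW; auto).
    assert (cdiff N z0) by (eexists; apply HN; auto).
    assert (cdiff W' z0) by (eexists; apply (cder_kernel2 f x0 x1 y0 y1 M (s / 2)); auto; lra).
    assert (cdiff N' z0) by (eexists; apply (cder_kernel2 (fun _ => RtoC 1) x0 x1 y0 y1 1 (s / 2)); auto; lra).
    apply cdiff_div.
    + destruct (HWN z0 H0). apply Cmult_neq_0; auto.
    + destruct (cdiff_mult W' N z0) as [a Ha]; auto. destruct (cdiff_mult W N' z0) as [b Hb]; auto.
      eexists. apply cder_minus; eauto.
    + apply cdiff_mult; auto.
Qed.

(** * Holomorphic functions on the upper half plane *)

Lemma holo_cdiff (f : C -> C) : holo f <-> forall z, inH z -> cdiff f z.
Proof.
  split; intros H z Hz; destruct (H z Hz) as [l Hl]; exists l; apply is_derive_cder; auto.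
Qed.

Lemma inH_open (z w : C) : Cmod (w - z)%C < Im z -> inH w.
Proof.
  intros H. generalize (im_le_Cmod (w - z)%C) (Rabs_maj2 (Im (w - z)%C)).
  unfold inH. replace (Im (w - z)%C) with (Im w - Im z) by reflexivity. lra.
Qed.

Lemma holo_cder (f : C -> C) (z : C) : holo f -> inH z -> cder f z (cderiv f z).
Proof.
  intros H Hz. destruct (proj1 (holo_cdiff f) H z Hz) as [l Hl].
  rewrite (cder_cderiv f z l Hl). exact Hl.
Qed.

Lemma holo_ext (f g : C -> C) : eqH f g -> holo f -> holo g.
Proof.
  intros E H. apply holo_cdiff. intros z Hz. eexists.
  apply (cder_ext_loc f g) with (Im z); [exact Hz| |apply holo_cder; auto].
  intros w Hw. apply E. apply (inH_open z w Hw).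
Qed.

Lemma holo_cderiv (f : C -> C) : holo f -> holo (cderiv f).
Proof.
  intros H. apply holo_cdiff. intros z Hz.
  destruct (cdiff_derivative f z (Im z)) as (g & s & Hs & Hg & l & Hl); [exact Hz| |].
  - intros w Hw. apply (proj1 (holo_cdiff f) H). apply (inH_open z w Hw).
  - exists l. apply (cder_ext_loc g) with s; auto. intros w Hw. symmetry. apply cder_cderiv; auto.
Qed.

(** * Convolution sums of divisor functions *)

Definition lsum {A : Type} (f : A -> R) (l : list A) : R := fold_right Rplus 0 (map f l).

Lemma lsum_app {A} (f : A -> R) (l l' : list A) : lsum f (l ++ l') = lsum f l + lsum f l'.
Proof. unfold lsum. induction l as [|x l IH]; simpl; [lra|]. rewrite IH. lra. Qed.

Lemma lsum_ext {A} (f g : A -> R) (l : list A) : (forall x, In x l -> f x = g x) -> lsum f l = lsum g l.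
Proof. intros H. unfold lsum. f_equal. apply map_ext_in. auto. Qed.

Lemma lsum_lin {A} (c d : R) (f g : A -> R) (l : list A) :
  lsum (fun x => c * f x + d * g x) l = c * lsum f l + d * lsum g l.
Proof. unfold lsum. induction l as [|x l IH]; simpl; [lra|]. rewrite IH. lra. Qed.

Lemma lsum_scal {A} (c : R) (f : A -> R) (l : list A) : lsum (fun x => c * f x) l = c * lsum f l.
Proof. unfold lsum. induction l as [|x l IH]; simpl; [lra|]. rewrite IH. lra. Qed.

Lemma lsum_scal_r {A} (c : R) (f : A -> R) (l : list A) : lsum (fun x => f x * c) l = lsum f l * c.
Proof. unfold lsum. induction l as [|x l IH]; simpl; [lra|]. rewrite IH. lra. Qed.

Lemma lsum_map {A B} (f : B -> R) (h : A -> B) (l : list A) : lsum f (map h l) = lsum (fun x => f (h x)) l.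
Proof. unfold lsum. rewrite map_map. reflexivity. Qed.

Lemma lsum_flat_map {A B} (f : B -> R) (h : A -> list B) (l : list A) :
  lsum f (flat_map h l) = lsum (fun x => lsum f (h x)) l.
Proof.
  induction l as [|x l IH]; [reflexivity|]. simpl. rewrite lsum_app, IH. reflexivity.
Qed.

Lemma lsum_filter {A} (p : A -> bool) (f : A -> R) (l : list A) :
  lsum f (filter p l) = lsum (fun x => if p x then f x else 0) l.
Proof.
  unfold lsum. induction l as [|x l IH]; simpl; auto. destruct (p x); simpl; rewrite IH; lra.
Qed.

Lemma lsum_const {A} (c : R) (l : list A) : lsum (fun _ => c) l = INR (length l) * c.
Proof.
  unfold lsum. induction l as [|x l IH]; [simpl; lra|].
  simpl fold_right. rewrite IH. simpl length. rewrite S_INR. lra.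
Qed.

Lemma lsum_perm {A} (f : A -> R) (l l' : list A) : Permutation l l' -> lsum f l = lsum f l'.
Proof.
  unfold lsum. induction 1; simpl; lra.
Qed.

Lemma lsum_bij {A B} (phi : A -> B) (f : A -> R) (g : B -> R) (l : list A) (l' : list B) :
  NoDup l -> NoDup l' ->
  (forall x, In x l -> In (phi x) l' /\ f x = g (phi x)) ->
  (forall x y, In x l -> In y l -> phi x = phi y -> x = y) ->
  (forall y, In y l' -> exists x, In x l /\ phi x = y) ->
  lsum f l = lsum g l'.
Proof.
  intros N N' H1 H2 H3.
  transitivity (lsum g (map phi l)).
  - rewrite lsum_map. apply lsum_ext. intros x Hx. apply H1; auto.
  - assert (P : Permutation (map phi l) l').
    { apply NoDup_Permutation; auto.
      - apply NoDup_map_NoDup_ForallPairs; [|exact N]. unfold ForallPairs. exact H2.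
      - intros y. rewrite in_map_iff. split.
        + intros (x & <- & Hx). apply H1; auto.
        + intros Hy. destruct (H3 y Hy) as (x & Hx & <-). eauto. }
    apply lsum_perm; auto.
Qed.

Lemma NoDup_flat_map {A B} (h : A -> list B) (l : list A) : NoDup l ->
  (forall x, In x l -> NoDup (h x)) ->
  (forall x y z, In x l -> In y l -> In z (h x) -> In z (h y) -> x = y) ->
  NoDup (flat_map h l).
Proof.
  induction l as [|x l IH]; intros N H1 H2; simpl; [constructor|].
  inversion N; subst. apply NoDup_app.
  - apply H1; left; auto.
  - apply IH; auto.
    + intros; apply H1; right; auto.
    + intros a b c Ha Hb; apply H2; right; auto.
  - intros z Hz Hz'. apply in_flat_map in Hz'. destruct Hz' as (y & Hy & Hzy).
    assert (x = y) by (apply (H2 x y z); simpl; auto). congruence.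
Qed.

Definition divs (n : nat) : list nat := filter (fun d => Nat.eqb (Nat.modulo n d) 0) (seq 1 n).

Lemma sigma_divs (r n : nat) : Defs.sigma r n = lsum (fun d => INR d ^ r) (divs n).
Proof. unfold divs. rewrite lsum_filter. reflexivity. Qed.

Lemma in_divs (n d : nat) : In d (divs n) <-> (1 <= n /\ 1 <= d /\ d * (n / d) = n)%nat.
Proof.
  unfold divs. rewrite filter_In, in_seq, Nat.eqb_eq. split.
  - intros [H1 H2]. split; [lia|]. split; [lia|]. symmetry. apply Nat.Div0.div_exact; lia.
  - intros (H1 & H2 & H3). split; [|rewrite <- H3 at 1; rewrite Nat.mul_comm; apply Nat.Div0.mod_mul].
    assert (n / d <> 0)%nat by (intros E; rewrite E in H3; lia). nia.
Qed.

Lemma in_divs_mult (a x : nat) : (1 <= a)%nat -> (1 <= x)%nat -> In a (divs (a * x)) /\ (a * x / a = x)%nat.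
Proof.
  intros Ha Hx. assert (E : (a * x / a = x)%nat) by (rewrite Nat.mul_comm; apply Nat.div_mul; lia).
  rewrite in_divs, E. repeat split; nia.
Qed.

Lemma NoDup_divs (n : nat) : NoDup (divs n).
Proof. apply NoDup_filter, seq_NoDup. Qed.

(** The quadruples [((a, x), (b, y))] of positive integers with [a x + b y = n]. *)
Definition sols (n : nat) : list ((nat * nat) * (nat * nat)) :=
  flat_map (fun k => flat_map (fun a => map (fun b => ((a, k / a), (b, (n - k) / b)))%nat (divs (n - k))) (divs k))
    (seq 1 (n - 1)).

Lemma in_sols (n a x b y : nat) : In ((a, x), (b, y)) (sols n) <->
  (1 <= a /\ 1 <= x /\ 1 <= b /\ 1 <= y /\ a * x + b * y = n)%nat.
Proof.
  unfold sols. rewrite in_flat_map. split.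
  - intros (k & Hk & H). apply in_seq in Hk. apply in_flat_map in H. destruct H as (a' & Ha & H).
    apply in_map_iff in H. destruct H as (b' & E & Hb). injection E as -> <- -> <-.
    apply in_divs in Ha. apply in_divs in Hb. nia.
  - intros (H1 & H2 & H3 & H4 & H5). exists (a * x)%nat. split; [apply in_seq; nia|].
    apply in_flat_map. exists a. destruct (in_divs_mult a x H1 H2) as [A1 A2]. split; auto.
    apply in_map_iff. exists b. replace (n - a * x)%nat with (b * y)%nat by lia.
    destruct (in_divs_mult b y H3 H4) as [B1 B2]. rewrite A2, B2. auto.
Qed.

Lemma NoDup_sols (n : nat) : NoDup (sols n).
Proof.
  apply NoDup_flat_map; [apply seq_NoDup| |].
  - intros k _. apply NoDup_flat_map; [apply NoDup_divs| |].
    + intros a _. apply NoDup_map_NoDup_ForallPairs; [|apply NoDup_divs].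
      intros b b' _ _ E. congruence.
    + intros a a' z _ _ H H'. apply in_map_iff in H. apply in_map_iff in H'.
      destruct H as (b & <- & _). destruct H' as (b' & E & _). congruence.
  - intros k k' z _ _ H H'. apply in_flat_map in H. apply in_flat_map in H'.
    destruct H as (a & Ha & H). destruct H' as (a' & Ha' & H').
    apply in_map_iff in H. apply in_map_iff in H'.
    destruct H as (b & <- & _). destruct H' as (b' & E & _).
    apply in_divs in Ha. apply in_divs in Ha'.
    assert (E' : (a * (k / a) = a' * (k' / a'))%nat) by congruence.
    exact (eq_trans (eq_sym (proj2 (proj2 Ha))) (eq_trans E' (proj2 (proj2 Ha')))).
Qed.

Definition conv (r s n : nat) : R := lsum (fun k => Defs.sigma r k * Defs.sigma s (n - k)) (seq 1 (n - 1)).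

Definition onsols (h : nat -> nat -> R) (z : (nat * nat) * (nat * nat)) : R := h (fst (fst z)) (fst (snd z)).

(** Grouping by k = a x: then [a] runs through the divisors of k, [b] through those of n - k, and x,
    y are determined. *)
Lemma lsum_sols_conv (r s n : nat) :
  lsum (onsols (fun a b => INR a ^ r * INR b ^ s)) (sols n) = conv r s n.
Proof.
  unfold sols, conv. rewrite lsum_flat_map. apply lsum_ext. intros k _.
  rewrite lsum_flat_map, !sigma_divs, <- lsum_scal_r. apply lsum_ext. intros a _.
  rewrite lsum_map. unfold onsols; simpl. apply lsum_scal.
Qed.

Lemma lsum_sols_swap (h : nat -> nat -> R) (n : nat) :
  lsum (onsols h) (sols n) = lsum (onsols (fun a b => h b a)) (sols n).
Proof.
  apply (lsum_bij (fun z => (snd z, fst z))); try apply NoDup_sols.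
  - intros [[a x] [b y]] H. simpl. rewrite in_sols in *. split; [lia|reflexivity].
  - intros [[a x] [b y]] [[a' x'] [b' y']] _ _ E. simpl in E. congruence.
  - intros [[a x] [b y]] H. exists ((b, y), (a, x)). rewrite in_sols in *. split; [lia|reflexivity].
Qed.

Lemma lsum_trichotomy {A} (f : A -> R) (u v : A -> nat) (l : list A) :
  lsum f l = lsum f (filter (fun z => u z <? v z)%nat l) + lsum f (filter (fun z => v z <? u z)%nat l)
    + lsum f (filter (fun z => u z =? v z)%nat l).
Proof.
  rewrite !lsum_filter. unfold lsum. induction l as [|z l IH]; simpl; [lra|]. rewrite IH.
  destruct (Nat.ltb_spec (u z) (v z)), (Nat.ltb_spec (v z) (u z)), (Nat.eqb_spec (u z) (v z)); try lia; lra.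
Qed.

Definition aof (z : (nat * nat) * (nat * nat)) := fst (fst z).
Definition xof (z : (nat * nat) * (nat * nat)) := snd (fst z).
Definition bof (z : (nat * nat) * (nat * nat)) := fst (snd z).
Definition yof (z : (nat * nat) * (nat * nat)) := snd (snd z).

Ltac sols_solve :=
  unfold aof, bof, xof, yof in *; simpl in *;
  repeat match goal with
  | H : In _ (filter _ _) |- _ => apply filter_In in H; destruct H; simpl in *
  | |- context [In _ (filter _ _)] => rewrite filter_In; simpl
  | H : (_ <? _)%nat = true |- _ => apply Nat.ltb_lt in H
  | H : (_ =? _)%nat = true |- _ => apply Nat.eqb_eq in H
  | |- context [(_ <? _)%nat = true] => rewrite Nat.ltb_lt
  | |- context [(_ =? _)%nat = true] => rewrite Nat.eqb_eq
  | H : context [In _ (sols _)] |- _ => rewrite in_sols in H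
  | |- context [In _ (sols _)] => rewrite in_sols
  end; repeat split; try nia.

(** Skoruppa's argument: [a x + b y = (a + b) x + b (y - x)] matches the
    solutions with [x < y] with those with [a > b]. *)
Lemma sols_shift (h : nat -> nat -> R) (n : nat) :
  (forall a b, h a b = h b a) -> (forall a b, h (a + b)%nat b = h (a + b)%nat a) ->
  lsum (onsols (fun a b => h (a + b)%nat b)) (sols n) - lsum (onsols h) (sols n) =
  lsum (fun d => lsum (fun a => h d (d - a)%nat) (seq 1 (d - 1)) - INR (n / d - 1) * h d d) (divs n).
Proof.
  intros Hsym Hinv.
  rewrite (lsum_trichotomy _ xof yof), (lsum_trichotomy (onsols h) bof aof).
  set (f := onsols (fun a b => h (a + b)%nat b)).
  assert (E1 : lsum f (filter (fun z => xof z <? yof z)%nat (sols n)) =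
    lsum (onsols h) (filter (fun z => bof z <? aof z)%nat (sols n))).
  { apply (lsum_bij (fun z => ((aof z + bof z, xof z), (bof z, yof z - xof z)))%nat);
      try apply NoDup_filter, NoDup_sols.
    - intros [[a x] [b y]] H. sols_solve.
    - intros [[a x] [b y]] [[a' x'] [b' y']] H H' E. sols_solve. injection E. intros.
      assert (a = a') by lia. assert (y = y') by lia. congruence.
    - intros [[a x] [b y]] H. exists ((a - b, x), (b, y + x))%nat. sols_solve.
      replace (a - b + b)%nat with a by lia. replace (y + x - x)%nat with y by lia. reflexivity. }
  (* The solutions with x > y go to those with a < b by (a, x, b, y) -> (a, x - y, a + b, y). Both
     invariances of [h] enter here: h(a + b, b) = h(a + b, a) = h(a, a + b). *)
  assert (E2 : lsum f (filter (fun z => yof z <? xof z)%nat (sols n)) =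
    lsum (onsols h) (filter (fun z => aof z <? bof z)%nat (sols n))).
  { apply (lsum_bij (fun z => ((aof z, xof z - yof z), (aof z + bof z, yof z)))%nat);
      try apply NoDup_filter, NoDup_sols.
    - intros [[a x] [b y]] H. sols_solve. unfold f, onsols; simpl. rewrite Hinv. apply Hsym.
    - intros [[a x] [b y]] [[a' x'] [b' y']] H H' E. sols_solve. injection E. intros.
      assert (b = b') by lia. assert (x = x') by lia. congruence.
    - intros [[a x] [b y]] H. exists ((a, x + y), (b - a, y))%nat. sols_solve.
      replace (a + (b - a))%nat with b by lia. replace (x + y - y)%nat with x by lia. reflexivity. }
  (* If x = y, then d = a + b divides n and x = n / d, while [a] is free between 1 and d - 1. *)
  assert (E3 : lsum f (filter (fun z => xof z =? yof z)%nat (sols n)) =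
    lsum (fun d => lsum (fun a => h d (d - a)%nat) (seq 1 (d - 1))) (divs n)).
  { transitivity (lsum f (flat_map (fun d => map (fun a => ((a, n / d), (d - a, n / d))%nat) (seq 1 (d - 1))) (divs n))).
    - apply (lsum_bij (fun z => z)); auto.
      + apply NoDup_filter, NoDup_sols.
      + apply NoDup_flat_map; [apply NoDup_divs| |].
        * intros d _. apply NoDup_map_NoDup_ForallPairs; [|apply seq_NoDup]. intros a a' _ _ E. congruence.
        * intros d d' z _ _ H H'. apply in_map_iff in H, H'. destruct H as (a & <- & Ha). destruct H' as (a' & E & Ha').
          apply in_seq in Ha, Ha'. injection E. intros. lia.
      + intros [[a x] [b y]] H. split; auto. sols_solve. subst y.
        apply in_flat_map. exists (a + b)%nat. destruct (in_divs_mult (a + b) x) as [A1 A2]; try lia.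
        replace n with ((a + b) * x)%nat by lia. split; auto. apply in_map_iff. exists a. rewrite A2.
        split; [do 2 f_equal; lia|]. apply in_seq. lia.
      + intros z Hz. exists z. split; auto. apply in_flat_map in Hz. destruct Hz as (d & Hd & Hz).
        apply in_map_iff in Hz. destruct Hz as (a & <- & Ha). apply in_seq in Ha. apply in_divs in Hd.
        set (e := (n / d)%nat) in *. sols_solve.
    - rewrite lsum_flat_map. apply lsum_ext. intros d _. rewrite lsum_map. apply lsum_ext.
      intros a Ha. apply in_seq in Ha. unfold f, onsols; simpl. f_equal. lia. }
  (* If a = b = d, what remains is x + y = n / d, with n / d - 1 solutions in positive integers. *)
  assert (E4 : lsum (onsols h) (filter (fun z => bof z =? aof z)%nat (sols n)) =
    lsum (fun d => INR (n / d - 1) * h d d) (divs n)).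
  { transitivity (lsum (onsols h) (flat_map (fun d => map (fun x => ((d, x), (d, n / d - x))%nat) (seq 1 (n / d - 1))) (divs n))).
    - apply (lsum_bij (fun z => z)); auto.
      + apply NoDup_filter, NoDup_sols.
      + apply NoDup_flat_map; [apply NoDup_divs| |].
        * intros d _. apply NoDup_map_NoDup_ForallPairs; [|apply seq_NoDup]. intros a a' _ _ E. congruence.
        * intros d d' z _ _ H H'. apply in_map_iff in H, H'. destruct H as (a & <- & Ha). destruct H' as (a' & E & Ha').
          congruence.
      + intros [[a x] [b y]] H. split; auto. sols_solve. subst b.
        apply in_flat_map. exists a. destruct (in_divs_mult a (x + y)) as [A1 A2]; try lia.
        replace n with (a * (x + y))%nat by lia. split; auto. apply in_map_iff. exists x. rewrite A2.
        split; [do 2 f_equal; lia|]. apply in_seq. lia.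
      + intros z Hz. exists z. split; auto. apply in_flat_map in Hz. destruct Hz as (d & Hd & Hz).
        apply in_map_iff in Hz. destruct Hz as (a & <- & Ha). apply in_seq in Ha. apply in_divs in Hd.
        set (e := (n / d)%nat) in *. sols_solve.
    - rewrite lsum_flat_map. apply lsum_ext. intros d _. rewrite lsum_map.
      unfold onsols; simpl. rewrite lsum_const, length_seq. reflexivity. }
  rewrite E1, E2, E3, E4.
  transitivity (lsum (fun d => 1 * lsum (fun a => h d (d - a)%nat) (seq 1 (d - 1)) + (-1) * (INR (n / d - 1) * h d d)) (divs n)).
  - rewrite lsum_lin. lra.
  - apply lsum_ext. intros; lra.
Qed.

Lemma lsum_sols_lin (c d : R) (f g : nat -> nat -> R) (n : nat) :
  lsum (onsols (fun a b => c * f a b + d * g a b)) (sols n) =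
  c * lsum (onsols f) (sols n) + d * lsum (onsols g) (sols n).
Proof. apply (lsum_lin c d (onsols f) (onsols g)). Qed.

Lemma lsum_seq_S (f : nat -> R) (N : nat) : lsum f (seq 1 (S N)) = lsum f (seq 1 N) + f (S N).
Proof. rewrite seq_S, lsum_app. unfold lsum at 2. simpl. lra. Qed.

(** [qform] and [cform ^ 2] are invariant under [(a, b) -> (b, a)] and
    [(a, b) -> (a, a - b)]; [qform ^ 2], [cform ^ 2] and [qform ^ 3] give the three
    convolution sums below. *)
Definition qform (a b : nat) : R := INR a * INR a - INR a * INR b + INR b * INR b.
Definition cform (a b : nat) : R := INR a * INR b * (INR a - INR b).

Lemma in_divs_INR (n d : nat) : In d (divs n) ->
  INR d <> 0 /\ INR (n / d - 1) = INR n / INR d - 1 /\ INR (d - 1) = INR d - 1.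
Proof.
  intros H. apply in_divs in H. destruct H as (H1 & H2 & H3).
  assert (INR d <> 0) by (apply not_0_INR; lia). split; auto.
  assert (1 <= n / d)%nat by (destruct (n / d)%nat; lia).
  split; rewrite minus_INR; auto. f_equal. rewrite <- H3 at 2. rewrite mult_INR. field; auto.
Qed.

(** The summand is D^4 - 2 D^3 a + 3 D^2 a^2 - 2 D a^3 + a^4; each power sum is entered in
    Faulhaber's closed form. The next two sums are obtained in the same way. *)
Lemma qform2_sum (D : R) (N : nat) :
  lsum (fun a => (D * D - D * INR a + INR a * INR a) ^ 2) (seq 1 N) =
  let M := INR N in
  D ^ 4 * M - 2 * D ^ 3 * (M * (M + 1) / 2) + 3 * D ^ 2 * (M * (M + 1) * (2 * M + 1) / 6)
  - 2 * D * (M * (M + 1) / 2) ^ 2 + M * (M + 1) * (2 * M + 1) * (3 * M ^ 2 + 3 * M - 1) / 30.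
Proof.
  induction N as [|N IH]; [unfold lsum; simpl; field|].
  rewrite lsum_seq_S, IH, S_INR. cbv zeta. field.
Qed.

Lemma cform2_sum (D : R) (N : nat) :
  lsum (fun a => (D * (D - INR a) * INR a) ^ 2) (seq 1 N) =
  let M := INR N in
  D ^ 4 * (M * (M + 1) * (2 * M + 1) / 6) - 2 * D ^ 3 * (M * (M + 1) / 2) ^ 2
  + D ^ 2 * (M * (M + 1) * (2 * M + 1) * (3 * M ^ 2 + 3 * M - 1) / 30).
Proof.
  induction N as [|N IH]; [unfold lsum; simpl; field|].
  rewrite lsum_seq_S, IH, S_INR. cbv zeta. field.
Qed.

Lemma qform3_sum (D : R) (N : nat) :
  lsum (fun a => (D * D - D * INR a + INR a * INR a) ^ 3) (seq 1 N) =
  let M := INR N in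
  D ^ 6 * M - 3 * D ^ 5 * (M * (M + 1) / 2) + 6 * D ^ 4 * (M * (M + 1) * (2 * M + 1) / 6)
  - 7 * D ^ 3 * (M * (M + 1) / 2) ^ 2
  + 6 * D ^ 2 * (M * (M + 1) * (2 * M + 1) * (3 * M ^ 2 + 3 * M - 1) / 30)
  - 3 * D * (M ^ 2 * (M + 1) ^ 2 * (2 * M ^ 2 + 2 * M - 1) / 12)
  + M * (M + 1) * (2 * M + 1) * (3 * M ^ 4 + 6 * M ^ 3 - 3 * M + 1) / 42.
Proof.
  induction N as [|N IH]; [unfold lsum; simpl; field|].
  rewrite lsum_seq_S, IH, S_INR. cbv zeta. field.
Qed.

Lemma conv_sym (r s n : nat) : conv r s n = conv s r n.
Proof.
  rewrite <- !lsum_sols_conv, lsum_sols_swap. apply lsum_ext. intros z _. unfold onsols. ring.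
Qed.

(** With S = a^2 + b^2 and P = a b, [qform a b] is S - P and [qform (a + b) b] is S + P. The squares
    differ by 4 S P = 4 (a b^3 + a^3 b), which sums to 8 times the convolution. The term with
    [INR n] comes from the count n / d - 1. *)
Lemma conv13 (n : nat) :
  240 * conv 1 3 n = 21 * Defs.sigma 5 n + (10 - 30 * INR n) * Defs.sigma 3 n - Defs.sigma 1 n.
Proof.
  assert (E := sols_shift (fun a b => qform a b ^ 2) n).
  cbv beta in E. specialize (E ltac:(intros; unfold qform; ring) ltac:(intros; unfold qform; rewrite plus_INR; ring)).
  assert (L : lsum (onsols (fun a b => qform (a + b) b ^ 2)) (sols n) - lsum (onsols (fun a b => qform a b ^ 2)) (sols n) = 8 * conv 1 3 n).
  { transitivity (lsum (onsols (fun a b => 4 * (INR a ^ 1 * INR b ^ 3) + 4 * (INR a ^ 3 * INR b ^ 1))) (sols n)).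
    - generalize (lsum_sols_lin 1 (-1) (fun a b => qform (a + b) b ^ 2) (fun a b => qform a b ^ 2) n).
      rewrite <- (lsum_ext (onsols (fun a b => 4 * (INR a ^ 1 * INR b ^ 3) + 4 * (INR a ^ 3 * INR b ^ 1)))).
      + lra.
      + intros z _. unfold onsols, qform. rewrite plus_INR. ring.
    - rewrite (lsum_sols_lin 4 4 (fun a b => INR a ^ 1 * INR b ^ 3) (fun a b => INR a ^ 3 * INR b ^ 1)).
      rewrite !lsum_sols_conv, (conv_sym 3 1). ring. }
  rewrite L in E.
  assert (R1 : lsum (fun d => lsum (fun a => qform d (d - a) ^ 2) (seq 1 (d - 1)) - INR (n / d - 1) * qform d d ^ 2) (divs n)
    = lsum (fun d => 1 * (21 / 30 * INR d ^ 5 + (1 / 3 - INR n) * INR d ^ 3) + (-1 / 30) * INR d ^ 1) (divs n)).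
  { apply lsum_ext. intros d Hd. destruct (in_divs_INR n d Hd) as (D0 & D1 & D2).
    rewrite (lsum_ext _ (fun a => (INR d * INR d - INR d * INR a + INR a * INR a) ^ 2)).
    - rewrite qform2_sum, D1, D2. unfold qform. cbv zeta. field; auto.
    - intros a Ha. apply in_seq in Ha. unfold qform. rewrite minus_INR by lia. ring. }
  rewrite R1, !lsum_lin, <- !sigma_divs in E. lra.
Qed.

(** Here (a b (a + b))^2 - (a b (a - b))^2 = 4 a^3 b^3. Since [cform d d] is 0, no term with n
    appears. *)
Lemma conv33 (n : nat) : 120 * conv 3 3 n = Defs.sigma 7 n - Defs.sigma 3 n.
Proof.
  assert (E := sols_shift (fun a b => cform a b ^ 2) n).
  cbv beta in E. specialize (E ltac:(intros; unfold cform; ring) ltac:(intros; unfold cform; rewrite plus_INR; ring)).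
  assert (L : lsum (onsols (fun a b => cform (a + b) b ^ 2)) (sols n) - lsum (onsols (fun a b => cform a b ^ 2)) (sols n) = 4 * conv 3 3 n).
  { transitivity (lsum (onsols (fun a b => 4 * (INR a ^ 3 * INR b ^ 3) + 0 * 0)) (sols n)).
    - generalize (lsum_sols_lin 1 (-1) (fun a b => cform (a + b) b ^ 2) (fun a b => cform a b ^ 2) n).
      rewrite <- (lsum_ext (onsols (fun a b => 4 * (INR a ^ 3 * INR b ^ 3) + 0 * 0))).
      + lra.
      + intros z _. unfold onsols, cform. rewrite plus_INR. ring.
    - rewrite (lsum_sols_lin 4 0 (fun a b => INR a ^ 3 * INR b ^ 3) (fun a b => 0)).
      rewrite !lsum_sols_conv. ring. }
  rewrite L in E.
  assert (R1 : lsum (fun d => lsum (fun a => cform d (d - a) ^ 2) (seq 1 (d - 1)) - INR (n / d - 1) * cform d d ^ 2) (divs n)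
    = lsum (fun d => 1 / 30 * INR d ^ 7 + (-1 / 30) * INR d ^ 3) (divs n)).
  { apply lsum_ext. intros d Hd. destruct (in_divs_INR n d Hd) as (D0 & D1 & D2).
    rewrite (lsum_ext _ (fun a => (INR d * (INR d - INR a) * INR a) ^ 2)).
    - rewrite cform2_sum, D1, D2. unfold cform. cbv zeta. field; auto.
    - intros a Ha. apply in_seq in Ha. unfold cform. rewrite minus_INR by lia. ring. }
  rewrite R1, !lsum_lin, <- !sigma_divs in E. lra.
Qed.

(** In the notation S = a^2 + b^2, P = a b, the cubes of S + P and S - P differ by 6 S^2 P + 2 P^3 =
    6 (a b^5 + a^5 b) + 14 a^3 b^3; the last term is removed by [conv33]. *)
Lemma conv15 (n : nat) :
  504 * conv 1 5 n = 20 * Defs.sigma 7 n + (21 - 42 * INR n) * Defs.sigma 5 n + Defs.sigma 1 n.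
Proof.
  assert (E := sols_shift (fun a b => qform a b ^ 3) n).
  cbv beta in E. specialize (E ltac:(intros; unfold qform; ring) ltac:(intros; unfold qform; rewrite plus_INR; ring)).
  assert (L : lsum (onsols (fun a b => qform (a + b) b ^ 3)) (sols n) - lsum (onsols (fun a b => qform a b ^ 3)) (sols n)
    = 12 * conv 1 5 n + 14 * conv 3 3 n).
  { transitivity (lsum (onsols (fun a b => 1 * (6 * (INR a ^ 1 * INR b ^ 5) + 6 * (INR a ^ 5 * INR b ^ 1)) + 14 * (INR a ^ 3 * INR b ^ 3))) (sols n)).
    - generalize (lsum_sols_lin 1 (-1) (fun a b => qform (a + b) b ^ 3) (fun a b => qform a b ^ 3) n).
      rewrite <- (lsum_ext (onsols (fun a b => 1 * (6 * (INR a ^ 1 * INR b ^ 5) + 6 * (INR a ^ 5 * INR b ^ 1)) + 14 * (INR a ^ 3 * INR b ^ 3)))).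
      + lra.
      + intros z _. unfold onsols, qform. rewrite plus_INR. ring.
    - rewrite (lsum_sols_lin 1 14 (fun a b => 6 * (INR a ^ 1 * INR b ^ 5) + 6 * (INR a ^ 5 * INR b ^ 1)) (fun a b => INR a ^ 3 * INR b ^ 3)).
      rewrite (lsum_sols_lin 6 6 (fun a b => INR a ^ 1 * INR b ^ 5) (fun a b => INR a ^ 5 * INR b ^ 1)).
      rewrite !lsum_sols_conv, (conv_sym 5 1). ring. }
  rewrite L in E.
  assert (R1 : lsum (fun d => lsum (fun a => qform d (d - a) ^ 3) (seq 1 (d - 1)) - INR (n / d - 1) * qform d d ^ 3) (divs n)
    = lsum (fun d => 1 * (1 * (1 * (25 / 42 - 1 / 420) * INR d ^ 7 + (1 / 2 - INR n) * INR d ^ 5) + (-7 / 60) * INR d ^ 3) + (1 / 42) * INR d ^ 1) (divs n)).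
  { apply lsum_ext. intros d Hd. destruct (in_divs_INR n d Hd) as (D0 & D1 & D2).
    rewrite (lsum_ext _ (fun a => (INR d * INR d - INR d * INR a + INR a * INR a) ^ 3)).
    - rewrite qform3_sum, D1, D2. unfold qform. cbv zeta. field; auto.
    - intros a Ha. apply in_seq in Ha. unfold qform. rewrite minus_INR by lia. ring. }
  rewrite R1, !lsum_lin, <- !sigma_divs in E. generalize (conv33 n). lra.
Qed.

(** * Series in [q] and Ramanujan's identities *)

Definition abss (a : nat -> C) : Prop := ex_series (fun n => Cmod (a n)).

Lemma ex_series_dom (a b : nat -> R) : (forall n, Rabs (a n) <= b n) -> ex_series b -> ex_series a.
Proof. intros H. apply (ex_series_le (V:=R_CompleteNormedModule)). exact H. Qed.

Lemma abss_dom (a : nat -> C) (b : nat -> R) : (forall n, Cmod (a n) <= b n) -> ex_series b -> abss a.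
Proof.
  intros H. apply ex_series_dom. intros n. rewrite Rabs_pos_eq by apply Cmod_ge_0. apply H.
Qed.

Lemma abss_parts (a : nat -> C) : abss a ->
  ex_series (fun n => Rabs (Re (a n))) /\ ex_series (fun n => Rabs (Im (a n))) /\
  ex_series (fun n => Re (a n)) /\ ex_series (fun n => Im (a n)).
Proof.
  intros H. repeat split; apply (ex_series_dom _ (fun n => Cmod (a n))); auto; intros n;
    rewrite ?Rabs_Rabsolu; auto using re_le_Cmod, im_le_Cmod.
Qed.

Lemma Csum_ext (a b : nat -> C) : (forall n, a n = b n) -> Csum a = Csum b.
Proof. intros H. unfold Csum. f_equal; apply Series_ext; intros n; rewrite H; auto. Qed.

Lemma Csum_lin (c d : C) (a b : nat -> C) : abss a -> abss b ->
  Csum (fun n => c * a n + d * b n)%C = (c * Csum a + d * Csum b)%C.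
Proof.
  intros Ha Hb. destruct (abss_parts a Ha) as (_ & _ & A1 & A2). destruct (abss_parts b Hb) as (_ & _ & B1 & B2).
  apply Series_correct in A1, A2, B1, B2.
  apply C_ext; simpl; apply is_series_unique.
  - generalize (is_series_plus _ _ _ _
      (is_series_minus _ _ _ _ (is_series_scal (Re c) _ _ A1) (is_series_scal (Im c) _ _ A2))
      (is_series_minus _ _ _ _ (is_series_scal (Re d) _ _ B1) (is_series_scal (Im d) _ _ B2))).
    exact (fun H => H).
  - generalize (is_series_plus _ _ _ _
      (is_series_plus _ _ _ _ (is_series_scal (Re c) _ _ A2) (is_series_scal (Im c) _ _ A1))
      (is_series_plus _ _ _ _ (is_series_scal (Re d) _ _ B2) (is_series_scal (Im d) _ _ B1))).
    exact (fun H => H).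
Qed.

Lemma abss_lin (c d : C) (a b : nat -> C) : abss a -> abss b -> abss (fun n => c * a n + d * b n)%C.
Proof.
  intros Ha Hb. apply (abss_dom _ (fun n => Cmod c * Cmod (a n) + Cmod d * Cmod (b n))).
  - intros n. rewrite <- !Cmod_mult. apply Cmod_triangle.
  - apply (ex_series_plus (V:=R_NormedModule)); apply (ex_series_scal (V:=R_NormedModule)); auto.
Qed.

Lemma Csum_scal (c : C) (a : nat -> C) : abss a -> Csum (fun n => c * a n)%C = (c * Csum a)%C.
Proof.
  intros Ha. rewrite <- (Cplus_0_r (c * Csum a)), <- (Cmult_0_l (Csum a)), <- Csum_lin; auto.
  apply Csum_ext. intros; ring.
Qed.

Lemma Csum_bound (a : nat -> C) (b : nat -> R) : (forall n, Cmod (a n) <= b n) -> ex_series b ->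
  Cmod (Csum a) <= 2 * Series b.
Proof.
  intros H Hb. assert (Ha := abss_dom a b H Hb). destruct (abss_parts a Ha) as (A1 & A2 & _ & _).
  eapply Rle_trans; [apply Cmod_le_sum|]. simpl.
  assert (B1 := Series_Rabs _ A1). assert (B2 := Series_Rabs _ A2).
  assert (D1 : Series (fun n => Rabs (Re (a n))) <= Series b).
  { apply Series_le; auto. intros n. split; [apply Rabs_pos|]. eapply Rle_trans; [apply re_le_Cmod|apply H]. }
  assert (D2 : Series (fun n => Rabs (Im (a n))) <= Series b).
  { apply Series_le; auto. intros n. split; [apply Rabs_pos|]. eapply Rle_trans; [apply im_le_Cmod|apply H]. }
  lra.
Qed.

Lemma Csum_incr (a : nat -> C) : abss a -> Csum a = (a 0%nat + Csum (fun n => a (S n)))%C.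
Proof.
  intros Ha. destruct (abss_parts a Ha) as (_ & _ & A1 & A2).
  apply C_ext; simpl; rewrite Series_incr_1; auto.
Qed.

(** The Cauchy product, taken in components so that the theorem on products of real series applies
    to each of the four real products. *)
Definition cprod (a b : nat -> C) (n : nat) : C :=
  (sum_f_R0 (fun k => Re (a k * b (n - k)%nat)%C) n, sum_f_R0 (fun k => Im (a k * b (n - k)%nat)%C) n).

Lemma Cmod_cprod (a b : nat -> C) (n : nat) :
  Cmod (cprod a b n) <= 2 * sum_f_R0 (fun k => Cmod (a k) * Cmod (b (n - k)%nat)) n.
Proof.
  eapply Rle_trans; [apply Cmod_le_sum|]. simpl.
  assert (forall h : nat -> R, (forall k, Rabs (h k) <= Cmod (a k) * Cmod (b (n - k)%nat)) ->
    Rabs (sum_f_R0 h n) <= sum_f_R0 (fun k => Cmod (a k) * Cmod (b (n - k)%nat)) n).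
  { intros h Hh. eapply Rle_trans; [apply Rsum_abs|]. apply sum_Rle. auto. }
  assert (A1 := H (fun k => Re (a k * b (n - k)%nat)%C)). assert (A2 := H (fun k => Im (a k * b (n - k)%nat)%C)).
  cbv beta in A1, A2.
  specialize (A1 ltac:(intros; rewrite <- Cmod_mult; apply re_le_Cmod)).
  specialize (A2 ltac:(intros; rewrite <- Cmod_mult; apply im_le_Cmod)).
  simpl in A1, A2. lra.
Qed.

Lemma ex_series_cauchy (a b : nat -> R) : (forall n, 0 <= a n) -> (forall n, 0 <= b n) ->
  ex_series a -> ex_series b -> ex_series (fun n => sum_f_R0 (fun k => a k * b (n - k)%nat) n).
Proof.
  intros Ha Hb Ea Eb. exists (Series a * Series b). apply is_series_mult; try apply Series_correct; auto.
  - apply (ex_series_ext a); auto. intros n. symmetry. apply Rabs_pos_eq; auto.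
  - apply (ex_series_ext b); auto. intros n. symmetry. apply Rabs_pos_eq; auto.
Qed.

Lemma Csum_mult (a b : nat -> C) : abss a -> abss b -> Csum (cprod a b) = (Csum a * Csum b)%C.
Proof.
  intros Ha Hb. destruct (abss_parts a Ha) as (A1 & A2 & A3 & A4). destruct (abss_parts b Hb) as (B1 & B2 & B3 & B4).
  apply Series_correct in A3, A4, B3, B4.
  apply C_ext; simpl; apply is_series_unique.
  - generalize (is_series_minus _ _ _ _ (is_series_mult _ _ _ _ A3 B3 A1 B1) (is_series_mult _ _ _ _ A4 B4 A2 B2)).
    apply is_series_ext. intros n. symmetry. apply (minus_sum _ _ n).
  - generalize (is_series_plus _ _ _ _ (is_series_mult _ _ _ _ A3 B4 A1 B2) (is_series_mult _ _ _ _ A4 B3 A2 B1)).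
    apply is_series_ext. intros n. symmetry. apply (plus_sum _ _ n).
Qed.

(** * Power series on the open unit disc *)

Definition grow (c : nat -> C) : Prop :=
  forall r, 0 <= r < 1 -> ex_series (fun n => Cmod (c n) * r ^ n).

Definition PS (c : nat -> C) (q : C) : C := Csum (fun n => c n * Cpow q n)%C.

Lemma grow_abss (c : nat -> C) (q : C) : grow c -> Cmod q < 1 -> abss (fun n => c n * Cpow q n)%C.
Proof.
  intros Hc Hq. apply (abss_dom _ (fun n => Cmod (c n) * Cmod q ^ n)).
  - intros n. rewrite Cmod_mult, Cmod_pow. lra.
  - apply Hc. split; auto. apply Cmod_ge_0.
Qed.

Lemma grow_dom (c d : nat -> C) (K : R) : (forall n, Cmod (d n) <= K * Cmod (c n)) -> grow c -> grow d.
Proof.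
  intros H Hc r Hr. apply (ex_series_dom _ (fun n => K * (Cmod (c n) * r ^ n))).
  - intros n. assert (0 <= r ^ n) by (apply pow_le; lra).
    rewrite Rabs_pos_eq by (apply Rmult_le_pos; auto; apply Cmod_ge_0).
    rewrite <- Rmult_assoc. apply Rmult_le_compat_r; auto.
  - apply (ex_series_scal (V:=R_NormedModule)). apply Hc; auto.
Qed.

Lemma grow_lin (c d : C) (a b : nat -> C) : grow a -> grow b -> grow (fun n => c * a n + d * b n)%C.
Proof.
  intros Ha Hb r Hr. apply (ex_series_dom _ (fun n => Cmod c * (Cmod (a n) * r ^ n) + Cmod d * (Cmod (b n) * r ^ n))).
  - intros n. assert (0 <= r ^ n) by (apply pow_le; lra).
    rewrite Rabs_pos_eq by (apply Rmult_le_pos; auto; apply Cmod_ge_0).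
    rewrite <- !Rmult_assoc, <- !Cmod_mult, <- Rmult_plus_distr_r. apply Rmult_le_compat_r; auto. apply Cmod_triangle.
  - apply (ex_series_plus (V:=R_NormedModule)); apply (ex_series_scal (V:=R_NormedModule)); auto.
Qed.

Lemma sum_pow_split (a b : nat -> R) (r : R) (n : nat) :
  sum_f_R0 (fun k => a k * b (n - k)%nat) n * r ^ n =
  sum_f_R0 (fun k => (a k * r ^ k) * (b (n - k)%nat * r ^ (n - k))) n.
Proof.
  rewrite Rmult_comm, scal_sum. apply sum_eq. intros k Hk.
  replace n with (k + (n - k))%nat at 2 by lia. rewrite pow_add. ring.
Qed.

Lemma grow_cprod (a b : nat -> C) : grow a -> grow b -> grow (cprod a b).
Proof.
  intros Ha Hb r Hr.
  apply (ex_series_dom _ (fun n => 2 * sum_f_R0 (fun k => (Cmod (a k) * r ^ k) * (Cmod (b (n - k)%nat) * r ^ (n - k))) n)).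
  - intros n. assert (0 <= r ^ n) by (apply pow_le; lra).
    rewrite Rabs_pos_eq by (apply Rmult_le_pos; auto; apply Cmod_ge_0).
    rewrite <- (sum_pow_split (fun k => Cmod (a k)) (fun k => Cmod (b k))), <- Rmult_assoc.
    apply Rmult_le_compat_r; auto. apply Cmod_cprod.
  - apply (ex_series_scal (V:=R_NormedModule)).
    apply (ex_series_cauchy (fun n => Cmod (a n) * r ^ n) (fun n => Cmod (b n) * r ^ n)); auto;
      intros n; apply Rmult_le_pos; try apply Cmod_ge_0; apply pow_le; lra.
Qed.

Lemma cprod_pow (a b : nat -> C) (q : C) (n : nat) :
  cprod (fun n => a n * Cpow q n)%C (fun n => b n * Cpow q n)%C n = (cprod a b n * Cpow q n)%C.
Proof.
  assert (E : forall k, (k <= n)%nat -> (a k * q ^ k * (b (n - k)%nat * q ^ (n - k)) = a k * b (n - k)%nat * q ^ n)%C).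
  { intros k Hk. transitivity (a k * b (n - k)%nat * (q ^ k * q ^ (n - k)))%C; [ring|].
    rewrite <- Cpow_add_r. do 2 f_equal. lia. }
  unfold cprod. apply C_ext.
  - transitivity (sum_f_R0 (fun k => Re (a k * b (n - k)%nat)%C * Re (q ^ n)%C - Im (a k * b (n - k)%nat)%C * Im (q ^ n)%C) n).
    + apply sum_eq. intros k Hk. rewrite E by auto. reflexivity.
    + rewrite minus_sum, <- !(scal_sum _ _ _). unfold Re, Im; simpl. ring.
  - transitivity (sum_f_R0 (fun k => Re (a k * b (n - k)%nat)%C * Im (q ^ n)%C + Im (a k * b (n - k)%nat)%C * Re (q ^ n)%C) n).
    + apply sum_eq. intros k Hk. rewrite E by auto. reflexivity.
    + rewrite plus_sum, <- !(scal_sum _ _ _). unfold Re, Im; simpl. ring.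
Qed.

Lemma PS_cprod (a b : nat -> C) (q : C) : grow a -> grow b -> Cmod q < 1 -> PS (cprod a b) q = (PS a q * PS b q)%C.
Proof.
  intros Ha Hb Hq. unfold PS. rewrite <- Csum_mult by (apply grow_abss; auto).
  apply Csum_ext. intros n. symmetry. apply cprod_pow.
Qed.

Lemma PS_lin (c d : C) (a b : nat -> C) (q : C) : grow a -> grow b -> Cmod q < 1 ->
  PS (fun n => c * a n + d * b n)%C q = (c * PS a q + d * PS b q)%C.
Proof.
  intros Ha Hb Hq. unfold PS. rewrite <- Csum_lin by (apply grow_abss; auto).
  apply Csum_ext. intros n. ring.
Qed.

(** A Bernoulli inequality: it gives n r^n <= s^n / (s - r), so a factor n in the coefficients is
    paid for by a slightly larger radius. *)
Lemma pow_nr_bound (r s : R) (n : nat) : 0 <= r <= s -> r <= 1 -> r ^ n + INR n * (s - r) * r ^ n <= s ^ n.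
Proof.
  intros Hrs H1. induction n as [|n IH]; [simpl; lra|].
  rewrite S_INR. simpl pow. assert (Hp : 0 <= r ^ n) by (apply pow_le; lra).
  assert (Hn := pos_INR n).
  apply Rle_trans with (s * (r ^ n + INR n * (s - r) * r ^ n)); [|apply Rmult_le_compat_l; lra].
  assert (0 <= (s - r) * (1 - r) * r ^ n) by (repeat apply Rmult_le_pos; lra).
  assert (0 <= INR n * (s - r) * (s - r) * r ^ n) by (repeat apply Rmult_le_pos; lra).
  nra.
Qed.

Lemma grow_INR (c : nat -> C) : grow c -> grow (fun n => INR n * c n)%C.
Proof.
  intros Hc r Hr. set (s := (1 + r) / 2).
  assert (Hs : r < s < 1) by (unfold s; lra).
  apply (ex_series_dom _ (fun n => / (s - r) * (Cmod (c n) * s ^ n))).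
  - intros n. assert (Hp : 0 <= r ^ n) by (apply pow_le; lra). assert (Hn := pos_INR n).
    rewrite Rabs_pos_eq by (apply Rmult_le_pos; auto; apply Cmod_ge_0).
    rewrite Cmod_mult, Cmod_R, Rabs_pos_eq by auto.
    apply (Rmult_le_reg_l (s - r)); [lra|].
    rewrite <- Rmult_assoc with (r1 := s - r) (r2 := / (s - r)), Rinv_r, Rmult_1_l by lra.
    generalize (pow_nr_bound r s n ltac:(lra) ltac:(lra)). intros B.
    replace ((s - r) * (INR n * Cmod (c n) * r ^ n)) with (Cmod (c n) * (INR n * (s - r) * r ^ n)) by ring.
    apply Rmult_le_compat_l; [apply Cmod_ge_0|lra].
  - apply (ex_series_scal (V:=R_NormedModule)). apply Hc. lra.
Qed.

Lemma grow_shift (c : nat -> C) : grow c -> grow (fun n => c (S n)).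
Proof.
  intros Hc r Hr. set (s := (1 + r) / 2).
  assert (Hs : r < s < 1) by (unfold s; lra).
  apply (ex_series_dom _ (fun n => / s * (Cmod (c (S n)) * s ^ S n))).
  - intros n. assert (Hp : 0 <= r ^ n) by (apply pow_le; lra).
    rewrite Rabs_pos_eq by (apply Rmult_le_pos; auto; apply Cmod_ge_0).
    replace (/ s * (Cmod (c (S n)) * s ^ S n)) with (Cmod (c (S n)) * s ^ n) by (simpl; field; lra).
    apply Rmult_le_compat_l; [apply Cmod_ge_0|apply pow_incr; lra].
  - apply (ex_series_scal (V:=R_NormedModule)).
    apply (ex_series_incr_1 (fun n => Cmod (c n) * s ^ n)). apply Hc. lra.
Qed.

(** The Taylor remainder of second order. Multiplying by s^2 avoids the exponent n - 2, and n^2 in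
    place of n (n - 1) / 2 lets the induction close. *)
Lemma pow_taylor_bound (q h : C) (s : R) (n : nat) : 0 < s -> Cmod q <= s -> Cmod (q + h)%C <= s ->
  Cmod (Cpow (q + h) n - Cpow q n - INR n * Cpow q (n - 1) * h)%C * (s * s) <= INR n * INR n * s ^ n * (Cmod h * Cmod h).
Proof.
  intros Hs Hq Hqh. assert (Hh := Cmod_ge_0 h).
  induction n as [|n IH].
  - simpl. replace (1 - 1 - 0 * 1 * h)%C with (RtoC 0) by ring. rewrite Cmod_0. lra.
  - replace (S n - 1)%nat with n by lia.
    assert (E : (Cpow (q + h) (S n) - Cpow q (S n) - INR (S n) * Cpow q n * h =
      (q + h) * (Cpow (q + h) n - Cpow q n - INR n * Cpow q (n - 1) * h) + INR n * Cpow q (n - 1) * (h * h))%C).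
    { destruct n; [simpl; ring|]. replace (S n - 1)%nat with n by lia.
      rewrite (S_INR (S n)), RtoC_plus. simpl Cpow. ring. }
    rewrite E. set (T := (Cpow (q + h) n - Cpow q n - INR n * Cpow q (n - 1) * h)%C) in *.
    assert (Hn := pos_INR n). assert (HT := Cmod_ge_0 T).
    apply Rle_trans with ((Cmod (q + h) * Cmod T + INR n * Cmod (q ^ (n - 1)) * (Cmod h * Cmod h)) * (s * s)).
    { apply Rmult_le_compat_r; [nra|]. eapply Rle_trans; [apply Cmod_triangle|].
      rewrite !Cmod_mult, Cmod_R, Rabs_pos_eq by auto. lra. }
    assert (A1 : Cmod (q + h) * Cmod T * (s * s) <= s * (INR n * INR n * s ^ n * (Cmod h * Cmod h))).
    { rewrite Rmult_assoc. apply Rmult_le_compat; auto; try apply Cmod_ge_0.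
      apply Rmult_le_pos; nra. }
    assert (A2 : INR n * Cmod (q ^ (n - 1)) * (s * s) <= INR n * s ^ S n).
    { destruct n; [simpl; lra|]. replace (S n - 1)%nat with n by lia.
      rewrite Rmult_assoc. apply Rmult_le_compat_l; auto.
      replace (s ^ S (S n)) with (s ^ n * (s * s)) by (simpl; ring).
      apply Rmult_le_compat_r; [nra|]. rewrite Cmod_pow. apply pow_incr. split; auto. apply Cmod_ge_0. }
    assert (Hhh : 0 <= Cmod h * Cmod h) by nra.
    apply (Rmult_le_compat_r _ _ _ Hhh) in A2.
    assert (A3 : 0 <= s ^ S n * (Cmod h * Cmod h)) by (apply Rmult_le_pos; auto; apply pow_le; lra).
    rewrite S_INR. simpl pow in *. nra.
Qed.

(** The termwise Taylor remainders are dominated by n^2 |c_n| s^n with s halfway between |q| and 1,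
    which is summable by applying [grow_INR] twice. The truncated [n - 1] at n = 0 is masked by the
    factor [INR n]. *)
Lemma PS_cder (c : nat -> C) (q : C) : grow c -> Cmod q < 1 ->
  cder (PS c) q (Csum (fun n => c n * (INR n * Cpow q (n - 1)))%C).
Proof.
  intros Hc Hq. assert (Hq0 := Cmod_ge_0 q). set (s := (1 + Cmod q) / 2).
  assert (Hs : Cmod q < s < 1) by (unfold s; lra).
  assert (G2 := grow_INR _ (grow_INR _ Hc)).
  set (b := fun n => Cmod (INR n * (INR n * c n))%C * s ^ n).
  assert (Hb : ex_series b) by (apply G2; lra).
  assert (HD : abss (fun n => c n * (INR n * Cpow q (n - 1)))%C).
  { apply (abss_dom _ (fun n => / s * (Cmod (INR n * c n)%C * s ^ n))).
    - intros n. rewrite !Cmod_mult, Cmod_R, Rabs_pos_eq by apply pos_INR. rewrite Cmod_pow.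
      destruct n; [simpl; lra|]. replace (S n - 1)%nat with n by lia.
      replace (/ s * (INR (S n) * Cmod (c (S n)) * s ^ S n)) with (Cmod (c (S n)) * (INR (S n) * s ^ n)) by (simpl; field; lra).
      apply Rmult_le_compat_l; [apply Cmod_ge_0|]. apply Rmult_le_compat_l; [apply pos_INR|]. apply pow_incr; lra.
    - apply (ex_series_scal (V:=R_NormedModule)). apply (grow_INR _ Hc). lra. }
  set (B := 2 * Series b / (s * s)).
  assert (HB : 0 <= B).
  { unfold B. apply Rmult_le_pos; [|apply Rlt_le, Rinv_0_lt_compat; nra].
    apply Rle_trans with (Cmod (Csum (fun _ => RtoC 0))); [apply Cmod_ge_0|]. apply Csum_bound; auto.
    intros n. rewrite Cmod_0. apply Rmult_le_pos; [apply Cmod_ge_0|apply pow_le; lra]. }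
  intros eps He. exists (Rmin (s - Cmod q) (eps / (B + 1))).
  split; [apply Rmin_pos; [lra|apply Rdiv_lt_0_compat; lra]|]. intros w Hw.
  generalize (Rmin_l (s - Cmod q) (eps / (B + 1))) (Rmin_r (s - Cmod q) (eps / (B + 1))); intros.
  set (h := (w - q)%C) in *. assert (Ew : w = (q + h)%C) by (unfold h; ring). clearbody h. subst w.
  assert (Hqh : Cmod (q + h)%C <= s) by (generalize (Cmod_triangle q h); lra).
  unfold PS.
  replace (Csum (fun n => c n * (q + h) ^ n) - Csum (fun n => c n * q ^ n) - Csum (fun n => c n * (INR n * q ^ (n - 1))) * h)%C
    with (Csum (fun n => 1 * (1 * (c n * (q + h) ^ n) + (-(1)) * (c n * q ^ n)) + (- h) * (c n * (INR n * q ^ (n - 1))))%C).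
  - apply Rle_trans with (2 * Series (fun n => (Cmod h * Cmod h / (s * s)) * b n)).
    + apply Csum_bound.
      * intros n. generalize (pow_taylor_bound q h s n ltac:(lra) ltac:(lra) Hqh). intros T.
        replace (1 * (1 * (c n * (q + h) ^ n) + - (1) * (c n * q ^ n)) + - h * (c n * (INR n * q ^ (n - 1))))%C
          with (c n * ((q + h) ^ n - q ^ n - INR n * q ^ (n - 1) * h))%C by ring.
        unfold b. rewrite !Cmod_mult, Cmod_R, Rabs_pos_eq by apply pos_INR.
        apply (Rmult_le_reg_r (s * s)); [nra|].
        replace (Cmod h * Cmod h / (s * s) * (INR n * (INR n * Cmod (c n)) * s ^ n) * (s * s))
          with (Cmod (c n) * (INR n * INR n * s ^ n * (Cmod h * Cmod h))) by (field; lra).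
        rewrite Rmult_assoc. apply Rmult_le_compat_l; auto. apply Cmod_ge_0.
      * apply (ex_series_scal (V:=R_NormedModule)); auto.
    + rewrite Series_scal_l. assert (Hh := Cmod_ge_0 h).
      replace (2 * (Cmod h * Cmod h / (s * s) * Series b)) with (B * Cmod h * Cmod h) by (unfold B; field; lra).
      apply Rmult_le_compat_r; auto.
      assert (Cmod h * (B + 1) <= eps).
      { apply (Rmult_le_reg_r (/ (B + 1))); [apply Rinv_0_lt_compat; lra|].
        rewrite Rmult_assoc, Rinv_r by lra. unfold Rdiv in *. lra. }
      nra.
  - assert (A1 := grow_abss c (q + h) Hc ltac:(lra)). assert (A2 := grow_abss c q Hc Hq).
    rewrite (Csum_lin 1 (- h) (fun n => 1 * (c n * (q + h) ^ n) + (-(1)) * (c n * q ^ n))%C); auto.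
    + rewrite Csum_lin; auto. ring.
    + apply abss_lin; auto.
Qed.

(** * The map from [z] to [q] and expansions in [q] *)

Definition qv (z : C) : C := qpow z 1.

Lemma qpow_pow (z : C) (n : nat) : qpow z n = Cpow (qv z) n.
Proof.
  induction n as [|n IH].
  - unfold qpow. simpl. rewrite !Rmult_0_r, !Rmult_0_l, exp_0, cos_0, sin_0. apply C_ext; simpl; ring.
  - simpl Cpow. rewrite <- IH. unfold qv, qpow. rewrite S_INR.
    replace (- 2 * PI * (INR n + 1) * Im z) with (- 2 * PI * INR 1 * Im z + - 2 * PI * INR n * Im z) by (simpl INR; ring).
    replace (2 * PI * (INR n + 1) * Re z) with (2 * PI * INR 1 * Re z + 2 * PI * INR n * Re z) by (simpl INR; ring).
    rewrite exp_plus, cos_plus, sin_plus. apply C_ext; simpl; ring.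
Qed.

Lemma Cmod_qv (z : C) : Cmod (qv z) = exp (- 2 * PI * Im z).
Proof.
  unfold qv, qpow. simpl INR. rewrite !Rmult_1_r.
  set (e := exp _). set (t := 2 * PI * Re z).
  replace (e * cos t, e * sin t) with (RtoC e * (cos t, sin t))%C by (apply C_ext; simpl; ring).
  rewrite Cmod_mult, Cmod_R, Rabs_pos_eq by (apply Rlt_le, exp_pos).
  unfold Cmod; simpl. replace (cos t * (cos t * 1) + sin t * (sin t * 1)) with 1.
  - rewrite sqrt_1. ring.
  - generalize (sin2_cos2 t). unfold Rsqr. lra.
Qed.

Lemma Cmod_qv_lt1 (z : C) : inH z -> Cmod (qv z) < 1.
Proof.
  intros H. rewrite Cmod_qv, <- exp_0. apply exp_increasing. unfold inH in H. generalize PI_RGT_0. nra.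
Qed.

Lemma qv_plus (z h : C) : qv (z + h)%C = (qv z * qv h)%C.
Proof.
  unfold qv, qpow. simpl INR. rewrite !Rmult_1_r.
  change (Im (z + h)%C) with (Im z + Im h). change (Re (z + h)%C) with (Re z + Re h).
  rewrite !Rmult_plus_distr_l.
  rewrite exp_plus, cos_plus, sin_plus. apply C_ext; simpl; ring.
Qed.

Lemma derivable_small (f : R -> R) (l : R) : derivable_pt_lim f 0 l ->
  forall eps, 0 < eps -> exists d, 0 < d /\ forall u, Rabs u < d -> Rabs (f u - f 0 - l * u) <= eps * Rabs u.
Proof.
  intros H eps He. destruct (H eps He) as [d Hd]. exists d. split; [apply cond_pos|].
  intros u Hu. destruct (Req_dec u 0) as [->|Hn].
  - rewrite Rabs_R0. replace (f 0 - f 0 - l * 0) with 0 by ring. rewrite Rabs_R0. lra.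
  - specialize (Hd u Hn Hu). rewrite Rplus_0_l in Hd.
    replace (f u - f 0 - l * u) with (((f u - f 0) / u - l) * u) by (field; auto).
    rewrite Rabs_mult. apply Rmult_le_compat_r; [apply Rabs_pos|lra].
Qed.

(** The first-order expansion of exp(u + i v) at 0, assembled from the real derivatives of [exp],
    [cos] and [sin]. *)
Lemma exp_polar_small (eps : R) : 0 < eps -> exists d, 0 < d /\ forall u v, Rabs u < d -> Rabs v < d ->
  Cmod (((exp u * cos v)%R, (exp u * sin v)%R) - ((1 + u)%R, v))%C <= eps * (Rabs u + Rabs v).
Proof.
  intros He. set (e := Rmin 1 (eps / 8)).
  assert (He1 : e <= 1) by apply Rmin_l. assert (He2 : e <= eps / 8) by apply Rmin_r.
  assert (He0 : 0 < e) by (apply Rmin_pos; lra). clearbody e.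
  destruct (derivable_small exp 1 derivable_pt_lim_exp_0 e He0) as [d1 [Hd1 A1]].
  assert (Hc := derivable_pt_lim_cos 0). rewrite sin_0, Ropp_0 in Hc.
  destruct (derivable_small cos 0 Hc e He0) as [d2 [Hd2 A2]].
  assert (Hs := derivable_pt_lim_sin 0). rewrite cos_0 in Hs.
  destruct (derivable_small sin 1 Hs e He0) as [d3 [Hd3 A3]].
  rewrite exp_0 in A1. rewrite cos_0 in A2. rewrite sin_0 in A3.
  exists (Rmin (Rmin d1 d2) (Rmin d3 e)). split; [repeat apply Rmin_pos; auto|].
  intros u v Hu Hv.
  generalize (Rmin_l (Rmin d1 d2) (Rmin d3 e)) (Rmin_r (Rmin d1 d2) (Rmin d3 e)) (Rmin_l d1 d2) (Rmin_r d1 d2) (Rmin_l d3 e) (Rmin_r d3 e); intros.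
  specialize (A1 u ltac:(lra)). specialize (A2 v ltac:(lra)). specialize (A3 v ltac:(lra)).
  assert (Pu := Rabs_pos u). assert (Pv := Rabs_pos v).
  eapply Rle_trans; [apply Cmod_le_sum|].
  assert (B1 : Rabs (Re (((exp u * cos v)%R, (exp u * sin v)%R) - ((1 + u)%R, v))%C) <= e * Rabs u + 2 * (e * Rabs v)).
  { simpl. replace (exp u * cos v + - (1 + u)) with ((exp u - 1 - 1 * u) * cos v + (1 + u) * (cos v - 1 - 0 * v)) by ring.
    eapply Rle_trans; [apply Rabs_triang|]. rewrite !Rabs_mult. apply Rplus_le_compat.
    - rewrite <- (Rmult_1_r (e * Rabs u)). apply Rmult_le_compat; try apply Rabs_pos; auto.
      apply Rabs_le. generalize (COS_bound v). lra.
    - apply Rmult_le_compat; try apply Rabs_pos; auto.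
      eapply Rle_trans; [apply Rabs_triang|]. rewrite Rabs_R1. lra. }
  assert (B2 : Rabs (Im (((exp u * cos v)%R, (exp u * sin v)%R) - ((1 + u)%R, v))%C) <= 2 * (Rabs u * (2 * e)) + e * Rabs v).
  { simpl. replace (exp u * sin v + - v) with ((exp u - 1) * sin v + (sin v - 0 - 1 * v)) by ring.
    eapply Rle_trans; [apply Rabs_triang|]. rewrite !Rabs_mult. apply Rplus_le_compat; auto.
    replace (2 * (Rabs u * (2 * e))) with ((2 * Rabs u) * (2 * e)) by ring.
    apply Rmult_le_compat; try apply Rabs_pos; auto.
    - replace (exp u - 1) with ((exp u - 1 - 1 * u) + u) by ring.
      eapply Rle_trans; [apply Rabs_triang|]. nra.
    - replace (sin v) with ((sin v - 0 - 1 * v) + v) by ring.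
      eapply Rle_trans; [apply Rabs_triang|]. nra. }
  nra.
Qed.

Definition tau : C := (RtoC (2 * PI) * Ci)%C.

Lemma tau_neq0 : tau <> 0%C.
Proof.
  unfold tau. apply Cmult_neq_0.
  - intros E. apply RtoC_inj in E. generalize PI_RGT_0. lra.
  - intros E. apply (f_equal Im) in E. simpl in E. lra.
Qed.

(** Since [qv] turns sums into products, the claim reduces to the expansion at 0, where [tau * h]
    has real part -2 pi Im h and imaginary part 2 pi Re h. *)
Lemma qv_cder (z : C) : cder qv z (tau * qv z)%C.
Proof.
  intros eps He. assert (HP := PI_RGT_0). assert (Hq := Cmod_ge_0 (qv z)).
  set (K := 4 * PI * (Cmod (qv z) + 1)). assert (HK : 0 < K) by (unfold K; nra).
  destruct (exp_polar_small (eps / K)) as [d [Hd A]]; [apply Rdiv_lt_0_compat; auto|].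
  exists (d / (2 * PI)). split; [apply Rdiv_lt_0_compat; lra|]. intros w Hw.
  set (h := (w - z)%C) in *. assert (Ew : w = (z + h)%C) by (unfold h; ring). clearbody h. subst w.
  assert (Hh := Cmod_ge_0 h).
  assert (Hd2 : 2 * PI * Cmod h < d).
  { apply (Rmult_lt_compat_l (2 * PI)) in Hw; [|lra]. replace (2 * PI * (d / (2 * PI))) with d in Hw by (field; lra). auto. }
  rewrite qv_plus.
  replace (qv z * qv h - qv z - tau * qv z * h)%C with (qv z * (qv h - (1 + tau * h)))%C by ring.
  set (u := - 2 * PI * Im h). set (v := 2 * PI * Re h).
  assert (Eh : (1 + tau * h)%C = ((1 + u)%R, v)) by (apply C_ext; unfold tau, u, v, Re, Im; simpl; ring).
  assert (Eq : qv h = ((exp u * cos v)%R, (exp u * sin v)%R)).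
  { unfold qv, qpow, u, v. simpl INR. rewrite !Rmult_1_r. reflexivity. }
  assert (Hu : Rabs u <= 2 * PI * Cmod h).
  { unfold u. rewrite Rabs_mult. replace (Rabs (- 2 * PI)) with (2 * PI) by (rewrite Rabs_left; lra).
    apply Rmult_le_compat_l; [lra|apply im_le_Cmod]. }
  assert (Hv : Rabs v <= 2 * PI * Cmod h).
  { unfold v. rewrite Rabs_mult. replace (Rabs (2 * PI)) with (2 * PI) by (rewrite Rabs_pos_eq; lra).
    apply Rmult_le_compat_l; [lra|apply re_le_Cmod]. }
  rewrite Eh, Eq, Cmod_mult.
  specialize (A u v ltac:(lra) ltac:(lra)).
  apply Rle_trans with (Cmod (qv z) * (eps / K * (4 * PI * Cmod h))).
  - apply Rmult_le_compat_l; auto. eapply Rle_trans; [exact A|].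
    apply Rmult_le_compat_l; [apply Rlt_le, Rdiv_lt_0_compat; auto|lra].
  - replace (eps * Cmod h) with (eps / K * (K * Cmod h)) by (field; lra).
    assert (0 < eps / K) by (apply Rdiv_lt_0_compat; auto).
    assert (0 <= eps / K * Cmod h * PI) by (apply Rmult_le_pos; [apply Rmult_le_pos|]; lra).
    replace (eps / K * (K * Cmod h)) with (4 * (eps / K * Cmod h * PI) * (Cmod (qv z) + 1)) by (unfold K; ring).
    nra.
Qed.

(** An expansion with nonnegative exponents only, converging on the whole unit disc: holomorphy at
    the cusp, in a form stable under sums, products and [dq]. *)
Definition QS (c : nat -> C) (f : C -> C) : Prop :=
  grow c /\ forall z, inH z -> f z = PS c (qv z).

Lemma QS_cder (c : nat -> C) (f : C -> C) (z : C) : QS c f -> inH z ->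
  cder f z (tau * PS (fun n => INR n * c n) (qv z))%C.
Proof.
  intros [Hc Hf] Hz. assert (Hq := Cmod_qv_lt1 z Hz).
  apply (cder_ext_loc (fun z => PS c (qv z))) with (Im z); [exact Hz| |].
  - intros w Hw. symmetry. apply Hf. apply (inH_open z w Hw).
  - eapply cder_eq; [apply (cder_comp (PS c) qv); [apply PS_cder; auto|apply qv_cder]|].
    unfold PS. rewrite (Csum_ext (fun n => INR n * c n * qv z ^ n) (fun n => qv z * (c n * (INR n * qv z ^ (n - 1)))))%C.
    + rewrite Csum_scal; [ring|].
      assert (Ha := grow_abss _ _ (grow_shift _ (grow_INR c Hc)) Hq).
      unfold abss in *. apply ex_series_incr_1.
      eapply ex_series_ext; [|exact Ha]. intros n. simpl. f_equal. replace (n - 0)%nat with n by lia. ring.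
    + intros n. destruct n; [simpl; ring|]. replace (S n - 1)%nat with n by lia. simpl Cpow. ring.
Qed.

Lemma QS_holo (c : nat -> C) (f : C -> C) : QS c f -> holo f.
Proof. intros H. apply holo_cdiff. intros z Hz. eexists. apply (QS_cder c f z H Hz). Qed.

Lemma QS_dq (c : nat -> C) (f : C -> C) : QS c f -> QS (fun n => INR n * c n)%C (dq f).
Proof.
  intros H. split; [apply grow_INR, H|]. intros z Hz. unfold dq.
  rewrite (cder_cderiv _ _ _ (QS_cder c f z H Hz)). fold tau. field. apply tau_neq0.
Qed.

Lemma QS_lin (a b : C) (c d : nat -> C) (f g : C -> C) : QS c f -> QS d g ->
  QS (fun n => a * c n + b * d n)%C (fun z => a * f z + b * g z)%C.
Proof.
  intros [Hc Hf] [Hd Hg]. split; [apply grow_lin; auto|]. intros z Hz.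
  rewrite PS_lin, Hf, Hg; auto using Cmod_qv_lt1.
Qed.

Lemma QS_mult (c d : nat -> C) (f g : C -> C) : QS c f -> QS d g -> QS (cprod c d) (fmul f g).
Proof.
  intros [Hc Hf] [Hd Hg]. split; [apply grow_cprod; auto|]. intros z Hz.
  unfold fmul. rewrite PS_cprod, Hf, Hg; auto using Cmod_qv_lt1.
Qed.

Lemma QS_ext (c d : nat -> C) (f g : C -> C) : QS c f -> QS d g -> (forall n, c n = d n) -> eqH f g.
Proof.
  intros [_ Hf] [_ Hg] E z Hz. rewrite Hf, Hg by auto. unfold PS. apply Csum_ext. intros n. rewrite E. auto.
Qed.

Lemma grow_pow (k : nat) : grow (fun n => RtoC (INR n ^ k)).
Proof.
  induction k as [|k IH].
  - intros r Hr. apply (ex_series_ext (fun n => r ^ n)).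
    + intros n. simpl. rewrite Cmod_1. simpl; ring.
    + apply ex_series_geom. rewrite Rabs_pos_eq; lra.
  - eapply grow_dom with (K := 1); [|apply grow_INR, IH]. intros n.
    cbv beta. rewrite <- RtoC_mult. simpl. lra.
Qed.

Lemma sigma_bound (r n : nat) : 0 <= Defs.sigma r n <= INR n ^ S r.
Proof.
  unfold Defs.sigma.
  assert (H : forall l, (forall d, In d l -> (d <= n)%nat) ->
    0 <= lsum (fun d => if Nat.eqb (Nat.modulo n d) 0 then INR d ^ r else 0) l <= INR (length l) * INR n ^ r).
  { induction l as [|d l IH]; intros Hl; [unfold lsum; simpl; lra|].
    specialize (IH (fun d Hd => Hl d (or_intror Hd))). unfold lsum in *. simpl length. simpl map. simpl fold_right.
    rewrite S_INR. assert (0 <= INR d ^ r <= INR n ^ r).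
    { split; [apply pow_le, pos_INR|]. apply pow_incr. split; [apply pos_INR|apply le_INR, Hl; left; auto]. }
    destruct (Nat.eqb _ _); lra. }
  specialize (H (seq 1 n)). rewrite length_seq in H. apply H.
  intros d Hd. apply in_seq in Hd. lia.
Qed.

Definition eis (c : R) (r n : nat) : R := match n with O => 1 | S _ => c * Defs.sigma r n end.

Lemma QS_Eis (c : R) (r : nat) : QS (fun n => RtoC (eis c r n)) (Eis c r).
Proof.
  assert (G : grow (fun n => RtoC (eis c r n))).
  { apply (grow_dom (fun n => 1 * RtoC (INR n ^ 0) + RtoC (Rabs c) * RtoC (INR n ^ S r))%C _ 1).
    - intros n. rewrite <- !RtoC_mult, <- RtoC_plus, !Cmod_R, Rmult_1_l.
      assert (0 <= INR n ^ S r) by (apply pow_le, pos_INR).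
      assert (0 <= Rabs c * INR n ^ S r) by (apply Rmult_le_pos; auto; apply Rabs_pos).
      rewrite (Rabs_pos_eq (1 * _ + _)) by (rewrite pow_O; lra). rewrite pow_O.
      destruct n; unfold eis; [rewrite Rabs_R1; lra|].
      rewrite Rabs_mult. generalize (sigma_bound r (S n)); intros.
      rewrite (Rabs_pos_eq (Defs.sigma _ _)) by lra.
      assert (Rabs c * Defs.sigma r (S n) <= Rabs c * INR (S n) ^ S r) by (apply Rmult_le_compat_l; [apply Rabs_pos|lra]).
      lra.
    - apply grow_lin; apply grow_pow. }
  split; auto. intros z Hz. assert (A := grow_abss _ _ G (Cmod_qv_lt1 z Hz)).
  unfold PS, Eis. rewrite (Csum_incr _ A). f_equal; [simpl; ring|].
  assert (A' : abss (fun n => RtoC (eis c r (S n)) * qv z ^ S n)%C).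
  { unfold abss in *. apply ex_series_incr_1 in A. exact A. }
  (* Summability is known for the coefficients that contain [c], so the bare divisor series is
     recovered by dividing by [c]; for c = 0 both sides vanish. *)
  destruct (Req_dec c 0) as [->|Hc].
  - rewrite Cmult_0_l. symmetry. rewrite (Csum_ext _ (fun n => 0 * (RtoC (eis 0 r (S n)) * qv z ^ S n))%C).
    + rewrite Csum_scal; auto. ring.
    + intros n. unfold eis. rewrite Rmult_0_l. ring.
  - rewrite (Csum_ext (fun k => RtoC (Defs.sigma r (S k)) * qpow z (S k))%C
      (fun n => RtoC (/ c) * (RtoC (eis c r (S n)) * qv z ^ S n))%C).
    + rewrite Csum_scal by auto. rewrite Cmult_assoc, <- RtoC_mult, Rinv_r by auto. ring.
    + intros n. rewrite qpow_pow. unfold eis. rewrite RtoC_mult, Cmult_assoc, Cmult_assoc, <- RtoC_mult, Rinv_l by auto. ring.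
Qed.

(** The two end terms of the Cauchy product meet a constant term 1; the inner ones form the
    convolution sum. *)
Lemma cprod_eis (c1 c2 : R) (r1 r2 n : nat) : (1 <= n)%nat ->
  cprod (fun n => RtoC (eis c1 r1 n)) (fun n => RtoC (eis c2 r2 n)) n =
  RtoC (c1 * Defs.sigma r1 n + c2 * Defs.sigma r2 n + c1 * c2 * conv r1 r2 n).
Proof.
  intros Hn. unfold cprod.
  assert (S0 : forall f : nat -> R, sum_f_R0 f n = f 0%nat + lsum f (seq 1 (n - 1)) + f n).
  { intros f. assert (H : forall N, sum_f_R0 f N = f 0%nat + lsum f (seq 1 N)).
    { induction N; [unfold lsum; simpl; ring|]. simpl sum_f_R0. rewrite IHN, lsum_seq_S. ring. }
    destruct n; [lia|]. rewrite H, lsum_seq_S. replace (S n - 1)%nat with n by lia. ring. }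
  apply C_ext; simpl.
  - rewrite S0. rewrite Nat.sub_0_r, Nat.sub_diag.
    rewrite (lsum_ext _ (fun k => c1 * c2 * (Defs.sigma r1 k * Defs.sigma r2 (n - k)))).
    + rewrite lsum_scal. fold (conv r1 r2 n). destruct n; [lia|]. unfold eis. ring.
    + intros k Hk. apply in_seq in Hk. unfold eis. destruct k; [lia|]. destruct (n - S k)%nat eqn:E; [lia|]. ring.
  - rewrite (sum_eq _ (fun _ => 0)); [|intros; ring]. rewrite sum_cte. ring.
Qed.

(** For n >= 1 the comparison of coefficients is 24 times [conv13]; at n = 0 both sides are 0. The
    summand [0 * E4] only provides the shape of [QS_lin]. *)
Lemma ramanujan_E4 : forall z, inH z -> dq E4 z = ((E2 z * E4 z - E6 z) / 3)%C.
Proof.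
  assert (H : eqH (fun z => 3 * dq E4 z + 0 * E4 z)%C (fun z => 1 * fmul E2 E4 z + (-(1)) * E6 z)%C).
  { eapply QS_ext; [apply QS_lin; [apply QS_dq, QS_Eis|apply QS_Eis]|apply QS_lin; [apply QS_mult; apply QS_Eis|apply QS_Eis]|].
    intros n. cbv beta. destruct (Nat.eq_dec n 0) as [->|Hn].
    - unfold cprod, eis; simpl. apply C_ext; simpl; ring.
    - rewrite cprod_eis by lia.
      replace (eis 240 3 n) with (240 * Defs.sigma 3 n) by (destruct n; [lia|reflexivity]).
      replace (eis (-504) 5 n) with (-504 * Defs.sigma 5 n) by (destruct n; [lia|reflexivity]).
      generalize (conv13 n). intros E. apply C_ext; simpl; [|ring].
      rewrite !Rmult_0_l, !Rmult_0_r. nra. }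
  intros z Hz. specialize (H z Hz). unfold fmul in H. cbv beta in H.
  replace (dq E4 z) with ((3 * dq E4 z + 0 * E4 z) / 3)%C by (field; intros E; apply RtoC_inj in E; lra).
  rewrite H. f_equal. ring.
Qed.

(** The coefficients combine 24 times [conv15] with 480 times [conv33], and the terms in sigma_7
    cancel. *)
Lemma ramanujan_E6 : forall z, inH z -> dq E6 z = ((E2 z * E6 z - E4 z * E4 z) / 2)%C.
Proof.
  assert (H : eqH (fun z => 2 * dq E6 z + 0 * E4 z)%C (fun z => 1 * fmul E2 E6 z + (-(1)) * fmul E4 E4 z)%C).
  { eapply QS_ext; [apply QS_lin; [apply QS_dq, QS_Eis|apply QS_Eis]|apply QS_lin; [apply QS_mult; apply QS_Eis|apply QS_mult; apply QS_Eis]|].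
    intros n. cbv beta. destruct (Nat.eq_dec n 0) as [->|Hn].
    - unfold cprod, eis; simpl. apply C_ext; simpl; ring.
    - rewrite !cprod_eis by lia.
      replace (eis 240 3 n) with (240 * Defs.sigma 3 n) by (destruct n; [lia|reflexivity]).
      replace (eis (-504) 5 n) with (-504 * Defs.sigma 5 n) by (destruct n; [lia|reflexivity]).
      generalize (conv15 n) (conv33 n). intros E E'. apply C_ext; simpl; [|ring].
      rewrite !Rmult_0_l, !Rmult_0_r. nra. }
  intros z Hz. specialize (H z Hz). unfold fmul in H. cbv beta in H.
  replace (dq E6 z) with ((2 * dq E6 z + 0 * E4 z) / 2)%C by (field; intros E; apply RtoC_inj in E; lra).
  rewrite H. f_equal. ring.
Qed.

(** Induction on the order of vanishing, factoring out one [q] at a time; for order 0, continuity at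
    0 suffices. *)
Lemma PS_nonzero_near (k : nat) : forall c, grow c -> (forall j, (j < k)%nat -> c j = 0%C) -> c k <> 0%C ->
  exists eta, 0 < eta /\ forall q, 0 < Cmod q < eta -> PS c q <> 0%C.
Proof.
  induction k as [|k IH]; intros c Hc Hz Hn.
  - assert (E : PS c 0%C = c 0%nat).
    { unfold PS. rewrite Csum_incr by (apply grow_abss; auto; rewrite Cmod_0; lra).
      rewrite (Csum_ext _ (fun n => 0 * (c (S n) * 0 ^ n))%C) by (intros; simpl; ring).
      rewrite Csum_scal; [simpl; ring|]. apply grow_abss; [apply grow_shift; auto|rewrite Cmod_0; lra]. }
    destruct (ccont_nonzero (PS c) 0%C) as [d [Hd A]].
    + eapply cder_ccont. apply PS_cder; auto. rewrite Cmod_0; lra.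
    + rewrite E; auto.
    + exists d. split; auto. intros q Hq. apply (Cmod_half_nonzero (PS c 0%C)); [rewrite E; auto|].
      apply A. replace (q - 0)%C with q by ring. lra.
  - destruct (IH (fun n => c (S n))) as [eta [He A]]; auto using grow_shift.
    + intros j Hj. apply Hz. lia.
    + exists (Rmin eta 1). split; [apply Rmin_pos; lra|]. intros q [Hq0 Hq].
      generalize (Rmin_l eta 1) (Rmin_r eta 1); intros.
      assert (E : PS c q = (q * PS (fun n => c (S n)) q)%C).
      { unfold PS. rewrite Csum_incr by (apply grow_abss; auto; lra). rewrite (Hz 0%nat) by lia.
        rewrite <- Csum_scal by (apply (grow_abss (fun n => c (S n))); [apply grow_shift; auto|lra]).
        rewrite (Csum_ext _ (fun n => q * (c (S n) * q ^ n))%C) by (intros; simpl; ring). ring. }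
      rewrite E. apply Cmult_neq_0; [apply Cmod_gt_0; auto|apply A; lra].
Qed.

(** Going up the imaginary axis, [q] tends to 0 without reaching it. A half-line free of zeros,
    rather than one point, lets two functions be nonzero at the same place. *)
Lemma QS_nonzero_cusp (c : nat -> C) (f : C -> C) : QS c f -> (exists z, inH z /\ f z <> 0%C) ->
  exists Y, 0 < Y /\ forall y, Y <= y -> f (0, y) <> 0%C.
Proof.
  intros [Hc Hf] [z0 [Hz0 Hn0]].
  assert (Hex : exists k, c k <> 0%C).
  { apply NNPP. intros HN. apply Hn0. rewrite Hf by auto. unfold PS.
    rewrite (Csum_ext _ (fun n => 0 * (c n * qv z0 ^ n))%C).
    - rewrite Csum_scal by (apply grow_abss; auto using Cmod_qv_lt1). ring.
    - intros n. assert (c n = 0%C) as ->; [|ring]. apply NNPP. intros H. apply HN. eauto. }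
  destruct (dec_inh_nat_subset_has_unique_least_element (fun k => c k <> 0%C)) as [k [[Hk Hmin] _]]; auto.
  { intros n. apply classic. }
  destruct (PS_nonzero_near k c) as [eta [He A]]; auto.
  { intros j Hj. apply NNPP. intros H. specialize (Hmin j H). lia. }
  (* From exp(2 pi y) > 1 + 2 pi y > y >= 1 / eta it follows that |q| < eta. *)
  exists (/ eta). assert (Hi : 0 < / eta) by (apply Rinv_0_lt_compat; auto). split; auto. intros y Hy.
  assert (HP := PI_RGT_0). assert (HP2 : 1 < 2 * PI) by (generalize PI2_1; lra).
  assert (Hin : inH (0, y)) by (unfold inH; simpl; lra).
  rewrite Hf by auto. apply A. rewrite Cmod_qv. simpl Im. split; [apply exp_pos|].
  replace (- 2 * PI * y) with (- (2 * PI * y)) by ring. rewrite exp_Ropp.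
  rewrite <- (Rinv_inv eta). apply Rinv_lt_contravar; [apply Rmult_lt_0_compat; auto; apply exp_pos|].
  assert (0 < 2 * PI * y) by nra. generalize (exp_ineq1 (2 * PI * y) ltac:(lra)). nra.
Qed.

(** * Normal forms of operators *)

Lemma dq_of_cder (f : C -> C) (z l : C) : cder f z l -> dq f z = (l / tau)%C.
Proof. intros H. unfold dq. rewrite (cder_cderiv _ _ _ H). reflexivity. Qed.

Lemma holo_cder_dq (f : C -> C) (z : C) : holo f -> inH z -> cder f z (tau * dq f z)%C.
Proof.
  intros H Hz. generalize (holo_cder f z H Hz). intros Hc.
  eapply cder_eq; [exact Hc|]. unfold dq. fold tau. field. apply tau_neq0.
Qed.

Lemma holo_const (c : C) : holo (fun _ => c).
Proof. apply holo_cdiff. intros z _. eexists. apply cder_const. Qed.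

Lemma holo_plus (f g : C -> C) : holo f -> holo g -> holo (fun z => f z + g z)%C.
Proof.
  intros Hf Hg. apply holo_cdiff. intros z Hz. eexists. apply cder_plus; apply holo_cder; auto.
Qed.

Lemma holo_mult (f g : C -> C) : holo f -> holo g -> holo (fun z => f z * g z)%C.
Proof.
  intros Hf Hg. apply holo_cdiff. intros z Hz. eexists. apply cder_mult; apply holo_cder; auto.
Qed.

Lemma holo_dq (f : C -> C) : holo f -> holo (dq f).
Proof.
  intros Hf. apply (holo_ext (fun z => / tau * cderiv f z)%C).
  - intros z _. unfold dq. fold tau. field. apply tau_neq0.
  - apply holo_mult; [apply holo_const|apply holo_cderiv; auto].
Qed.

Lemma holo_E2 : holo E2. Proof. eapply QS_holo. apply QS_Eis. Qed.

Lemma holo_Dk (k : R) (f : C -> C) : holo f -> holo (Dk k f).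
Proof.
  intros Hf. apply (holo_ext (fun z => dq f z + (- RtoC (k / 12)) * (E2 z * f z))%C).
  - intros z _. unfold Dk. ring.
  - apply holo_plus; [apply holo_dq; auto|]. apply holo_mult; [apply holo_const|].
    apply holo_mult; auto using holo_E2.
Qed.

(** The upper half plane contains the disc of radius [Im z] around [z], so values elsewhere do not
    affect the derivative. *)
Lemma dq_local (f g : C -> C) (z : C) : holo f -> eqH f g -> inH z -> dq f z = dq g z.
Proof.
  intros Hf E Hz. symmetry. transitivity (tau * dq f z / tau)%C.
  - apply dq_of_cder. apply (cder_ext_loc f g) with (Im z); [exact Hz| |apply holo_cder_dq; auto].
    intros w Hw. apply E. apply (inH_open z w Hw).
  - field. apply tau_neq0.
Qed.

Lemma Dk_local (k : R) (f g : C -> C) : holo f -> eqH f g -> eqH (Dk k f) (Dk k g).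
Proof. intros Hf E z Hz. unfold Dk. rewrite (dq_local f g z), E; auto. Qed.

Lemma Dk_plus (k : R) (f g : C -> C) (z : C) : holo f -> holo g -> inH z ->
  Dk k (fun z => f z + g z)%C z = (Dk k f z + Dk k g z)%C.
Proof.
  intros Hf Hg Hz. unfold Dk.
  rewrite (dq_of_cder _ _ _ (cder_plus _ _ _ _ _ (holo_cder_dq f z Hf Hz) (holo_cder_dq g z Hg Hz))).
  field. apply tau_neq0.
Qed.

Lemma Dk_mult (k1 k2 k : R) (f g : C -> C) (z : C) : k = k1 + k2 -> holo f -> holo g -> inH z ->
  Dk k (fun z => f z * g z)%C z = (Dk k1 f z * g z + f z * Dk k2 g z)%C.
Proof.
  intros -> Hf Hg Hz. unfold Dk.
  rewrite (dq_of_cder _ _ _ (cder_mult _ _ _ _ _ (holo_cder_dq f z Hf Hz) (holo_cder_dq g z Hg Hz))).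
  rewrite Rdiv_plus_distr, RtoC_plus. field. apply tau_neq0.
Qed.

Lemma inM_QS (f : C -> C) : inM f -> exists c, QS c f.
Proof.
  induction 1 as [c| | |f g _ [cf Hf] _ [cg Hg]|f g _ [cf Hf] _ [cg Hg]].
  (* [Eis 0 0] is the constant function 1, which supplies expansions of constants. *)
  - exists (fun n => c * RtoC (eis 0 0 n) + 0 * RtoC (eis 0 0 n))%C.
    destruct (QS_lin c 0%C _ _ _ _ (QS_Eis 0 0) (QS_Eis 0 0)) as [A B]. split; auto.
    intros z Hz. rewrite <- B by auto. unfold Eis. ring.
  - eexists. apply QS_Eis.
  - eexists. apply QS_Eis.
  - exists (fun n => 1 * cf n + 1 * cg n)%C. destruct (QS_lin 1 1 _ _ _ _ Hf Hg) as [A B]. split; auto.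
    intros z Hz. rewrite <- B by auto. ring.
  - eexists. apply QS_mult; eauto.
Qed.

Lemma inM_holo (f : C -> C) : inM f -> holo f.
Proof. intros H. destruct (inM_QS f H) as [c Hc]. eapply QS_holo; eauto. Qed.

Lemma inM_domain (f g : C -> C) : inM f -> inM g ->
  (exists z, inH z /\ f z <> 0%C) -> (exists z, inH z /\ g z <> 0%C) ->
  exists z, inH z /\ fmul f g z <> 0%C.
Proof.
  intros Hf Hg Nf Ng. destruct (inM_QS f Hf) as [c Hc]. destruct (inM_QS g Hg) as [d Hd].
  destruct (QS_nonzero_cusp c f Hc Nf) as [Y [HY A]]. destruct (QS_nonzero_cusp d g Hd Ng) as [Y' [HY' A']].
  exists (0, Y + Y'). split; [unfold inH; simpl; lra|]. unfold fmul. apply Cmult_neq_0; [apply A|apply A']; lra.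
Qed.

Lemma inMk_inM (k : Z) (f : C -> C) : inMk k f -> inM f.
Proof.
  induction 1; [apply inM_const|apply inM_const|apply inM_E4|apply inM_E6|apply inM_add; auto|apply inM_mul; auto].
Qed.

Lemma inMk_holo (k : Z) (f : C -> C) : inMk k f -> holo f.
Proof. intros H. apply inM_holo, (inMk_inM k), H. Qed.

Lemma inMk_cast (k k' : Z) (f : C -> C) : inMk k f -> k = k' -> inMk k' f.
Proof. intros H <-. exact H. Qed.

Lemma inMk_scal (k : Z) (c : C) (f : C -> C) : inMk k f -> inMk k (fmul (fun _ => c) f).
Proof. intros H. apply (inMk_mul 0 k); auto. apply inMk_const. Qed.

Lemma Dk_const0 (c z : C) : Dk 0 (fun _ => c) z = 0%C.
Proof.
  unfold Dk. rewrite (dq_of_cder _ _ _ (cder_const c z)).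
  replace (0 / 12) with 0 by field. field. apply tau_neq0.
Qed.

Lemma RtoC_neq0 (x : R) : x <> 0 -> RtoC x <> 0%C.
Proof. intros H E. apply H. apply RtoC_inj, E. Qed.

(** Ramanujan's identities make the ring of modular forms stable under [Dk]. *)
Lemma inMk_Dk (k : Z) (f : C -> C) : inMk k f -> exists g, inMk (k + 2) g /\ eqH (Dk (IZR k) f) g.
Proof.
  induction 1 as [k|c| | |k f g Hf [f' [Hf' Ef]] Hg [g' [Hg' Eg]]|k1 k2 f g Hf [f' [Hf' Ef]] Hg [g' [Hg' Eg]]].
  - exists (fun _ => RtoC 0). split; [apply inMk_zero|]. intros z Hz. unfold Dk.
    rewrite (dq_of_cder _ _ _ (cder_const 0 z)). field. apply tau_neq0.
  - exists (fun _ => RtoC 0). split; [apply inMk_zero|]. intros z Hz. apply Dk_const0.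
  - exists (fmul (fun _ => (- (1) / 3)%C) E6). split; [apply inMk_scal, inMk_E6|].
    intros z Hz. unfold Dk, fmul. rewrite ramanujan_E4 by auto.
    replace (4 / 12) with (/ 3) by field. rewrite RtoC_inv by lra. field.
  - exists (fmul (fun _ => (- (1) / 2)%C) (fmul E4 E4)). split; [apply inMk_scal, (inMk_mul 4 4); apply inMk_E4|].
    intros z Hz. unfold Dk, fmul. rewrite ramanujan_E6 by auto.
    replace (6 / 12) with (/ 2) by field. rewrite RtoC_inv by lra. field.
  - exists (fun z => f' z + g' z)%C. split; [apply inMk_add; auto|].
    intros z Hz. rewrite Dk_plus, Ef, Eg; eauto using inMk_holo.
  - exists (fun z => fmul f' g z + fmul f g' z)%C. split.
    + apply inMk_add.
      * apply (inMk_cast (k1 + 2 + k2)); [apply inMk_mul; auto|lia].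
      * apply (inMk_cast (k1 + (k2 + 2))); [apply inMk_mul; auto|lia].
    + intros z Hz. unfold fmul. rewrite (Dk_mult (IZR k1) (IZR k2)); eauto using inMk_holo, plus_IZR.
      rewrite Ef, Eg; auto.
Qed.

Lemma holo_dpow (k : nat) (n : R) (f : C -> C) : holo f -> holo (dpow k n f).
Proof. intros H. induction k; simpl; auto. apply holo_Dk. auto. Qed.

Lemma dpow_local (k : nat) (n : R) (f g : C -> C) : holo f -> eqH f g -> eqH (dpow k n f) (dpow k n g).
Proof.
  intros Hf E. induction k; simpl; auto. apply Dk_local; auto using holo_dpow.
Qed.

Lemma dpow_plus (k : nat) (n : R) (f g : C -> C) : holo f -> holo g ->
  eqH (dpow k n (fun z => f z + g z)%C) (fun z => dpow k n f z + dpow k n g z)%C.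
Proof.
  intros Hf Hg. induction k; [intros z _; reflexivity|]. intros z Hz.
  transitivity (Dk (n + IZR (2 * Z.of_nat k)) (fun z => dpow k n f z + dpow k n g z)%C z).
  - apply Dk_local; auto. apply holo_dpow, holo_plus; auto.
  - rewrite Dk_plus; auto using holo_dpow.
Qed.

Definition monom (g : C -> C) (k : nat) : Op := fun n f z => (g z * dpow k n f z)%C.

(** [Deg w N T]: [T] agrees with [g_0 + g_1 delta + ... + g_(N-1) delta^(N-1)], where
    [g_k] is a modular form of weight [w - 2 k]. *)
Fixpoint Deg (w : Z) (N : nat) (T : Op) : Prop :=
  match N with
  | O => op_eq T zero_op
  | S N' => exists g U, inMk (w - 2 * Z.of_nat N') g /\ Deg w N' U /\ op_eq T (op_add U (monom g N'))
  end.

(** [t] is the coefficient of delta^N and may vanish, so this bounds the order by N; exact order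
    follows only with a point where [t] is nonzero. *)
Definition DegT (w : Z) (N : nat) (T : Op) (t : C -> C) : Prop :=
  inMk (w - 2 * Z.of_nat N) t /\ exists U, Deg w N U /\ op_eq T (op_add U (monom t N)).

Lemma op_eq_trans (T U V : Op) : op_eq T U -> op_eq U V -> op_eq T V.
Proof. intros H1 H2 n f Hf z Hz. rewrite H1, H2; auto. Qed.

Lemma op_eq_sym (T U : Op) : op_eq T U -> op_eq U T.
Proof. intros H n f Hf z Hz. rewrite H; auto. Qed.

Lemma DegT_Deg (w : Z) (N : nat) (T : Op) (t : C -> C) : DegT w N T t -> Deg w (S N) T.
Proof. intros [H [U [HU E]]]. exists t, U. auto. Qed.

Lemma Deg_DegT (w : Z) (N : nat) (T : Op) : Deg w (S N) T -> exists t, DegT w N T t.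
Proof. intros [t [U [H1 [H2 H3]]]]. exists t. split; eauto. Qed.

Lemma Deg_ext (w : Z) (N : nat) (T U : Op) : op_eq T U -> Deg w N T -> Deg w N U.
Proof.
  intros E. destruct N; simpl.
  - intros H. eapply op_eq_trans; [apply op_eq_sym; exact E|exact H].
  - intros [g [V [H1 [H2 H3]]]]. exists g, V. repeat split; auto.
    eapply op_eq_trans; [apply op_eq_sym; exact E|exact H3].
Qed.

Lemma DegT_ext (w : Z) (N : nat) (T U : Op) (t : C -> C) : op_eq T U -> DegT w N T t -> DegT w N U t.
Proof.
  intros E [H [V [H2 H3]]]. split; auto. exists V. split; auto.
  eapply op_eq_trans; [apply op_eq_sym; exact E|exact H3].
Qed.

Lemma Deg_cast (w w' : Z) (N N' : nat) (T : Op) : Deg w N T -> w = w' -> N = N' -> Deg w' N' T.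
Proof. intros H <- <-. exact H. Qed.

Lemma DegT_cast (w w' : Z) (N N' : nat) (T : Op) (t : C -> C) : DegT w N T t -> w = w' -> N = N' -> DegT w' N' T t.
Proof. intros H <- <-. exact H. Qed.

Lemma Deg_S (w : Z) (N : nat) (T : Op) : Deg w N T -> Deg w (S N) T.
Proof.
  intros H. exists (fun _ => RtoC 0), T. split; [apply inMk_zero|]. split; auto.
  intros n f Hf z Hz. unfold op_add, monom. ring.
Qed.

Lemma Deg_le (w : Z) (N N' : nat) (T : Op) : (N <= N')%nat -> Deg w N T -> Deg w N' T.
Proof. induction 1; auto using Deg_S. Qed.

Lemma Deg_zero (w : Z) (N : nat) : Deg w N zero_op.
Proof. apply (Deg_le w 0); [lia|]. intros n f Hf z Hz. reflexivity. Qed.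

Lemma Deg_plus (w : Z) (N : nat) : forall T U, Deg w N T -> Deg w N U -> Deg w N (op_add T U).
Proof.
  induction N as [|N IH]; simpl; intros T U.
  - intros H1 H2 n f Hf z Hz. unfold op_add. rewrite H1, H2; auto. unfold zero_op. ring.
  - intros (g & V & A1 & A2 & A3) (h & W & B1 & B2 & B3).
    exists (fun z => g z + h z)%C, (op_add V W). split; [apply inMk_add; auto|]. split; [apply IH; auto|].
    intros n f Hf z Hz. unfold op_add, monom in *. rewrite A3, B3; auto. ring.
Qed.

Lemma DegT_plus (w : Z) (N : nat) (T U : Op) (t : C -> C) : Deg w N T -> DegT w N U t -> DegT w N (op_add T U) t.
Proof.
  intros HT (H1 & V & H2 & H3). split; auto. exists (op_add T V). split; [apply Deg_plus; auto|].
  intros n f Hf z Hz. unfold op_add in *. rewrite H3; auto. ring.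
Qed.

Definition lmul (h : C -> C) (T : Op) : Op := fun n f z => (h z * T n f z)%C.

Lemma lmul_monom (v w : Z) (N : nat) (h g : C -> C) : inMk v h -> inMk (w - 2 * Z.of_nat N) g ->
  inMk (v + w - 2 * Z.of_nat N) (fmul h g) /\ op_eq (lmul h (monom g N)) (monom (fmul h g) N).
Proof.
  intros H1 H2. split.
  - eapply inMk_cast; [apply inMk_mul; eauto|lia].
  - intros n f Hf z Hz. unfold lmul, monom, fmul. ring.
Qed.

Lemma Deg_lmul (v w : Z) (N : nat) (h : C -> C) : inMk v h -> forall T, Deg w N T -> Deg (v + w) N (lmul h T).
Proof.
  intros Hh. induction N as [|N IH]; simpl; intros T.
  - intros H n f Hf z Hz. unfold lmul. rewrite H; auto. unfold zero_op. ring.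
  - intros (g & V & A1 & A2 & A3). exists (fmul h g), (lmul h V).
    split; [apply lmul_monom; auto|]. split; [apply IH; auto|].
    intros n f Hf z Hz. unfold lmul, op_add, monom, fmul in *. rewrite A3; auto. ring.
Qed.

Lemma DegT_lmul (v w : Z) (N : nat) (h t : C -> C) (T : Op) : inMk v h -> DegT w N T t -> DegT (v + w) N (lmul h T) (fmul h t).
Proof.
  intros Hh (H1 & V & H2 & H3). split; [apply lmul_monom; auto|]. exists (lmul h V). split; [apply Deg_lmul; auto|].
  intros n f Hf z Hz. unfold lmul, op_add, monom, fmul in *. rewrite H3; auto. ring.
Qed.

Lemma holo_monom (v : Z) (g f : C -> C) (N : nat) (n : R) : inMk v g -> holo f -> holo (monom g N n f).
Proof. intros Hg Hf. apply holo_mult; [eapply inMk_holo; eauto|apply holo_dpow; auto]. Qed.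

Lemma Deg_holo (w : Z) (N : nat) : forall T, Deg w N T -> forall n f, holo f -> holo (T n f).
Proof.
  induction N as [|N IH]; simpl; intros T.
  - intros H n f Hf. apply (holo_ext (fun _ => RtoC 0)); [|apply holo_const].
    intros z Hz. rewrite H; auto.
  - intros (g & V & A1 & A2 & A3) n f Hf. apply (holo_ext (fun z => V n f z + monom g N n f z)%C).
    + intros z Hz. rewrite A3; auto.
    + apply holo_plus; [apply IH; auto|eapply holo_monom; eauto].
Qed.

(** An arbitrary [Op] could depend on its input off the upper half plane; agreement with a normal
    form excludes this for holomorphic inputs. *)
Lemma Deg_local (w : Z) (N : nat) : forall T, Deg w N T ->
  forall n f g, holo f -> eqH f g -> eqH (T n f) (T n g).
Proof.
  induction N as [|N IH]; simpl; intros T.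
  - intros H n f g Hf E z Hz. rewrite !H; auto. apply (holo_ext f); auto.
  - intros (h & V & A1 & A2 & A3) n f g Hf E z Hz.
    rewrite !A3; auto; [|apply (holo_ext f); auto].
    unfold op_add, monom. rewrite (IH V A2 n f g Hf E z Hz), (dpow_local N n f g Hf E z Hz). reflexivity.
Qed.

Lemma Deg_linear (w : Z) (N : nat) : forall T, Deg w N T ->
  forall n f g, holo f -> holo g -> eqH (T n (fun z => f z + g z)%C) (fun z => T n f z + T n g z)%C.
Proof.
  induction N as [|N IH]; simpl; intros T.
  - intros H n f g Hf Hg z Hz. rewrite !H; auto using holo_plus. unfold zero_op. ring.
  - intros (h & V & A1 & A2 & A3) n f g Hf Hg z Hz. rewrite !A3; auto using holo_plus.
    unfold op_add, monom. rewrite (IH V A2 n f g Hf Hg z Hz), (dpow_plus N n f g Hf Hg z Hz). ring.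
Qed.

Lemma DegT_monom (w : Z) (k : nat) (g : C -> C) : inMk (w - 2 * Z.of_nat k) g -> DegT w k (monom g k) g.
Proof.
  intros H. split; auto. exists zero_op. split; [apply Deg_zero|].
  intros n f Hf z Hz. unfold op_add, zero_op. ring.
Qed.

Definition dleft (k : nat) (w : Z) (T : Op) : Op := fun n f => dpow k (n + IZR w) (T n f).

(** Leibniz with the weights split as n + w = (w - 2 N) + (n + 2 N): delta applied to t delta^N is t
    delta^(N+1) plus the lower term D(t) delta^N. The claim for [U] is a hypothesis so that the
    lemma serves both inside the induction of [Deg_delta] and after it. *)
Lemma DegT_delta_aux (w : Z) (N : nat) (T : Op) (t : C -> C) :
  (forall U, Deg w N U -> Deg (w + 2) (S N) (fun n f => Dk (n + IZR w) (U n f))) ->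
  DegT w N T t -> DegT (w + 2) (S N) (fun n f => Dk (n + IZR w) (T n f)) t.
Proof.
  intros IH (H1 & U & H2 & H3). destruct (inMk_Dk _ _ H1) as [t' [Ht' Et]].
  apply (DegT_ext _ _ (op_add (op_add (fun n f => Dk (n + IZR w) (U n f)) (monom t' N)) (monom t (S N)))).
  - intros n f Hf z Hz.
    assert (HU := Deg_holo w N U H2 n f Hf). assert (Ht := inMk_holo _ _ H1). assert (Hd := holo_dpow N n f Hf).
    transitivity (Dk (n + IZR w) (fun z => U n f z + t z * dpow N n f z)%C z).
    + rewrite Dk_plus by auto using holo_mult.
      rewrite (Dk_mult (IZR (w - 2 * Z.of_nat N)) (n + IZR (2 * Z.of_nat N))); auto.
      * rewrite Et by auto. unfold op_add, monom. cbn [dpow]. unfold rcomp, delta. ring.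
      * rewrite minus_IZR. ring.
    + apply Dk_local; auto using holo_plus, holo_mult. intros z' Hz'. rewrite H3 by auto. reflexivity.
  - apply DegT_plus.
    + apply Deg_plus; [apply IH; auto|]. apply (DegT_Deg _ _ _ t'), DegT_monom.
      eapply inMk_cast; [exact Ht'|lia].
    + apply DegT_monom. eapply inMk_cast; [exact H1|lia].
Qed.

Lemma Deg_delta (w : Z) (N : nat) : forall T, Deg w N T -> Deg (w + 2) (S N) (fun n f => Dk (n + IZR w) (T n f)).
Proof.
  induction N as [|N IH]; intros T H.
  - apply (Deg_ext _ _ zero_op); [|apply Deg_zero]. intros n f Hf z Hz. symmetry.
    transitivity (Dk (n + IZR w) (fun _ => RtoC 0) z).
    + apply Dk_local; auto; [eapply Deg_holo; eauto|]. intros z' Hz'. apply H; auto.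
    + unfold Dk. rewrite (dq_of_cder _ _ _ (cder_const 0 z)). unfold zero_op. field. apply tau_neq0.
  - destruct (Deg_DegT _ _ _ H) as [t Ht]. apply (DegT_Deg _ _ _ t), DegT_delta_aux; auto.
Qed.

Lemma dleft_S (k : nat) (w : Z) (T : Op) : op_eq (dleft (S k) w T) (fun n f => Dk (n + IZR (w + 2 * Z.of_nat k)) (dleft k w T n f)).
Proof.
  intros n f Hf z Hz. unfold dleft. cbn [dpow]. unfold rcomp, delta. rewrite plus_IZR, Rplus_assoc. reflexivity.
Qed.

Lemma Deg_dleft (w : Z) (N k : nat) (T : Op) : Deg w N T -> Deg (w + 2 * Z.of_nat k) (k + N) (dleft k w T).
Proof.
  intros H. induction k as [|k IH].
  - eapply Deg_cast; [exact H|lia|lia].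
  - apply (Deg_ext _ _ _ _ (op_eq_sym _ _ (dleft_S k w T))).
    eapply Deg_cast; [apply Deg_delta, IH|lia|lia].
Qed.

Lemma DegT_dleft (w : Z) (N k : nat) (T : Op) (t : C -> C) : DegT w N T t -> DegT (w + 2 * Z.of_nat k) (k + N) (dleft k w T) t.
Proof.
  intros H. induction k as [|k IH].
  - eapply DegT_cast; [exact H|lia|lia].
  - apply (DegT_ext _ _ _ _ _ (op_eq_sym _ _ (dleft_S k w T))).
    eapply DegT_cast; [apply DegT_delta_aux; [apply Deg_delta|exact IH]|lia|lia].
Qed.

Lemma rcomp_monom (w : Z) (g : C -> C) (k : nat) (T : Op) : rcomp w (monom g k) T = lmul g (dleft k w T).
Proof. reflexivity. Qed.

(** [Deg] counts coefficients, so [S N] means order at most N; orders below M and at most N compose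
    to an order below M + N. *)
Lemma Deg_comp (v w : Z) (M N : nat) (T : Op) : Deg w (S N) T ->
  forall S, Deg v M S -> Deg (v + w) (M + N) (rcomp w S T).
Proof.
  intros HT. induction M as [|M IH]; intros U.
  - intros H. apply (Deg_ext _ _ zero_op); [|apply Deg_zero].
    intros n f Hf z Hz. symmetry. apply (H (n + IZR w) (T n f)); auto. eapply Deg_holo; eauto.
  - intros (g & V & A1 & A2 & A3).
    apply (Deg_ext _ _ (op_add (rcomp w V T) (rcomp w (monom g M) T))).
    + intros n f Hf z Hz. symmetry. apply A3; auto. eapply Deg_holo; eauto.
    + apply (Deg_plus _ (S (M + N))); [apply Deg_S, IH; auto|]. rewrite rcomp_monom.
      eapply Deg_cast; [apply Deg_lmul; [exact A1|apply Deg_dleft; exact HT]|lia|lia].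
Qed.

Lemma DegT_comp (v w : Z) (M N : nat) (S T : Op) (s t : C -> C) :
  DegT v M S s -> DegT w N T t -> DegT (v + w) (M + N) (rcomp w S T) (fmul s t).
Proof.
  intros (A1 & V & A2 & A3) HT. assert (HT' := DegT_Deg _ _ _ _ HT).
  apply (DegT_ext _ _ (op_add (rcomp w V T) (rcomp w (monom s M) T))).
  - intros n f Hf z Hz. symmetry. apply A3; auto. eapply Deg_holo; eauto.
  - apply DegT_plus; [apply Deg_comp; auto|]. rewrite rcomp_monom.
    eapply DegT_cast; [apply DegT_lmul; [exact A1|apply DegT_dleft; exact HT]|lia|lia].
Qed.

Lemma inR_Deg (k : Z) (T : Op) : inR k T -> exists N, Deg k N T.
Proof.
  induction 1 as [k|c| | | |k T U _ [N HN] _ [M HM]|k1 k2 T U _ [N HN] _ [M HM]].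
  - exists 0%nat. apply Deg_zero.
  - exists 1%nat. apply (DegT_Deg _ _ _ (fun _ => c)), (DegT_monom 0 0). apply inMk_const.
  - exists 2%nat. apply (DegT_Deg _ _ _ (fun _ => RtoC 1)).
    apply (DegT_ext _ _ (monom (fun _ => RtoC 1) 1)).
    + intros n f Hf z Hz. unfold monom, delta. cbn [dpow]. unfold rcomp, delta. simpl IZR.
      rewrite Rplus_0_r. ring.
    + apply DegT_monom. apply inMk_const.
  - exists 1%nat. apply (DegT_Deg _ _ _ E4), (DegT_monom 4 0). apply inMk_E4.
  - exists 1%nat. apply (DegT_Deg _ _ _ E6), (DegT_monom 6 0). apply inMk_E6.
  - exists (Nat.max N M). apply Deg_plus; [apply (Deg_le _ N)|apply (Deg_le _ M)]; auto; lia.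
  - exists (N + M)%nat. apply Deg_comp; auto. apply Deg_S; auto.
Qed.

Fixpoint psum (F : nat -> C) (N : nat) : C :=
  match N with O => RtoC 0 | S N' => (psum F N' + F N')%C end.

Definition nf (s : nat -> C -> C) (N : nat) : Op :=
  fun n f z => psum (fun k => monom (s k) k n f z) N.

Lemma psum_ext (F G : nat -> C) (N : nat) : (forall k, (k < N)%nat -> F k = G k) -> psum F N = psum G N.
Proof. induction N; intros H; simpl; auto. rewrite IHN, H; auto. Qed.

Lemma expand_nf (s : nat -> C -> C) (i : nat) : expand s i = nf s (S i).
Proof.
  unfold expand, nf. extensionality n. extensionality f. extensionality z.
  induction i as [|i IH].
  - rewrite sum_O. simpl. unfold monom. simpl. ring.
  - rewrite sum_Sn, IH. reflexivity.
Qed.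

Lemma Deg_nf (w : Z) (N : nat) : forall T, Deg w N T ->
  exists s, (forall k, inMk (w - 2 * Z.of_nat k) (s k)) /\ op_eq T (nf s N).
Proof.
  induction N as [|N IH]; simpl; intros T H.
  - exists (fun _ _ => RtoC 0). split; [intros; apply inMk_zero|]. exact H.
  - destruct H as (g & V & A1 & A2 & A3). destruct (IH V A2) as (s & S1 & S2).
    exists (fun k => if Nat.eqb k N then g else s k). split.
    + intros k. destruct (Nat.eqb_spec k N) as [->|]; [exact A1|apply S1].
    + clear IH. intros n f Hf z Hz. rewrite A3 by auto. unfold op_add. rewrite S2 by auto. unfold nf. simpl.
      rewrite Nat.eqb_refl. apply (f_equal2 Cplus); [|reflexivity]. apply psum_ext. intros k Hk.
      destruct (Nat.eqb_spec k N); [lia|auto].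
Qed.

Lemma nf_Deg (w : Z) (N : nat) (s : nat -> C -> C) : (forall k, inMk (w - 2 * Z.of_nat k) (s k)) -> Deg w N (nf s N).
Proof.
  intros H. induction N as [|N IH]; simpl.
  - intros n f Hf z Hz. reflexivity.
  - exists (s N), (nf s N). split; [apply H|]. split; [exact IH|]. intros n f Hf z Hz. reflexivity.
Qed.

Lemma inR_cast (k k' : Z) (T : Op) : inR k T -> k = k' -> inR k' T.
Proof. intros H <-. exact H. Qed.

(** Membership in [inR] is transported along literal equality of operators, hence the use of
    extensionality instead of [op_eq]. *)
Lemma inR_mul (k : Z) (g : C -> C) : inMk k g -> inR k (mul_op g).
Proof.
  induction 1 as [k|c| | |k f g Hf IHf Hg IHg|k1 k2 f g Hf IHf Hg IHg].
  - replace (mul_op (fun _ => RtoC 0)) with zero_op; [apply inR_zero|].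
    unfold mul_op, zero_op. extensionality n. extensionality f. extensionality z. ring.
  - apply inR_scal.
  - apply inR_e4.
  - apply inR_e6.
  - replace (mul_op (fun z => f z + g z)%C) with (op_add (mul_op f) (mul_op g)); [apply inR_add; auto|].
    unfold mul_op, op_add. extensionality n. extensionality h. extensionality z. ring.
  - replace (mul_op (fmul f g)) with (rcomp k2 (mul_op f) (mul_op g)); [apply inR_comp; auto|].
    unfold mul_op, rcomp, fmul. extensionality n. extensionality h. extensionality z. ring.
Qed.

Lemma inR_dpow (k : nat) : inR (2 * Z.of_nat k) (dpow k).
Proof.
  induction k as [|k IH].
  - replace (dpow 0) with (fun (_ : R) (f : C -> C) z => RtoC 1 * f z)%C; [apply (inR_scal 1)|].
    extensionality n. extensionality f. extensionality z. simpl. ring.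
  - eapply inR_cast; [apply inR_comp; [apply inR_delta|exact IH]|lia].
Qed.

Lemma inR_nf (w : Z) (N : nat) (s : nat -> C -> C) : (forall k, inMk (w - 2 * Z.of_nat k) (s k)) -> inR w (nf s N).
Proof.
  intros H. induction N as [|N IH].
  - apply inR_zero.
  - change (nf s (S N)) with (op_add (nf s N) (rcomp (2 * Z.of_nat N) (mul_op (s N)) (dpow N))).
    apply inR_add; auto. eapply inR_cast; [apply inR_comp; [apply inR_mul, H|apply inR_dpow]|lia].
Qed.

(** * Uniqueness of normal forms *)

Lemma holo_pow (z0 : C) (N : nat) : holo (fun w => Cpow (w - z0) N).
Proof.
  induction N as [|N IH]; simpl; [apply holo_const|].
  apply (holo_mult (fun w => w - z0)%C); auto.
  apply holo_cdiff. intros z _. apply cdiff_sub_const, cdiff_id.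
Qed.

Lemma Dk_pow_mult (m : R) (z0 : C) (j : nat) (h : C -> C) (z : C) : holo h -> inH z ->
  Dk m (fun w => Cpow (w - z0) (S j) * h w)%C z =
  (Cpow (z - z0) j * (INR (S j) / tau * h z + (z - z0) * Dk m h z))%C.
Proof.
  intros Hh Hz. rewrite (Dk_mult 0 m); auto using holo_pow; [|ring].
  unfold Dk at 1. rewrite (dq_of_cder _ _ (INR (S j) * Cpow (z - z0) j * (1 - 0))%C).
  - replace (0 / 12) with 0 by field. cbn [Cpow]. field. apply tau_neq0.
  - apply (cder_comp (fun w => Cpow w (S j)) (fun w => (w - z0)%C)); [apply cder_pow|].
    apply cder_minus; [apply cder_id|apply cder_const].
Qed.

(** Each delta lowers the order of vanishing at [z0] by exactly one: the cofactor at [z0] is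
    multiplied by a nonzero integer over [tau], while the [E2] term keeps the extra factor w -
    z0. *)
Lemma dpow_pow_vanish (z0 : C) (N : nat) (n : R) (k : nat) : (k <= N)%nat ->
  exists h, holo h /\ h z0 <> 0%C /\
    eqH (dpow k n (fun w => Cpow (w - z0) N)) (fun w => Cpow (w - z0) (N - k) * h w)%C.
Proof.
  induction k as [|k IH]; intros Hk.
  - exists (fun _ => RtoC 1). split; [apply holo_const|]. split; [apply RtoC_neq0; lra|].
    intros z Hz. rewrite Nat.sub_0_r. simpl. ring.
  - destruct (IH ltac:(lia)) as (h & H1 & H2 & H3).
    set (m := n + IZR (2 * Z.of_nat k)). set (j := (N - S k)%nat).
    exists (fun w => INR (S j) / tau * h w + (w - z0) * Dk m h w)%C. split; [|split].
    + apply holo_plus; apply holo_mult; auto using holo_const, holo_Dk.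
      apply holo_cdiff. intros z _. apply cdiff_sub_const, cdiff_id.
    + replace (INR (S j) / tau * h z0 + (z0 - z0) * Dk m h z0)%C with (INR (S j) * (/ tau * h z0))%C by (unfold Cdiv; ring).
      apply Cmult_neq_0; [apply RtoC_neq0, not_0_INR; lia|]. apply Cmult_neq_0; auto.
      intros E. apply tau_neq0. rewrite <- (Cmult_1_r tau), <- (Cinv_r tau), E by apply tau_neq0. ring.
    + intros z Hz. rewrite <- Dk_pow_mult by auto. cbn [dpow]. unfold rcomp, delta. fold m.
      apply Dk_local; auto.
      * apply holo_dpow, holo_pow.
      * intros z' Hz'. rewrite H3 by auto. replace (N - k)%nat with (S j) by (unfold j; lia). reflexivity.
Qed.

(** Testing on [(w - z)^N], which is killed at [z] by the lower powers of
    [delta], isolates the top coefficient. *)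
Lemma coef_zero (z : C) (N : nat) : inH z -> forall c : nat -> C,
  (forall f, holo f -> psum (fun k => c k * dpow k 0 f z)%C N = 0%C) ->
  forall k, (k < N)%nat -> c k = 0%C.
Proof.
  intros Hz. induction N as [|N IH]; intros c H k Hk; [lia|].
  assert (Htop : c N = 0%C).
  { assert (E := H _ (holo_pow z N)). simpl in E.
    rewrite (psum_ext _ (fun _ => RtoC 0)) in E.
    - destruct (dpow_pow_vanish z N 0 N (le_n N)) as (h & H1 & H2 & H3).
      rewrite (H3 z Hz), Nat.sub_diag in E. simpl in E.
      assert (Z0 : forall M, psum (fun _ => RtoC 0) M = RtoC 0) by (induction M; simpl; [|rewrite IHM]; try ring; auto).
      rewrite Z0 in E. apply NNPP. intros Hn. apply (Cmult_neq_0 _ _ Hn H2).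
      rewrite <- E. ring.
    - intros j Hj. destruct (dpow_pow_vanish z N 0 j ltac:(lia)) as (h & H1 & H2 & H3).
      rewrite (H3 z Hz). destruct (N - j)%nat eqn:E'; [lia|]. simpl. ring. }
  destruct (Nat.eq_dec k N) as [->|]; auto.
  apply IH; [|lia]. intros f Hf. specialize (H f Hf). simpl in H. rewrite Htop in H. rewrite <- H. ring.
Qed.

Lemma psum_minus (F G : nat -> C) (N : nat) : psum (fun k => F k - G k)%C N = (psum F N - psum G N)%C.
Proof. induction N; simpl; [ring|]. rewrite IHN. ring. Qed.

Lemma psum_trunc (F : nat -> C) (M N : nat) : (M <= N)%nat ->
  psum (fun k => if (k <? M)%nat then F k else RtoC 0) N = psum F M.
Proof.
  induction 1 as [|N H IH].
  - apply psum_ext. intros k Hk. destruct (Nat.ltb_spec k M); [auto|lia].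
  - simpl. rewrite IH. destruct (Nat.ltb_spec N M); [lia|]. ring.
Qed.

(** Unequal lengths are allowed because a weighted expansion from [inR_Deg] may be longer than the
    given one. *)
Lemma nf_unique (s t : nat -> C -> C) (M N : nat) : (M <= N)%nat -> op_eq (nf s N) (nf t M) ->
  forall k z, (k < N)%nat -> inH z -> s k z = (if (k <? M)%nat then t k z else RtoC 0).
Proof.
  intros HMN H k z Hk Hz.
  enough (E : (s k z - (if (k <? M)%nat then t k z else RtoC 0))%C = 0%C).
  { set (x := if (k <? M)%nat then t k z else RtoC 0) in *.
    transitivity (s k z - x + x)%C; [ring|]. rewrite E. ring. }
  apply (coef_zero z N Hz (fun k => s k z - (if (k <? M)%nat then t k z else RtoC 0))%C); auto.
  intros f Hf.
  rewrite (psum_ext _ (fun k => monom (s k) k 0 f z - (if (k <? M)%nat then monom (t k) k 0 f z else RtoC 0))%C).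
  - rewrite psum_minus, (psum_trunc (fun k => monom (t k) k 0 f z)) by auto. specialize (H 0 f Hf z Hz). unfold nf in H. rewrite H. ring.
  - intros j _. unfold monom. destruct (j <? M)%nat; ring.
Qed.

Lemma mul_op_nonzero (t : C -> C) : ~ op_eq (mul_op t) zero_op <-> exists z, inH z /\ t z <> 0%C.
Proof.
  split.
  - intros H. apply NNPP. intros HN. apply H. intros n f Hf z Hz. unfold mul_op, zero_op.
    replace (t z) with (RtoC 0); [ring|]. symmetry. apply NNPP. intros E. apply HN. eauto.
  - intros (z & Hz & Hn) H. apply Hn. specialize (H 0 _ (holo_const 1) z Hz). unfold mul_op, zero_op in H.
    rewrite <- H. ring.
Qed.

(** The given coefficients lie in [inM] without weights, while membership in [inR n] yields a
    weighted expansion. Uniqueness identifies the two on the upper half plane, so the given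
    coefficients may be exchanged for weighted ones. *)
Lemma has_ord_top_DegT (n : Z) (a : Op) (i : nat) (t : C -> C) : inR n a -> has_ord_top a i t ->
  exists t', eqH t' t /\ DegT n i a t'.
Proof.
  intros HR (s & H1 & H2 & H3 & H4). destruct (inR_Deg n a HR) as [N0 HN0].
  set (N := Nat.max N0 (S i)). assert (HN := Deg_le n N0 N a ltac:(lia) HN0).
  destruct (Deg_nf n N a HN) as (u & U1 & U2). rewrite expand_nf in H4.
  assert (E := nf_unique u s (S i) N ltac:(lia) (op_eq_trans _ _ _ (op_eq_sym _ _ U2) H4)).
  exists (u i). split.
  - intros z Hz. rewrite (E i z) by (auto; lia). destruct (Nat.ltb_spec i (S i)); [congruence|lia].
  - split; auto. exists (nf u i). split; [apply nf_Deg; auto|].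
    apply (op_eq_trans _ _ _ H4). intros m f Hf z Hz. change (nf s (S i) m f z = nf u (S i) m f z).
    apply psum_ext. intros k Hk. unfold monom. rewrite (E k z) by (auto; lia).
    destruct (Nat.ltb_spec k (S i)); [reflexivity|lia].
Qed.

Lemma nf_has_ord (s : nat -> C -> C) (N : nat) : (forall k, inM (s k)) -> (exists z, inH z /\ s N z <> 0%C) ->
  has_ord (nf s (S N)) N.
Proof.
  intros H Hn. exists (s N), s. repeat split; auto.
  - apply mul_op_nonzero; auto.
  - rewrite expand_nf. intros n f Hf z Hz. reflexivity.
Qed.

Lemma op_eq_has_ord (T U : Op) (i : nat) : op_eq T U -> has_ord U i -> has_ord T i.
Proof.
  intros E (t & s & H1 & H2 & H3 & H4). exists t, s. repeat split; auto. eapply op_eq_trans; eauto.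
Qed.

(** Top coefficients that vanish on the upper half plane are stripped off until a nonzero one, or
    nothing, is left. *)
Lemma nf_ord_lt (s : nat -> C -> C) (N : nat) : (forall k, inM (s k)) -> ord_lt (nf s N) N.
Proof.
  intros H. induction N as [|N IH].
  - left. intros n f Hf z Hz. reflexivity.
  - destruct (classic (exists z, inH z /\ s N z <> 0%C)) as [Hn|Hn].
    + right. exists N. split; [lia|]. apply nf_has_ord; auto.
    + assert (E : op_eq (nf s (S N)) (nf s N)).
      { intros n f Hf z Hz. unfold nf. simpl. unfold monom at 2.
        replace (s N z) with (RtoC 0); [ring|]. symmetry. apply NNPP. intros E. apply Hn. eauto. }
      destruct IH as [IH|(i & Hi & IH)].
      * left. eapply op_eq_trans; eauto.
      * right. exists i. split; [lia|]. eapply op_eq_has_ord; eauto.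
Qed.

(** The witness is the normal form itself, built from generators and hence in [inR], even though [T]
    is known only up to [op_eq]. *)
Lemma DegT_realize (w : Z) (N : nat) (T : Op) (t : C -> C) : DegT w N T t -> (exists z, inH z /\ t z <> 0%C) ->
  exists U, inR w U /\ has_ord U N /\ op_eq T U.
Proof.
  intros (H1 & V & H2 & H3) Hn. destruct (Deg_nf w N V H2) as (s & S1 & S2).
  set (u := fun k => if Nat.eqb k N then t else s k).
  assert (Hu : forall k, inMk (w - 2 * Z.of_nat k) (u k)).
  { intros k. unfold u. destruct (Nat.eqb_spec k N) as [->|]; [exact H1|apply S1]. }
  exists (nf u (S N)). split; [apply inR_nf; auto|]. split.
  - apply nf_has_ord; [intros k; eapply inMk_inM, Hu|]. unfold u. rewrite Nat.eqb_refl. exact Hn.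
  - apply (op_eq_trans _ _ _ H3). intros n f Hf z Hz. unfold op_add. rewrite S2 by auto.
    unfold nf. cbn [psum]. apply (f_equal2 Cplus).
    + apply psum_ext. intros k Hk. unfold u. destruct (Nat.eqb_spec k N); [lia|auto].
    + unfold u. rewrite Nat.eqb_refl. reflexivity.
Qed.

Lemma Deg_realize (w : Z) (N : nat) (T : Op) : Deg w N T ->
  exists U, inR w U /\ ord_lt U N /\ op_eq T U.
Proof.
  intros H. destruct (Deg_nf w N T H) as (s & S1 & S2). exists (nf s N). split; [apply inR_nf; auto|].
  split; auto. apply nf_ord_lt. intros k. eapply inMk_inM, S1.
Qed.

Lemma inMk_fpow (k : Z) (f : C -> C) (e : nat) : inMk k f -> inMk (Z.of_nat e * k) (fpow f e).
Proof.
  intros H. induction e as [|e IH].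
  - apply (inMk_const 1).
  - change (fpow f (S e)) with (fmul f (fpow f e)). eapply inMk_cast; [apply inMk_mul; eauto|lia].
Qed.

Lemma fpow_S (f : C -> C) (e : nat) (z : C) : fpow f (S e) z = (f z * fpow f e z)%C.
Proof. reflexivity. Qed.

Lemma op_arg_eq (T : Op) (n n' : R) (f : C -> C) (z : C) : n = n' -> T n f z = T n' f z.
Proof. intros ->. reflexivity. Qed.

Lemma Deg_sub (v w w' : Z) (N : nat) (g h : C -> C) (T U : Op) :
  inMk (w - v) g -> inMk (w - w') h -> Deg v N T -> Deg w' N U ->
  Deg w N (fun n f z => g z * T n f z - h z * U n f z)%C.
Proof.
  intros Hg Hh HT HU.
  apply (Deg_ext _ _ (op_add (lmul g T) (lmul (fmul (fun _ => (- (1))%C) h) U))).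
  - intros n f Hf z Hz. unfold op_add, lmul, fmul. ring.
  - apply Deg_plus; [apply (Deg_cast (w - v + v) _ N N)|apply (Deg_cast (w - w' + w') _ N N)]; try lia;
      apply Deg_lmul; auto using inMk_scal.
Qed.

(** * Pseudo-division *)

Lemma DegT_rmul (w v : Z) (N : nat) (T : Op) (t g : C -> C) : DegT w N T t -> inMk v g ->
  DegT (w + v) N (rcomp v T (mul_op g)) (fmul t g).
Proof.
  intros HT Hg. eapply DegT_cast; [apply DegT_comp; [exact HT|]| |].
  - apply (DegT_monom v 0). eapply inMk_cast; [exact Hg|simpl; lia].
  - reflexivity.
  - lia.
Qed.

Lemma Deg_sub_tops (w : Z) (N : nat) (T U : Op) (t u : C -> C) : DegT w N T t -> DegT w N U u -> eqH t u ->
  Deg w N (fun n f z => T n f z - U n f z)%C.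
Proof.
  intros (A1 & V & A2 & A3) (B1 & W & B2 & B3) E.
  apply (Deg_ext _ _ (fun n f z => 1 * V n f z - 1 * W n f z)%C).
  - intros n f Hf z Hz. rewrite A3, B3 by auto. unfold op_add, monom. rewrite (E z Hz). ring.
  - apply (Deg_sub w _ w _ (fun _ => RtoC 1) (fun _ => RtoC 1)); auto;
      (eapply inMk_cast; [apply (inMk_const 1)|lia]).
Qed.

(** The quotient of the remaining steps has order below [e], so the newly added term alone
    determines the top. *)
Lemma left_quotient_DegT (c1 : Op) (e : nat) (w v : Z) (h g : C -> C) : Deg w e c1 ->
  inMk v g -> inMk (w - v - 2 * Z.of_nat e) h ->
  DegT w e (op_add c1 (lmul g (monom h e))) (fmul g h).
Proof.
  intros H1 Hg Hh. apply DegT_plus; auto.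
  eapply DegT_cast; [apply (DegT_lmul v (w - v)); [exact Hg|apply DegT_monom; exact Hh]|lia|auto].
Qed.

Lemma right_quotient_DegT (c1 : Op) (e : nat) (w v : Z) (h g : C -> C) : Deg w e c1 ->
  inMk v g -> inMk (w - v - 2 * Z.of_nat e) h ->
  DegT w e (op_add c1 (rcomp v (monom h e) (mul_op g))) (fmul h g).
Proof.
  intros H1 Hg Hh. apply DegT_plus; auto.
  eapply DegT_cast; [apply (DegT_rmul (w - v) v); [apply DegT_monom; exact Hh|exact Hg]|lia|auto].
Qed.

Section Division.
Variables (b : Op) (beta : C -> C) (m : Z) (j : nat).
Hypothesis Hb : DegT m j b beta.
Let mu := (m - 2 * Z.of_nat j)%Z.

(** The coefficients of [delta^(j + e)] cancel by the last hypothesis. *)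
Lemma left_step (a : Op) (n : Z) (e : nat) (ta : C -> C) (g h : C -> C) (l : Z) :
  DegT n (j + e) a ta -> inMk (mu - l) g -> inMk (n - 2 * Z.of_nat (j + e) - l) h ->
  eqH (fmul g ta) (fmul h beta) ->
  Deg (mu - l + n) (j + e) (fun n' f z => g z * a n' f z - h z * dpow e (n' + IZR m)%R (b n' f) z)%C.
Proof.
  intros (A1 & U & A2 & A3) Hg Hh E.
  destruct (DegT_dleft m j e b beta Hb) as (B1 & V & B2 & B3).
  apply (Deg_ext _ _ (fun n f z => g z * U n f z - h z * V n f z)%C).
  - intros n' f Hf z Hz. rewrite A3 by auto. unfold dleft in B3. rewrite B3 by auto.
    rewrite (Nat.add_comm e j). specialize (E z Hz). unfold fmul in E. unfold op_add, monom.
    transitivity (g z * U n' f z - h z * V n' f z + (g z * ta z - h z * beta z) * dpow (j + e) n' f z)%C; [|ring].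
    rewrite E. ring.
  - rewrite (Nat.add_comm e j) in B2. apply (Deg_sub n _ (m + 2 * Z.of_nat e)); auto.
    + eapply inMk_cast; [exact Hg|lia].
    + eapply inMk_cast; [exact Hh|unfold mu; lia].
Qed.

(** Induction on [e] by beta^(e+1) r = beta^e (beta r - rho delta^e b) + beta^e rho delta^e b, with
    rho the coefficient of delta^(j+e) in r. The first bracket has one coefficient fewer; the last
    term joins the quotient. *)
Lemma left_division (e : nat) : forall (w : Z) (r : Op), Deg w (j + e) r ->
  exists c c', Deg (Z.of_nat e * mu + w - m) e c /\ Deg (Z.of_nat e * mu + w) j c' /\
    forall n f z, holo f -> inH z ->
      (fpow beta e z * r n f z = c (n + IZR m)%R (b n f) z + c' n f z)%C.
Proof.
  induction e as [|e IH]; intros w r Hr.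
  - exists zero_op, r. split; [apply Deg_zero|]. split; [eapply Deg_cast; [exact Hr|lia|lia]|].
    intros n f z Hf Hz. unfold fpow, zero_op. simpl. change (@one C_Ring) with (RtoC 1). ring.
  - rewrite Nat.add_succ_r in Hr. destruct (Deg_DegT _ _ _ Hr) as [rho Hrho].
    assert (Hrho' := proj1 Hrho).
    assert (Hbeta0 : inMk (mu - 0) beta) by (eapply inMk_cast; [exact (proj1 Hb)|unfold mu; lia]).
    assert (Hrho0 : inMk (w - 2 * Z.of_nat (j + e) - 0) rho) by (eapply inMk_cast; [exact Hrho'|lia]).
    (* No common divisor is used in this step, hence l = 0 and the trivial cancellation of beta rho
       against rho beta. *)
    assert (Hst := left_step r w e rho beta rho 0 Hrho Hbeta0 Hrho0 ltac:(intros z Hz; unfold fmul; ring)).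
    destruct (IH _ _ Hst) as (c1 & c1' & C1 & C2 & C3).
    exists (op_add c1 (lmul (fpow beta e) (monom rho e))), c1'. split; [|split].
    + apply (DegT_Deg _ _ _ (fmul (fpow beta e) rho)). apply (left_quotient_DegT c1 e _ (Z.of_nat e * mu)).
      * eapply Deg_cast; [exact C1|lia|auto].
      * apply inMk_fpow. exact (proj1 Hb).
      * eapply inMk_cast; [exact Hrho'|unfold mu; lia].
    + eapply Deg_cast; [exact C2|lia|auto].
    + intros n f z Hf Hz. specialize (C3 n f z Hf Hz). rewrite fpow_S. unfold op_add, lmul, monom.
      transitivity (fpow beta e z * (beta z * r n f z - rho z * dpow e (n + IZR m)%R (b n f) z)
        + fpow beta e z * (rho z * dpow e (n + IZR m)%R (b n f) z))%C; [ring|].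
      rewrite C3. ring.
Qed.

(** Moving [g] and [h] to the left of delta changes only lower coefficients, so the tops are still
    products and cancel. The operator h delta^e has weight n - 2 j - l. *)
Lemma right_step (a : Op) (n : Z) (e : nat) (ta : C -> C) (g h : C -> C) (l : Z) :
  DegT n (j + e) a ta -> inMk (mu - l) g -> inMk (n - 2 * Z.of_nat (j + e) - l) h ->
  eqH (fmul ta g) (fmul beta h) ->
  Deg (n + (mu - l)) (j + e)
    (fun n' f z => rcomp (mu - l) a (mul_op g) n' f z - rcomp (n - 2 * Z.of_nat j - l) b (monom h e) n' f z)%C.
Proof.
  intros Ha Hg Hh E.
  apply (Deg_sub_tops _ _ _ _ (fmul ta g) (fmul beta h)); auto.
  - apply DegT_rmul; auto.
  - eapply DegT_cast; [apply (DegT_comp m (n - 2 * Z.of_nat j - l) j e); [exact Hb|apply DegT_monom]|unfold mu; lia|auto].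
    eapply inMk_cast; [exact Hh|lia].
Qed.

(** From (a g - b h delta^e) k = b c1 + c1' to a g k = b (c1 + h delta^e k) + c1'. Collecting the
    two terms under [b] uses its additivity; matching the multipliers in the argument of [a] uses
    its locality. *)
Lemma right_combine (a c1 c1' : Op) (e : nat) (n l wc : Z) (g h k : C -> C) (vk : Z) :
  inMk vk k -> inMk (mu - l) g -> inMk (n - 2 * Z.of_nat (j + e) - l) h ->
  wc = (vk + (n - 2 * Z.of_nat j - l))%Z -> (exists N, Deg wc N c1) -> (exists N, Deg n N a) ->
  (forall n' f z, holo f -> inH z ->
    (rcomp (mu - l) a (mul_op g) (n' + IZR vk)%R (fmul k f) z
      - rcomp (n - 2 * Z.of_nat j - l) b (monom h e) (n' + IZR vk)%R (fmul k f) z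
      = b (n' + IZR wc)%R (c1 n' f) z + c1' n' f z)%C) ->
  forall n' f z, holo f -> inH z ->
    a (n' + IZR (mu - l + vk))%R (fun z => fmul g k z * f z)%C z =
    (b (n' + IZR wc)%R (op_add c1 (rcomp vk (monom h e) (mul_op k)) n' f) z + c1' n' f z)%C.
Proof.
  intros Hk Hg Hh Ewc [Nc Hc] [Na Ha] H n' f z Hf Hz.
  assert (Hkf : holo (fmul k f)) by (apply holo_mult; auto; eapply inMk_holo; eauto).
  assert (Hgh : holo g) by (eapply inMk_holo; eauto).
  assert (Hbd := DegT_Deg _ _ _ _ Hb).
  specialize (H n' f z Hf Hz). unfold rcomp in H.
  unfold op_add at 1.
  assert (HL := Deg_linear _ _ _ Hbd (n' + IZR wc)%R (c1 n' f) (rcomp vk (monom h e) (mul_op k) n' f)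
    ltac:(eapply Deg_holo; eauto) ltac:(unfold rcomp; eapply holo_monom; [exact Hh|exact Hkf]) z Hz).
  cbv beta in HL. etransitivity; [|apply (f_equal (fun x => x + c1' n' f z)%C); symmetry; exact HL].
  assert (Eb : b (n' + IZR wc)%R (rcomp vk (monom h e) (mul_op k) n' f) z =
    b (n' + IZR vk + IZR (n - 2 * Z.of_nat j - l))%R (monom h e (n' + IZR vk)%R (fmul k f)) z).
  { apply op_arg_eq. rewrite Ewc, plus_IZR. ring. }
  assert (Ea : a (n' + IZR (mu - l + vk))%R (fun z => fmul g k z * f z)%C z =
    a (n' + IZR vk + IZR (mu - l))%R (mul_op g (n' + IZR vk)%R (fmul k f)) z).
  { rewrite (op_arg_eq a (n' + IZR (mu - l + vk))%R (n' + IZR vk + IZR (mu - l))%R) by (rewrite plus_IZR; ring).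
    apply (Deg_local n Na a Ha); auto.
    - apply (holo_mult (fmul g k)); auto. apply holo_mult; auto. eapply inMk_holo; eauto.
    - intros z' _. unfold mul_op, fmul. ring. }
  rewrite Ea, Eb.
  transitivity ((a (n' + IZR vk + IZR (mu - l))%R (mul_op g (n' + IZR vk)%R (fmul k f)) z
     - b (n' + IZR vk + IZR (n - 2 * Z.of_nat j - l))%R (monom h e (n' + IZR vk)%R (fmul k f)) z)
     + b (n' + IZR vk + IZR (n - 2 * Z.of_nat j - l))%R (monom h e (n' + IZR vk)%R (fmul k f)) z)%C; [ring|].
  rewrite H. ring.
Qed.

Lemma right_division (e : nat) : forall (w : Z) (r : Op), Deg w (j + e) r ->
  exists c c', Deg (Z.of_nat e * mu + w - m) e c /\ Deg (Z.of_nat e * mu + w) j c' /\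
    forall n f z, holo f -> inH z ->
      (r (n + IZR (Z.of_nat e * mu))%R (fmul (fpow beta e) f) z =
       b (n + IZR (Z.of_nat e * mu + w - m))%R (c n f) z + c' n f z)%C.
Proof.
  induction e as [|e IH]; intros w r Hr.
  - exists zero_op, r. split; [apply Deg_zero|]. split; [eapply Deg_cast; [exact Hr|lia|lia]|].
    intros n f z Hf Hz. assert (Hbd := DegT_Deg _ _ _ _ Hb).
    (* Additivity at 0 + 0 = 0 forces [b] to send the zero function to 0. *)
    assert (B0 : b (n + IZR (Z.of_nat 0 * mu + w - m))%R (zero_op n f) z = 0%C).
    { assert (HL := Deg_linear _ _ _ Hbd (n + IZR (Z.of_nat 0 * mu + w - m))%R _ _ (holo_const 0) (holo_const 0) z Hz).
      cbv beta in HL. replace (fun _ : C => (RtoC 0 + RtoC 0)%C) with (fun _ : C => RtoC 0) in HL by (extensionality t; ring).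
      unfold zero_op. set (X := b _ _ z) in *. replace X with (X + X - X)%C by ring. rewrite <- HL at 1. ring. }
    rewrite B0. rewrite (op_arg_eq r _ n) by (simpl; ring). rewrite Cplus_0_l.
    apply (Deg_local _ _ _ Hr).
    + apply holo_mult; [apply holo_const|auto].
    + intros z' _. unfold fmul, fpow. simpl. change (@one C_Ring) with (RtoC 1). ring.
    + exact Hz.
  - rewrite Nat.add_succ_r in Hr. destruct (Deg_DegT _ _ _ Hr) as [rho Hrho].
    assert (Hrho' := proj1 Hrho). assert (Hbeta := proj1 Hb).
    assert (Hbeta0 : inMk (mu - 0) beta) by (eapply inMk_cast; [exact Hbeta|unfold mu; lia]).
    assert (Hrho0 : inMk (w - 2 * Z.of_nat (j + e) - 0) rho) by (eapply inMk_cast; [exact Hrho'|lia]).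
    assert (Hst := right_step r w e rho beta rho 0 Hrho Hbeta0 Hrho0 ltac:(intros z Hz; unfold fmul; ring)).
    destruct (IH _ _ Hst) as (c1 & c1' & C1 & C2 & C3).
    set (wc := (Z.of_nat e * mu + (w + (mu - 0)) - m)%Z) in *.
    exists (op_add c1 (rcomp (Z.of_nat e * mu) (monom rho e) (mul_op (fpow beta e)))), c1'. split; [|split].
    + apply (DegT_Deg _ _ _ (fmul rho (fpow beta e))). apply right_quotient_DegT.
      * eapply Deg_cast; [exact C1|unfold wc; lia|auto].
      * apply inMk_fpow. exact Hbeta.
      * eapply inMk_cast; [exact Hrho'|unfold mu; lia].
    + eapply Deg_cast; [exact C2|lia|auto].
    + intros n f z Hf Hz.
      assert (R1 := right_combine r c1 c1' e w 0 wc beta rho (fpow beta e) (Z.of_nat e * mu)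
        (inMk_fpow _ _ e Hbeta) Hbeta0 Hrho0 ltac:(unfold wc, mu; lia) (ex_intro (fun N => Deg wc N c1) _ C1) (ex_intro (fun N => Deg w N r) _ Hr) C3 n f z Hf Hz).
      replace (Z.of_nat (S e) * mu + w - m)%Z with wc by (unfold wc; lia).
      rewrite <- R1. apply op_arg_eq. do 2 f_equal. lia.
Qed.
End Division.

Lemma fpow_nonzero (f : C -> C) (e : nat) : inM f -> (exists z, inH z /\ f z <> 0%C) ->
  inM (fpow f e) /\ exists z, inH z /\ fpow f e z <> 0%C.
Proof.
  intros Hf Hn. induction e as [|e [IH1 IH2]].
  - destruct Hn as (z & Hz & _). split; [apply (inM_const 1)|]. exists z. split; auto.
    apply RtoC_neq0. lra.
  - change (fpow f (S e)) with (fmul f (fpow f e)). split; [apply inM_mul; auto|apply inM_domain; auto].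
Qed.

Lemma fpow_eqH (f g : C -> C) (e : nat) (z : C) : f z = g z -> fpow f e z = fpow g e z.
Proof. unfold fpow. intros ->. reflexivity. Qed.

Theorem theorem3p10 :
  forall (i j : nat) (m n l : Z) (a b : Op) (ta tb d a' b' : C -> C),
    (j <= i)%nat -> (0 <= m)%Z -> (0 <= n)%Z ->
    inR n a -> inR m b ->
    has_ord_top a i ta -> has_ord_top b j tb ->
    inMk l d ->
    inMk (n - 2 * Z.of_nat i - l)%Z a' ->
    inMk (m - 2 * Z.of_nat j - l)%Z b' ->
    eqH ta (fmul a' d) -> eqH tb (fmul b' d) ->
    let p := ((m - 2 * Z.of_nat j) * (Z.of_nat i - Z.of_nat j + 1) - l - m + n)%Z in
    let q := ((m - 2 * Z.of_nat j) * (Z.of_nat i - Z.of_nat j + 1) - l + n)%Z in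
    let w := ((m - 2 * Z.of_nat j) * (Z.of_nat i - Z.of_nat j)
              + (m - 2 * Z.of_nat j - l))%Z in
    (* (1) top(b)^(i-j) b' a = c b + c' *)
    (exists c c' : Op,
        inR p c /\ has_ord c (i - j)%nat /\ inR q c' /\ ord_lt c' j /\
        op_eq (rcomp n (mul_op (fmul (fpow tb (i - j)%nat) b')) a)
              (op_add (rcomp m c b) c')) /\
    (* (2) a top(b)^(i-j) b' = b c + c' *)
    (exists c c' : Op,
        inR p c /\ has_ord c (i - j)%nat /\ inR q c' /\ ord_lt c' j /\
        op_eq (rcomp w a (mul_op (fmul (fpow tb (i - j)%nat) b')))
              (op_add (rcomp p b c) c')).
Proof.
  intros i j m n l a b ta tb d a' b' Hji _ _ HRa HRb Hta Htb _ Ha' Hb' Eta Etb p q w.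
  (* [ta] and [tb] are exchanged for weighted modular forms that agree with them on the upper half
     plane. *)
  destruct (has_ord_top_DegT n a i ta HRa Hta) as (alpha & Ea & Da).
  destruct (has_ord_top_DegT m b j tb HRb Htb) as (beta & Eb & Db).
  set (e := (i - j)%nat) in *. assert (Ei : i = (j + e)%nat) by (unfold e; lia).
  assert (Ee : (Z.of_nat i - Z.of_nat j)%Z = Z.of_nat e) by lia.
  set (mu := (m - 2 * Z.of_nat j)%Z) in *.
  assert (Hbeta := proj1 Db). fold mu in Hbeta.
  assert (Hbetae := inMk_fpow mu beta e Hbeta).
  assert (Nbeta : exists z, inH z /\ beta z <> 0%C).
  { destruct Htb as (_ & _ & _ & Hn & _). apply mul_op_nonzero in Hn. destruct Hn as (z & Hz & Hn).
    exists z. rewrite Eb; auto. }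
  assert (Na' : exists z, inH z /\ a' z <> 0%C).
  { destruct Hta as (_ & _ & _ & Hn & _). apply mul_op_nonzero in Hn. destruct Hn as (z & Hz & Hn).
    exists z. split; auto. intros E. apply Hn. rewrite Eta by auto. unfold fmul. rewrite E. ring. }
  destruct (fpow_nonzero beta e (inMk_inM _ _ Hbeta) Nbeta) as [Me Ne].
  assert (Da' : DegT n (j + e) a alpha) by (rewrite <- Ei; exact Da).
  assert (Ha'e : inMk (n - 2 * Z.of_nat (j + e) - l) a') by (rewrite <- Ei; exact Ha').
  (* Both sides equal a' b' d. *)
  assert (Ecross : forall z, inH z -> (b' z * alpha z = a' z * beta z)%C).
  { intros z Hz. rewrite Ea, Eb, Eta, Etb by auto. unfold fmul. ring. }
  split.
  - assert (Hst := left_step b beta m j Db a n e alpha b' a' l Da' Hb' Ha'e Ecross).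
    destruct (left_division b beta m j Db e _ _ Hst) as (c1 & c1' & C1 & C2 & C3).
    fold mu in C1, C2.
    assert (Hc : DegT p e (op_add c1 (lmul (fpow beta e) (monom a' e))) (fmul (fpow beta e) a')).
    { apply (left_quotient_DegT c1 e p (Z.of_nat e * mu)).
      - eapply Deg_cast; [exact C1|unfold p; rewrite Ee; lia|auto].
      - exact Hbetae.
      - eapply inMk_cast; [exact Ha'|unfold p; rewrite Ee; lia]. }
    (* The top beta^e a' is a product of nonzero modular forms, hence nonzero, and the order is
       exactly [e]. *)
    destruct (DegT_realize p e _ _ Hc (inM_domain _ _ Me (inMk_inM _ _ Ha') Ne Na')) as (c & R1 & R2 & R3).
    destruct (Deg_realize q j c1') as (c' & R1' & R2' & R3').
    { eapply Deg_cast; [exact C2|unfold q; rewrite Ee; lia|auto]. }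
    exists c, c'. do 4 (split; auto). intros n' f Hf z Hz.
    assert (Hbf : holo (b n' f)) by (eapply Deg_holo; [exact (DegT_Deg _ _ _ _ Db)|exact Hf]).
    unfold op_add at 1, rcomp, mul_op. rewrite <- R3, <- R3' by auto. unfold op_add, lmul, monom, fmul.
    rewrite (fpow_eqH tb beta) by (symmetry; auto).
    transitivity (fpow beta e z * (b' z * a n' f z - a' z * dpow e (n' + IZR m)%R (b n' f) z)
        + fpow beta e z * (a' z * dpow e (n' + IZR m)%R (b n' f) z))%C; [ring|].
    rewrite C3 by auto. ring.
  - assert (Hst := right_step b beta m j Db a n e alpha b' a' l Da' Hb' Ha'e
      ltac:(intros z Hz; unfold fmul; rewrite (Cmult_comm (alpha z)), (Cmult_comm (beta z)); auto)).
    destruct (right_division b beta m j Db e _ _ Hst) as (c1 & c1' & C1 & C2 & C3).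
    fold mu in C1, C2, C3.
    set (wc := (Z.of_nat e * mu + (n + (mu - l)) - m)%Z) in *.
    assert (Hwc : wc = p) by (unfold wc, p; rewrite Ee; lia).
    assert (Hc : DegT p e (op_add c1 (rcomp (Z.of_nat e * mu) (monom a' e) (mul_op (fpow beta e)))) (fmul a' (fpow beta e))).
    { apply right_quotient_DegT.
      - rewrite <- Hwc. exact C1.
      - exact Hbetae.
      - eapply inMk_cast; [exact Ha'|unfold p; rewrite Ee; lia]. }
    destruct (DegT_realize p e _ _ Hc (inM_domain _ _ (inMk_inM _ _ Ha') Me Na' Ne)) as (c & R1 & R2 & R3).
    destruct (Deg_realize q j c1') as (c' & R1' & R2' & R3').
    { eapply Deg_cast; [exact C2|unfold q; rewrite Ee; lia|auto]. }
    exists c, c'. do 4 (split; auto). intros n' f Hf z Hz.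
    assert (RC := right_combine b beta m j Db a c1 c1' e n l wc b' a' (fpow beta e) (Z.of_nat e * mu)
      Hbetae Hb' Ha'e ltac:(unfold wc, mu; lia) (ex_intro (fun N => Deg wc N c1) _ C1)
      (ex_intro (fun N => Deg n N a) _ (DegT_Deg _ _ _ _ Da)) C3 n' f z Hf Hz).
    fold mu in RC. unfold op_add at 1, rcomp. rewrite <- R3' by auto.
    transitivity (a (n' + IZR (mu - l + Z.of_nat e * mu))%R (fun z => fmul b' (fpow beta e) z * f z)%C z).
    + rewrite (op_arg_eq a (n' + IZR w) (n' + IZR (mu - l + Z.of_nat e * mu))).
      (* [tb] and [beta] agree only on the upper half plane and stand in the argument of [a], so
         locality of [a] is what permits the exchange. *)
      * apply (Deg_local _ _ _ (DegT_Deg _ _ _ _ Da)); auto.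
        -- apply (holo_ext (fun z => fmul b' (fpow beta e) z * f z)%C).
           ++ intros z' Hz'. unfold mul_op, fmul. rewrite (fpow_eqH tb beta) by (symmetry; auto). ring.
           ++ apply (holo_mult (fmul b' (fpow beta e))); auto.
              apply holo_mult; [eapply inMk_holo; eauto|eapply inM_holo; eauto].
        -- intros z' Hz'. unfold mul_op, fmul. rewrite (fpow_eqH tb beta) by (symmetry; auto). ring.
      * do 2 f_equal. unfold w. rewrite Ee. lia.
    + rewrite RC, Hwc. f_equal.
      (* Likewise the quotient is exchanged for its normal form inside the argument of [b]. *)
      apply (Deg_local _ _ _ (DegT_Deg _ _ _ _ Db)); auto.
      * eapply Deg_holo; [exact (DegT_Deg _ _ _ _ Hc)|exact Hf].
      * intros z' Hz'. apply R3; auto.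
Qed.
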